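(* Let $K, L \subset \mathbb{R}^n$ be convex bodies. Then there exists $b(n) \in \big(n^2 - n + \frac12,\ n^2 - n + \frac12 + \frac{11}{10n}\big)$, depending only on $n$, such that $$d_{BM}(K,L) \leq b(n).$$ Numerical values of the current best known upper bounds on the diameter of the Banach--Mazur compactum for $2 \leq n \leq 8$ are (approximately): $2.62$ for $n=2$; $6.86$ for $n=3$; $12.76$ for $n=4$; $20.7$ for $n=5$; $30.66$ for $n=6$; $42.63$ for $n=7$; $56.61$ for $n=8$. The values for $3 \leq n \leq 8$ are those of $b(n)$; the value for $n=2$ is the previously known bound of Brodiuk, Palko, and Prymak.
   Context: A convex body in $\mathbb{R}^n$ is a compact convex set with non-empty interior. The Banach--Mazur distance between convex bodies $K, L \subset \mathbb{R}^n$ is $d_{BM}(K,L) = \inf\{\rho \geq 0 : u + K \subset AL \subset v + \rho K \text{ for some invertible } A \in \mathbb{R}^{n\times n} \text{ and } u,v \in \mathbb{R}^n\}$. The diameter of the Banach--Mazur compactum in dimension $n$ is the maximal value of $d_{BM}(K,L)$ over all convex bodies $K, L \subset \mathbb{R}^n$. *)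

(* Defs.v *)
From HB Require Import structures.
From mathcomp Require Import all_boot all_order all_algebra.
From mathcomp Require Import all_classical all_reals all_analysis.

Set Implicit Arguments.
Unset Strict Implicit.
Unset Printing Implicit Defensive.

Import Order.TTheory GRing.Theory Num.Theory.
Import numFieldNormedType.Exports.

Local Open Scope classical_set_scope.
Local Open Scope ring_scope.

(* R^n is the space of column vectors, so that matrices act on the left. *)
Definition convex_body (R : realType) (n : nat) (K : set 'cV[R]_n) : Prop :=
  [/\ compact K, convex_set K & K° !=set0].

(* u + K `<=` A L `<=` v + rho K for some invertible A and some u, v *)
Definition BM_admissible (R : realType) (n : nat) (K L : set 'cV[R]_n)
    (rho : R) : Prop :=
  0 <= rho /\
  exists (A : 'M[R]_n) (u v : 'cV[R]_n),
    [/\ A \in unitmx,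
        [set u + x | x in K] `<=` [set A *m y | y in L] &
        [set A *m y | y in L] `<=` [set v + rho *: x | x in K]].

(* The infimum is taken in the extended reals, so that an empty set of
   admissible factors would give +oo, not the default value 0 of inf. *)
Definition BM_distance (R : realType) (n : nat) (K L : set 'cV[R]_n) : \bar R :=
  ereal_inf [set rho%:E | rho in [set rho : R | BM_admissible K L rho]].

(* The maximum is written as a supremum, so that an upper bound on the diameter
   does not depend on the maximum being attained. *)
Definition BM_diameter (R : realType) (n : nat) : \bar R :=
  ereal_sup [set d | exists K L : set 'cV[R]_n,
    [/\ convex_body K, convex_body L & d = BM_distance K L]].

(* Main.v *)
Require Import Defs.
From HB Require Import structures.
From mathcomp Require Import all_boot all_order all_algebra.
From mathcomp Require Import perm finmap.
From mathcomp Require Import all_classical all_reals all_analysis.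
From mathcomp Require Import ring lra zify ssrZ.
From Stdlib Require ZArith.

(** A bound for the distance comes from two affine maps in opposite
    directions: one sends [L] into [K], the other sends [K] into [L], and in
    barycentric coordinates of a frame of [K] and a frame of [L] they act as
    [s] and [s'] times the identity, up to translations.  Then the distance is
    at most [1 / (s s')] ([frames_admissible]).  Frames are chosen in two ways.

    In dimension [n <> 2], put [lam := b n / n].  If one of the two bodies, say
    [K], lies in a translate of [- lam K], the volume argument applies: an affine
    copy [L1] of [L] of maximal volume in [K] satisfies [K <= t - n L1]
    ([maximal_copy_cover]), and one reflection turns the negative homothety into
    a positive one, so that the distance is at most [n lam = b n]
    ([reflection_distance]).  If neither body has this property, both are near a
    simplex.  Indeed, by duality a body [K] outside all translates of [- lam K]
    with [lam > n - 1] has affine coordinates [b_0, ..., b_n], nonnegative on [K]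
    and of sum one, whose maxima on [K] are attained at points [p_i] with
    [b_i (p_i) = 1 - d_i] and [sum d_i < e := n - lam]
    ([asymmetric_coordinates]).  The matrix [(b_j (p_i))] is stochastic and
    diagonally heavy; an estimate of the negative parts of its inverse shows that
    [K] lies in a homothetic copy of the simplex [p_0 ... p_n] of ratio at most
    [g := (1 - e^2 / 2) / (1 - e)] ([stochastic_box]).  Two such bodies are at
    distance at most [g^2] ([sandwiched_distance]).  With
    [b n = n^2 - n + 1/2 + 1/n] for [n >= 9], and the listed values for
    [3 <= n <= 8], one has [g^2 <= b n]; on the line [e = 0] and the second case does
    not occur.

    In the plane, let [v_0 v_1 v_2] be a triangle of maximal area in [K] with
    barycentric coordinates [g_j], and let the depth [m_j] be the maximum of
    [- g_j] on [K], attained at [w_j].  Since no triangle in [K] has a larger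
    area, the sorted depths [x >= y >= z] satisfy [x (1 + y) <= 1] and
    [(1 + x) (y + z) <= 1] ([extremal_region]).  The hexagon of the [v_j] and [w_j]
    lies in [K], while [K] lies in the hexagon [- m_j <= g_j <= 1].  So it is
    enough to inscribe the outer hexagon of [L] in the inner one of [K] and
    conversely, with parallel or opposite sides.  A family of inscribed copies
    with parameters [a_j >= 0] gives an explicit ratio ([inscribe]); the
    conditions on the parameters are affine in the depths of [K] and of [L]
    separately.  Hence a choice of the parameters at the vertices of two
    tetrahedra of depths settles all pairs of depths in these tetrahedra, and a
    finite subdivision, checked in integer arithmetic, settles all pairs of bodies
    ([sorted_close], [planar_bound]). *)

Set Implicit Arguments.
Unset Strict Implicit.
Unset Printing Implicit Defensive.

Import Order.TTheory GRing.Theory Num.Theory.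
Import numFieldNormedType.Exports.

Local Open Scope classical_set_scope.
Local Open Scope ring_scope.

(** * Points in homogeneous coordinates and comparison of two frames *)

Section Frames.
Variables (R : realType) (n : nat).
Implicit Types (x y : 'cV[R]_n) (p : 'I_(n + 1) -> 'cV[R]_n).

(** A point as a row of homogeneous coordinates: affine maps act on it by
    multiplication on the right, and affine combinations become linear ones. *)
Definition homog x : 'rV[R]_(n + 1) := row_mx x^T 1%:M.

Definition frame_mx p : 'M[R]_(n + 1) := \matrix_i homog (p i).

Definition bary p x : 'rV[R]_(n + 1) := homog x *m invmx (frame_mx p).

Lemma homog_sum (I : finType) (w : I -> R) (q : I -> 'cV[R]_n) :
  \sum_i w i = 1 -> homog (\sum_i w i *: q i) = \sum_i w i *: homog (q i).
Proof.
move=> w1; rewrite /homog; apply/rowP => k.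
rewrite summxE; case: (split_ordP k) => j ->.
  rewrite row_mxEl mxE summxE; apply: eq_bigr => i _.
  by rewrite !mxE (unsplitK (inl j)) !mxE.
rewrite row_mxEr.
under eq_bigr => i _ do rewrite mxE row_mxEr.
by rewrite -mulr_suml w1 mul1r.
Qed.

Lemma homog_inj : injective homog.
Proof. by move=> x y /eq_row_mx[/(congr1 trmx)]; rewrite !trmxK. Qed.

Lemma rowsum_frame (w : 'rV[R]_(n + 1)) p :
  w *m frame_mx p = row_mx (\sum_j w 0 j *: p j)^T (\sum_j w 0 j)%:M.
Proof.
rewrite mulmx_sum_row; apply/rowP => k; rewrite summxE.
case: (split_ordP k) => j ->.
  rewrite row_mxEl mxE summxE; apply: eq_bigr => i _.
  by rewrite rowK mxE row_mxEl !mxE.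
rewrite row_mxEr ord1 mxE eqxx mulr1n; apply: eq_bigr => i _.
by rewrite rowK mxE row_mxEr !mxE eqxx mulr1.
Qed.

Section Unit.
Variables (p : 'I_(n + 1) -> 'cV[R]_n) (pU : frame_mx p \in unitmx).

Lemma bary_frame x : bary p x *m frame_mx p = homog x.
Proof. by rewrite /bary mulmxKV. Qed.

Lemma bary_sum x : \sum_j bary p x 0 j = 1.
Proof.
have := bary_frame x; rewrite rowsum_frame /homog => /eq_row_mx[_].
by move/matrixP/(_ 0 0); rewrite !mxE eqxx !mulr1n.
Qed.

Lemma bary_point x : \sum_j bary p x 0 j *: p j = x.
Proof.
have := bary_frame x; rewrite rowsum_frame /homog => /eq_row_mx[+ _].
by move/(congr1 trmx); rewrite !trmxK.
Qed.

Lemma bary_uniq (w : 'rV[R]_(n + 1)) x :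
  \sum_j w 0 j = 1 -> \sum_j w 0 j *: p j = x -> bary p x = w.
Proof.
move=> w1 wx; have: w *m frame_mx p = homog x by rewrite rowsum_frame wx w1.
by rewrite /bary => <-; rewrite mulmxK.
Qed.

Lemma bary_comb (I : finType) (w : I -> R) (q : I -> 'cV[R]_n) :
  \sum_i w i = 1 -> bary p (\sum_i w i *: q i) = \sum_i w i *: bary p (q i).
Proof.
move=> w1; rewrite /bary homog_sum // mulmx_suml.
by apply: eq_bigr => i _; rewrite scalemxAl.
Qed.

Lemma bary_vertex i j : bary p (p i) 0 j = (i == j)%:R.
Proof.
rewrite (@bary_uniq (delta_mx 0 i)).
- by rewrite mxE eqxx eq_sym.
- rewrite (bigD1 i) //= mxE !eqxx big1 ?addr0 // => k ki.
  by rewrite mxE eqxx (negbTE ki).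
- rewrite (bigD1 i) //= mxE !eqxx scale1r big1 ?addr0 // => k ki.
  by rewrite mxE eqxx (negbTE ki) scale0r.
Qed.

End Unit.

(** The affine map that sends the frame [p'] to the frame [p] has matrix
    [(frame_mx p')^-1 *m frame_mx p] on homogeneous coordinates; it fixes the last
    column, whence its linear part [M] and its translation [c]. *)
Lemma frames_affine p p' :
  frame_mx p \in unitmx -> frame_mx p' \in unitmx ->
  exists M : 'M[R]_n, exists c : 'cV[R]_n, M \in unitmx /\
    forall x, \sum_j bary p' x 0 j *: p j = M *m x + c.
Proof.
move=> pU p'U; pose N := invmx (frame_mx p') *m frame_mx p.
have NU : N \in unitmx by rewrite unitmx_mul unitmx_inv p'U.
have last q : frame_mx q *m col_mx 0 1%:M = const_mx 1 :> 'cV[R]_(n + 1).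
  apply/row_matrixP => i; rewrite row_mul rowK /homog mul_row_col mulmx0 add0r.
  by rewrite mulmx1; apply/rowP => k; rewrite !mxE ord1 eqxx.
have Nlast : N *m col_mx 0 1%:M = col_mx 0 1%:M :> 'cV[R]_(n + 1).
  by rewrite /N -mulmxA last -(last p') mulKmx.
have [Nur Ndr] : ursubmx N = 0 /\ drsubmx N = 1%:M.
  move: Nlast; rewrite -{1}[N]submxK mul_block_col !mulmx0 !mulmx1 !add0r.
  by move/eq_col_mx.
have EN : N = block_mx (ulsubmx N) 0 (dlsubmx N) 1%:M.
  by rewrite -{1}[N]submxK Nur Ndr.
exists (ulsubmx N)^T, (dlsubmx N)^T; split.
  rewrite unitmx_tr; move: NU; rewrite EN block_mxKul.
  by rewrite !unitmxE det_lblock det1 mulr1.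
move=> x; apply: homog_inj.
have E : bary p' x *m frame_mx p = homog x *m N by rewrite /bary mulmxA.
move: E; rewrite rowsum_frame bary_sum // -/(homog _) => ->.
rewrite EN block_mxKul block_mxKdl /homog mul_row_block mulmx0 add0r !mul1mx.
by rewrite linearD /= trmx_mul !trmxK.
Qed.

End Frames.

Section Distance.
Variables (R : realType) (n : nat).
Implicit Types (K L : set 'cV[R]_n) (p : 'I_(n + 1) -> 'cV[R]_n).

Lemma BM_distance_le K L (rho r : R) :
  BM_admissible K L rho -> rho <= r -> (BM_distance K L <= r%:E)%E.
Proof.
move=> a rr; apply: (@le_trans _ _ rho%:E); last by rewrite lee_fin.
by apply: ereal_inf_lbound; exists rho.
Qed.

(** In the coordinates of the two frames both maps are homotheties, so that
    their composition has ratio [s * s'].  Only the product has to be positive: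
    both maps may reverse the frames. *)
Lemma frames_admissible K L p p' (s s' : R) (a a' : 'I_(n + 1) -> R) :
  frame_mx p \in unitmx -> frame_mx p' \in unitmx -> 0 < s * s' ->
  (forall y, L y -> K (\sum_j (s * bary p' y 0 j + a j) *: p j)) ->
  (forall x, K x -> L (\sum_j (s' * bary p x 0 j + a' j) *: p' j)) ->
  \sum_j a' j = 1 - s' ->
  BM_admissible K L (s * s')^-1.
Proof.
move=> pU p'U ss0 HL HK a's; split; first by rewrite invr_ge0 ltW.
have [M [c [MU Mc]]] := frames_affine pU p'U.
have [s0 s'0] : s != 0 /\ s' != 0.
  by apply/andP; rewrite -negb_or -mulf_eq0 gt_eqF.
pose u := \sum_j a' j *: p j; pose v := \sum_j a j *: p j.
exists (s'^-1 *: M), (s'^-1 *: (u - c)), (- (s'^-1 *: c) - (s * s')^-1 *: v); split.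
- by rewrite unitmxZ // unitfE invr_eq0.
- move=> _ [x Kx <-]; exists (\sum_j (s' * bary p x 0 j + a' j) *: p' j); first exact: HK.
  set y := \sum_j _.
  have By : bary p' y = s' *: bary p x + \row_j a' j.
    have E j : (s' *: bary p x + \row_j a' j) 0 j = s' * bary p x 0 j + a' j.
      by rewrite mxE [X in X + _]mxE [X in _ + X]mxE.
    apply: bary_uniq => //.
      under eq_bigr do rewrite E.
      by rewrite big_split /= -mulr_sumr bary_sum // a's mulr1 addrC subrK.
    by apply: eq_bigr => j _; rewrite E.
  have Ey : M *m y + c = s' *: x + u.
    rewrite -Mc By -[in RHS](bary_point pU x) scaler_sumr -big_split /=.
    apply: eq_bigr => j _; rewrite mxE [X in X + _]mxE [X in _ + X]mxE.
    by rewrite scalerDl scalerA.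
  rewrite -scalemxAl; have -> : M *m y = s' *: x + u - c by rewrite -Ey addrK.
  by rewrite -addrA scalerDr scalerA mulVf // scale1r [RHS]addrC.
- move=> _ [y Ly <-]; exists (\sum_j (s * bary p' y 0 j + a j) *: p j); first exact: HL.
  have -> : \sum_j (s * bary p' y 0 j + a j) *: p j = s *: (M *m y + c) + v.
    rewrite -Mc scaler_sumr -big_split /=.
    by apply: eq_bigr => j _; rewrite scalerDl scalerA.
  rewrite -scalemxAl; move: (M *m y) => z.
  by apply/matrixP => i j; rewrite !mxE; field; rewrite s0 s'0.
Qed.

End Distance.

(** * Compactness, maximal frames, convex combinations *)

Section Compactness.
Variables (R : realType) (n N : nat).
Local Notation E := 'cV[R]_n.
Local Notation X := (prod_topology (fun _ : 'I_N => E)).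
Implicit Types q : X.

Lemma coord_cont (i : 'I_N) (j : 'I_n) : continuous (fun q : X => q i j 0 : R).
Proof.
move=> q; have h : (proj i : X -> E) r @[r --> q] --> proj i q by exact: proj_continuous.
have := continuous_comp h (@coord_continuous R n 1 j 0 (proj i q)).
exact.
Qed.

Lemma sum_cont (T : topologicalType) (I : Type) (r : seq I) (P : pred I) (f : I -> T -> R) :
  (forall i, continuous (f i)) -> continuous (fun x => \sum_(i <- r | P i) f i x).
Proof.
by move=> fc; apply: continuous_big => [|i _]; [exact: add_continuous|exact: fc].
Qed.

Lemma prod_cont (T : topologicalType) (I : Type) (r : seq I) (P : pred I) (f : I -> T -> R) :
  (forall i, continuous (f i)) -> continuous (fun x => \prod_(i <- r | P i) f i x).
Proof.
by move=> fc; apply: continuous_big => [|i _]; [exact: mul_continuous|exact: fc].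
Qed.

(** The topology of column vectors is that of their entries. *)
Lemma col_cont (T : topologicalType) (f : T -> E) :
  (forall j, continuous (fun x => f x j 0 : R)) -> continuous f.
Proof.
move=> fc x; apply/cvg_ballP => e e0.
have h j : \forall y \near x, ball (f x j 0) e (f y j 0).
  by have /cvg_ballP := fc j x; apply.
apply: filterS (filter_forall _ h) => y hy.
by split => // i j; rewrite ord1.
Qed.

Lemma comb_cont (c : 'I_N -> R) : continuous (fun q : X => \sum_i c i *: q i : E).
Proof.
apply: col_cont => j.
rewrite (_ : (fun _ => _) = fun q : X => \sum_i c i * q i j 0); last first.
  by apply/funext => q; rewrite summxE; apply: eq_bigr => i _; rewrite mxE.
apply: sum_cont => i q. apply: (@continuousM R X (fun=> c i) (fun q : X => q i j 0)). exact: cst_continuous. exact: coord_cont. 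
Qed.

(** The tuples with entries in the [C i] form a compact set, by Tychonoff's
    theorem. *)
Lemma tuple_max (C : 'I_N -> set E) (P : set X) (F : X -> R) :
  (forall i, compact (C i)) -> closed P -> continuous F ->
  (exists2 q : X, P q & forall i, C i (q i)) ->
  exists q : X, [/\ P q, forall i, C i (q i) &
    forall r : X, P r -> (forall i, C i (r i)) -> F r <= F q].
Proof.
move=> Cc Pc Fc [q0 Pq0 Cq0]; pose A := [set q : X | forall i, C i (q i)].
have Ac : compact (A `&` P) by apply: compact_closedI => //; exact: tychonoff.
have [||q qA qm] := @compact_EVT_max _ R F (A `&` P) _ Ac.
- by exists q0.
- exact: continuous_subspaceT.
rewrite inE in qA; case: qA => Aq Pq; exists q; split=> // r Pr Ar.
by apply: qm; rewrite inE.
Qed.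

End Compactness.

Section MaxFrame.
Variables (R : realType) (n : nat).
Local Notation E := 'cV[R]_n.
Local Notation X := (prod_topology (fun _ : 'I_(n + 1) => E)).
Implicit Types K L : set E.

Lemma det_frame_cont : continuous (fun q : X => \det (frame_mx q) : R).
Proof.
pose D (s : 'S_(n + 1)) (q : X) : R :=
  (-1) ^+ s * \prod_(i < n + 1) frame_mx q i (s i).
apply: (@sum_cont R X _ _ predT D) => s q.
apply: (@continuousM R X (fun=> (-1) ^+ s)); first exact: cst_continuous.
move: q; apply: (@prod_cont R X _ _ predT (fun i q => frame_mx q i (s i))) => i.
case: (split_ordP (s i)) => j jE; last first.
  rewrite (_ : (fun _ => _) = fun=> (1%:M : 'M[R]_1) 0 j); first exact: cst_continuous.
  by apply/funext => r; rewrite mxE jE row_mxEr.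
rewrite (_ : (fun _ => _) = fun r : X => r i j 0); first exact: coord_cont.
by apply/funext => r; rewrite mxE jE row_mxEl mxE.
Qed.

Lemma norm_det_frame_cont : continuous (fun q : X => `|\det (frame_mx q)| : R).
Proof.
move=> q; have h := @det_frame_cont q.
have := continuous_comp h (@norm_continuous R R^o _).
exact.
Qed.

(** Small translations of an interior point along the axes stay in [K]. *)
Lemma frame_inside K : K° !=set0 ->
  exists2 q : 'I_(n + 1) -> E, frame_mx q \in unitmx & forall i, K (q i).
Proof.
case=> x /nbhs_ballP[e /= e0 xe].
pose q (i : 'I_(n + 1)) : E :=
  match fintype.split i with inl j => x + (e / 2) *: delta_mx j 0 | inr _ => x end.
have Kq i : K (q i).
  apply: xe; split=> // k l; rewrite /q; case: (fintype.split i) => [j|_]; last exact: ballxx.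
  rewrite !mxE /ball /= opprD addrA subrr sub0r normrN ord1 eqxx andbT.
  by case: (k == j); rewrite ?mulr1 ?mulr0 ?normr0 // ger0_norm; lra.
exists q => //.
have E1 : frame_mx q = block_mx ((e / 2)%:M + const_mx 1 *m x^T) (const_mx 1) x^T 1%:M.
  apply/matrixP => i k; rewrite mxE /homog /q.
  case: (split_ordP i) => j ->; rewrite ?(unsplitK (inl j)) ?(unsplitK (inr j));
    case: (split_ordP k) => l ->; rewrite ?row_mxEl ?row_mxEr ?block_mxEul ?block_mxEur
      ?block_mxEdl ?block_mxEdr ?ord1 ?mxE //.
  by rewrite big_ord1 !mxE eqxx andbT mul1r addrC eq_sym mulr_natr.
have E2 : frame_mx q = block_mx (e / 2)%:M (const_mx 1) 0 1%:M *m block_mx 1%:M 0 x^T 1%:M.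
  by rewrite mulmx_block !mulmx1 !mulmx0 ?mul0mx !mul1mx !add0r E1.
rewrite unitmxE E2 det_mulmx det_ublock det_lblock !det1 !mulr1 det_scalar.
by rewrite unitfE expf_neq0 // gt_eqF // divr_gt0.
Qed.

Lemma bary_cont (v : 'I_(n + 1) -> E) j : continuous (fun x : E => bary v x 0 j : R).
Proof.
rewrite (_ : (fun _ => _) = fun x : E => \sum_k homog x 0 k * invmx (frame_mx v) k j);
  last by apply/funext => x; rewrite mxE.
apply: sum_cont => k x; apply: (@continuousM R E (fun x : E => homog x 0 k) (fun=> _));
  last exact: cst_continuous.
case: (split_ordP k) => l ->.
  rewrite (_ : (fun _ => _) = fun x : E => x l 0); first exact: coord_continuous.
  by apply/funext => y; rewrite row_mxEl mxE.
rewrite (_ : (fun _ => _) = fun x : E => (1%:M : 'M[R]_1) 0 l); first exact: cst_continuous.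
by apply/funext => y; rewrite row_mxEr.
Qed.

End MaxFrame.

Section Convexity.
Variables (R : realType) (n : nat).
Implicit Types K : set 'cV[R]_n.

Lemma convex_pair K x y (a b : R) : convex_set K -> K x -> K y ->
  0 <= a -> 0 <= b -> a + b = 1 -> K (a *: x + b *: y).
Proof.
move=> cK Kx Ky a0 b0 ab; have a1 : a <= 1 by rewrite -ab lerDl.
have := cK x y (Itv01 a0 a1) (mem_set Kx) (mem_set Ky).
rewrite inE /conv /=.
have -> : b = 1 - a by rewrite -ab addrAC subrr add0r.
exact.
Qed.

Lemma convex_sum K (I : finType) (w : I -> R) (q : I -> 'cV[R]_n) : convex_set K ->
  (forall i, 0 <= w i) -> \sum_i w i = 1 -> (forall i, K (q i)) ->
  K (\sum_i w i *: q i).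
Proof.
move=> cK w0 w1 Kq.
have [i0 _] : exists i : I, true.
  apply/existsP; rewrite -[X in is_true X]negbK; apply/negP => /existsPn h.
  by move/eqP: w1; rewrite big1 1?eq_sym ?oner_eq0 // => i; have := h i.
suff [x Kx ->] : exists2 x, K x & \sum_i w i *: q i = (\sum_i w i) *: x.
  by rewrite w1 scale1r.
elim: (index_enum I) => [|i r [x Kx IH]].
  by exists (q i0) => //; rewrite !big_nil scale0r.
rewrite !big_cons IH; set W := \sum_(j <- r) w j.
have W0 : 0 <= W by apply: sumr_ge0.
have [s0|s0] := eqVneq (w i + W) 0.
  move: s0 => /eqP; rewrite paddr_eq0 // => /andP[/eqP-> /eqP->].
  by exists (q i0) => //; rewrite addr0 !scale0r addr0.
have sW : 0 < w i + W by rewrite lt_neqAle eq_sym s0 addr_ge0.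
exists ((w i / (w i + W)) *: q i + (W / (w i + W)) *: x).
  apply: convex_pair; rewrite ?divr_ge0 // 1?ltW //.
  by rewrite -mulrDl divff.
by rewrite scalerDr !scalerA ![(w i + W) * _]mulrC !divfK.
Qed.

End Convexity.

(** * Separation of compact convex sets without a common point *)

Section Separation.
Variables (R : realType) (n : nat).
Local Notation E := 'cV[R]_n.
Implicit Types (K L : set E) (f : 'rV[R]_n).

Lemma sub_cont (T : topologicalType) (g h : T -> R) : continuous g -> continuous h ->
  continuous (fun x => g x - h x).
Proof. by move=> gc hc x; apply: (@cvgB _ R^o); [exact: gc|exact: hc]. Qed.

Definition form_at f (x : E) : R := (f *m x) 0 0.

Lemma form_atD f x y : form_at f (x + y) = form_at f x + form_at f y.
Proof. by rewrite /form_at mulmxDr mxE. Qed.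

Lemma form_atZ f a x : form_at f (a *: x) = a * form_at f x.
Proof. by rewrite /form_at -scalemxAr mxE. Qed.

Lemma form_at_sum (I : finType) f (w : I -> R) (q : I -> E) :
  form_at f (\sum_i w i *: q i) = \sum_i w i * form_at f (q i).
Proof.
rewrite /form_at mulmx_sumr summxE; apply: eq_bigr => i _.
by rewrite -scalemxAr mxE.
Qed.

Lemma form_atE f x : form_at f x = \sum_k f 0 k * x k 0.
Proof. by rewrite /form_at mxE. Qed.

(** If [B] were negative, the quadratic would be negative at
    [t := - B / (Q + 1 - B)]. *)
Lemma first_variation (B Q : R) : 0 <= Q ->
  (forall t, 0 <= t <= 1 -> 0 <= 2 * t * B + t ^+ 2 * Q) -> 0 <= B.
Proof.
move=> Q0 h; rewrite leNgt; apply/negP => B0.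
have d0 : 0 < Q + 1 - B by lra.
pose t := - B / (Q + 1 - B).
have t0 : 0 < t by rewrite divr_gt0 // oppr_gt0.
have t1 : t <= 1 by rewrite ler_pdivrMr // mul1r; lra.
have tE : t * (Q + 1 - B) = - B by rewrite divfK // gt_eqF.
have := h t; rewrite (ltW t0) t1 => /(_ isT).
have -> : 2 * t * B + t ^+ 2 * Q = t * (B + (B + t * Q)) by ring.
rewrite pmulr_rge0 // => h1.
have tB : t * B <= 0 by rewrite mulr_ge0_le0 // ltW.
by lra.
Qed.

(** The polar form of [\sum_(i, j) |z i - z j|^2]. *)
Definition spread N (z d : 'I_N -> E) : R :=
  \sum_(p : 'I_N * 'I_N * 'I_n) (z p.1.1 p.2 0 - z p.1.2 p.2 0) * (d p.1.1 p.2 0 - d p.1.2 p.2 0).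

Lemma spread_line N (z d : 'I_N -> E) t :
  spread (fun i => z i + t *: d i) (fun i => z i + t *: d i) =
  spread z z + (2 * t * spread z d + t ^+ 2 * spread d d).
Proof.
rewrite /spread !mulr_sumr -!big_split; apply: eq_bigr => p _ /=; rewrite !mxE; ring.
Qed.

Lemma spread_pair N (z d : 'I_N -> E) :
  spread z d = 2 * \sum_i form_at (\row_k \sum_j (z i k 0 - z j k 0)) (d i).
Proof.
pose T (i j : 'I_N) k := (z i k 0 - z j k 0) * d i k 0.
have -> : spread z d = \sum_i \sum_j \sum_k (T i j k + T j i k).
  rewrite pair_bigA /= pair_bigA /=; apply: eq_bigr => -[[i j] k] _ /=; rewrite /T; ring.
under eq_bigr do under eq_bigr do rewrite big_split.
under eq_bigr do rewrite big_split.
rewrite big_split /= [X in _ + X]exchange_big /=.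
suff -> : \sum_i form_at (\row_k \sum_j (z i k 0 - z j k 0)) (d i) =
  \sum_i \sum_j \sum_k T i j k by rewrite mulr_natl mulr2n.
apply: eq_bigr => i _; rewrite form_atE [RHS]exchange_big; apply: eq_bigr => k _.
by rewrite mxE mulr_suml.
Qed.

(** Choose points of the sets with the least spread.  The first variation of
    the spread at these points is the sum of the functionals
    [f i := \sum_j (z i - z j)]; it is nonnegative towards every other choice, and
    its value at the chosen points is the spread itself, which is positive since
    the sets have no common point. *)
Lemma disjoint_family N (C : 'I_N.+1 -> set E) :
  (forall i, compact (C i)) -> (forall i, convex_set (C i)) -> (forall i, C i !=set0) ->
  ~ (exists c, forall i, C i c) ->
  exists f : 'I_N.+1 -> 'rV[R]_n, \sum_i f i = 0 /\
    forall z, (forall i, C i (z i)) -> 0 < \sum_i form_at (f i) (z i).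
Proof.
move=> Cc Cx C0 nc.
have /choice[z0 z0P] i : exists x, C i x by exact: C0.
have [] := @tuple_max R n N.+1 C setT (fun z => - spread z z).
- exact: Cc.
- exact: closedT.
- rewrite (_ : (fun _ => _) = fun z => 0 - spread z z); last first.
    by apply/funext => z; rewrite sub0r.
  apply: sub_cont; first exact: cst_continuous.
  apply: sum_cont => p z.
  have dc : continuous (fun z : prod_topology (fun _ : 'I_N.+1 => E) =>
      z p.1.1 p.2 0 - z p.1.2 p.2 0 : R) by apply: sub_cont; exact: coord_cont.
  exact: (continuousM (@dc z) (@dc z)).
- by exists z0.
move=> z [_ Cz zm].
pose f i : 'rV[R]_n := \row_k \sum_j (z i k 0 - z j k 0).
have f0 : \sum_i f i = 0.
  apply/rowP => k; rewrite summxE mxE; under eq_bigr do rewrite mxE.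
  under eq_bigr do rewrite sumrB.
  by rewrite sumrB exchange_big /= subrr.
exists f; split => // x Cx'.
have var : 0 <= spread z (fun i => x i - z i).
  apply: (@first_variation _ (spread (fun i => x i - z i) (fun i => x i - z i))).
    by apply: sumr_ge0 => p _; rewrite -expr2 sqr_ge0.
  move=> t /andP[t0 t1].
  have := zm (fun i => z i + t *: (x i - z i)) I.
  rewrite lerN2 spread_line lerDl; apply=> i.
  have -> : z i + t *: (x i - z i) = t *: x i + (1 - t) *: z i.
    by apply/matrixP => a b; rewrite !mxE; ring.
  by apply: convex_pair => //; rewrite ?subr_ge0 // addrC subrK.
have zz : 0 < spread z z.
  rewrite lt_neqAle eq_sym; apply/andP; split; last first.
    by apply: sumr_ge0 => p _; rewrite -expr2 sqr_ge0.
  apply/eqP => /eqP; rewrite psumr_eq0 => [|p _]; last by rewrite -expr2 sqr_ge0.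
  move=> /allP h; apply: nc; exists (z ord0) => i.
  suff <- : z i = z ord0 by exact: Cz.
  apply/colP => k; have := h (i, ord0, k) (mem_index_enum _).
  by rewrite /= -expr2 sqrf_eq0 subr_eq0 => /eqP.
have -> : \sum_i form_at (f i) (x i) =
    \sum_i form_at (f i) (x i - z i) + \sum_i form_at (f i) (z i).
  by rewrite -big_split; apply: eq_bigr => i _ /=; rewrite -form_atD subrK.
move: var zz; rewrite !spread_pair !pmulr_rge0 // !pmulr_rgt0 //.
exact: ltr_wpDl.
Qed.

Lemma finite_disjoint K (C : E -> set E) : K !=set0 ->
  (forall x, K x -> compact (C x)) -> ~ (exists c, forall x, K x -> C x c) ->
  exists N, exists q : 'I_N.+1 -> E, (forall i, K (q i)) /\
    ~ exists c, forall i, C (q i) c.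
Proof.
move=> [x0 Kx0] Cc nc; apply: contrapT => fin.
have := Cc x0 Kx0; rewrite compact_In0 => /(_ _ K (fun x => C x0 `&` C x)).
case.
- exists C => // x Kx; apply: compact_closed (Cc x Kx); exact: norm_hausdorff.
- move=> D DK; apply: contrapT => nD; apply: fin.
  exists #|` D|, (fun i => nth x0 (x0 :: D) i); split.
    case=> -[|i] //= hi; have /DK : nth x0 D i \in D by rewrite mem_nth.
    by rewrite inE.
  case=> c h; apply: nD; exists c => x /= xD; split; first exact: (h ord0).
  have hx : ((index x D).+1 < #|` D|.+1)%N by rewrite ltnS index_mem.
  by have := h (Ordinal hx); rewrite /= nth_index.
move=> c h; apply: nc; exists c => x Kx; by have [] := h x Kx.
Qed.

Lemma form_at_cont f : continuous (form_at f).
Proof.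
rewrite (_ : form_at f = fun x => \sum_k f 0 k * x k 0); last first.
  by apply/funext => x; rewrite form_atE.
apply: sum_cont => k x; apply: (@continuousM R E (fun=> f 0 k) (fun x : E => x k 0)).
  exact: cst_continuous.
exact: coord_continuous.
Qed.

Lemma form_atN f x : form_at (- f) x = - form_at f x.
Proof. by rewrite /form_at mulNmx mxE. Qed.

(** [K] lies in a translate of [- lam L] exactly when the sets [x + lam L], for
    [x] in [K], have a common point.  If not, finitely many of them have none, and
    the signs of the separating functionals are reversed in order to speak of the
    maxima of [f i] on [L]. *)
Lemma homothety_separation K L (lam : R) : K !=set0 -> compact L -> convex_set L ->
  L !=set0 -> ~ (exists c, forall x, K x -> exists2 y, L y & c = x + lam *: y) ->
  exists N, exists q : 'I_N.+1 -> E, exists f : 'I_N.+1 -> 'rV[R]_n,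
  exists y : 'I_N.+1 -> E,
  [/\ forall i, K (q i), \sum_i f i = 0,
      forall i, L (y i) /\ forall x, L x -> form_at (f i) x <= form_at (f i) (y i) &
      lam * \sum_i form_at (f i) (y i) + \sum_i form_at (f i) (q i) < 0].
Proof.
move=> K0 Lc Lx L0 nc.
pose C x := [set x + lam *: y | y in L].
have Cc x : compact (C x).
  apply: continuous_compact => //; apply/continuous_subspaceT/col_cont => j.
  rewrite (_ : (fun _ => _) = fun y : E => x j 0 + lam * y j 0); last first.
    by apply/funext => y; rewrite !mxE.
  move=> y; apply: (@continuousD R R^o E (fun=> x j 0) (fun y : E => lam * y j 0)).
    exact: cst_continuous.
  apply: (@continuousM R E (fun=> lam) (fun y : E => y j 0)).
    exact: cst_continuous.
  exact: coord_continuous.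
have Cx x : convex_set (C x).
  move=> a b t; rewrite !inE => -[a' La <-] [b' Lb <-].
  exists (conv t (a' : convex_lmodType _) (b' : convex_lmodType _)).
    by have := Lx a' b' t; rewrite !inE; apply.
  rewrite /conv /=. rewrite /unstable.onem; move: (t%:num) => s; apply/matrixP => i j; rewrite !mxE; ring.
have [x _||N [q [Kq nq]]] := @finite_disjoint K C K0; first exact: Cc.
  by case=> c h; apply: nc; exists c => x /h[y Ly <-]; exists y.
have [||g [g0 gP]] := @disjoint_family N (C \o q) (fun i => Cc (q i)) (fun i => Cx (q i)).
- by move=> i; case: L0 => y Ly; exists (q i + lam *: y), y.
- by [].
have /choice[y yP] i : exists y, L y /\ forall x, L x -> form_at (g i) y <= form_at (g i) x.
  have [||x xL xm] := @compact_EVT_min _ R (form_at (g i)) L _ Lc => //.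
    exact/continuous_subspaceT/form_at_cont.
  by rewrite inE in xL; exists x; split=> // z Lz; apply: xm; rewrite inE.
exists N, q, (fun i => - g i), y; split=> //.
- by rewrite sumrN g0 oppr0.
- by move=> i; have [Ly h] := yP i; split=> // x Lx'; rewrite !form_atN lerN2 h.
have := gP (fun i => q i + lam *: y i); have Cy i : C (q i) (q i + lam *: y i).
  by exists (y i) => //; have [] := yP i.
move=> /(_ Cy); under eq_bigr do rewrite form_atD form_atZ.
rewrite big_split /= -mulr_sumr => h.
under eq_bigr do rewrite form_atN; rewrite sumrN.
under [X in _ + X]eq_bigr do rewrite form_atN; rewrite sumrN.
by lra.
Qed.

End Separation.

(** * Copies of maximal volume *)

Section DetGrowth.
Variable R : realType.

Lemma poly_bounded (q : {poly R}) : exists2 C, 0 < C &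
  forall t, 0 <= t <= 1 -> `|q.[t]| <= C.
Proof.
exists (1 + \sum_(i < size q) `|q`_i|); first by rewrite ltr_pwDl // sumr_ge0.
move=> t /andP[t0 t1]; rewrite horner_coef; apply: (le_trans (ler_norm_sum _ _ _)).
rewrite addrC; apply: ler_wpDr => //; apply: ler_sum => i _.
by rewrite normrM normrX (ger0_norm t0) ler_piMr // exprn_ile1.
Qed.

(** Writing the polynomial as [1 + t (d + t q)] with [d > 0], the term [t q]
    is smaller than [d] for small [t]. *)
Lemma poly_initial_growth (q : {poly R}) (e : R) : q`_0 = 1 -> 0 < q`_1 -> 0 < e ->
  exists2 t, 0 < t <= e & 1 < q.[t].
Proof.
elim/poly_ind: q => [|q c _]; first by rewrite coef0 => _; rewrite coef0 ltxx.
elim/poly_ind: q => [|q d _].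
  by rewrite mul0r add0r !coefC /= ltxx.
rewrite !coefD !coefMX !coefC /= coefD coefMX !coefC /= !add0r addr0 => -> d0 e0.
have [C C0 qC] := poly_bounded q.
pose t := Num.min (Num.min e 1) (d / (2 * C)).
have t0 : 0 < t by rewrite !lt_min e0 ltr01 divr_gt0 ?mulr_gt0.
have te : t <= e by rewrite !ge_min lexx.
have t1 : t <= 1 by rewrite !ge_min lexx orbT.
have td : t * C <= d / 2.
  have : t <= d / (2 * C) by rewrite ge_min lexx orbT.
  by rewrite ler_pdivlMr ?mulr_gt0 // mulrCA => h; lra.
exists t; first by rewrite t0.
rewrite !(hornerE, hornerMX) /=; have := qC t; rewrite (ltW t0) t1 => /(_ isT).
rewrite ler_norml => /andP[h _].
have h2 : t * - C <= t * q.[t] by rewrite ler_pM2l.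
have : 0 < (q.[t] * t + d) * t by rewrite mulr_gt0 //; lra.
by lra.
Qed.

Lemma char_poly_horner n (A : 'M[R]_n) x : (char_poly A).[x] = \det (x%:M - A).
Proof.
rewrite -[LHS]/(horner_eval x _) -det_map_mx; congr (\det _).
by apply/matrixP => i j; rewrite !mxE /= /horner_eval !hornerE hornerMn hornerX.
Qed.

(** [\det (1 + t W)] is the reversed characteristic polynomial of [- W], hence
    it starts with [1 + t \tr W]. *)
Lemma det_perturbation n (W : 'M[R]_n) (e : R) : 0 < \tr W -> 0 < e ->
  exists2 t, 0 < t <= e & 1 < \det (1%:M + t *: W).
Proof.
move=> W0 e0; have n0 : (0 < n)%N.
  by case: n W W0 => // W; rewrite /mxtrace big_ord0 ltxx.
pose c := char_poly (- W); pose q := \poly_(i < n.+1) c`_(n - i).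
have szc : size c = n.+1 by rewrite size_char_poly.
have q0 : q`_0 = 1.
  rewrite coef_poly /= subn0; have := char_poly_monic (- W).
  by rewrite monicE lead_coefE size_char_poly => /eqP.
have q1 : q`_1 = \tr W.
  rewrite coef_poly ltnS n0 subn1 char_poly_trace // linearN opprK.
  by [].
have [||t /andP[t0 te] qt] := @poly_initial_growth q e q0; rewrite ?q1 //.
exists t; rewrite ?t0 //; apply: lt_le_trans qt _.
rewrite le_eqVlt; apply/orP; left; apply/eqP.
have tn : t != 0 by rewrite gt_eqF.
have -> : 1%:M + t *: W = t *: (t^-1%:M - - W).
  by rewrite scalerBr scalerN opprK scale_scalar_mx mulfV.
rewrite detZ -char_poly_horner (@horner_coef_wide _ n.+1); last exact: size_poly.
rewrite (@horner_coef_wide _ n.+1 c); last by rewrite szc.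
rewrite mulr_sumr (reindex_inj rev_ord_inj) /=; apply: eq_bigr => i _.
have ni : (i <= n)%N by rewrite -ltnS.
rewrite subSS coef_poly ltnS leq_subr subKn // mulrCA; congr (_ * _).
have E : t ^+ n = t ^+ (n - i) * t ^+ i by rewrite -exprD subnK.
by rewrite exprVn E mulfK // expf_neq0.
Qed.

End DetGrowth.

Section MaximalCopy.
Variables (R : realType) (n : nat).
Local Notation E := 'cV[R]_n.
Local Notation I := 'I_(n + 1).
Implicit Types (K L : set E).

Definition transport (p' v : I -> E) (y : E) : E := \sum_j bary p' y 0 j *: v j.

(** [v] is the image of the frame [p'] of [L] under an affine map that sends
    [L] into [K]; the volume of the copy is proportional to the determinant of the
    frame. *)
Definition maximal_copy K L (p' v : I -> E) :=
  [/\ frame_mx p' \in unitmx, frame_mx v \in unitmx,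
      forall y, L y -> K (transport p' v y) &
      forall w, (forall y, L y -> K (transport p' w y)) ->
        `|\det (frame_mx w)| <= `|\det (frame_mx v)|].

Lemma frame_mx_linear (A : 'M[R]_n) (b : E) (v w : I -> E) :
  (forall i, w i = A^T *m v i + b) ->
  frame_mx w = frame_mx v *m block_mx A 0 b^T 1%:M.
Proof.
move=> wE; apply/row_matrixP => i; rewrite row_mul !rowK /homog wE.
by rewrite mul_row_block mulmx0 add0r !mul1mx linearD /= trmx_mul trmxK.
Qed.

Lemma det_frame_linear (A : 'M[R]_n) (b : E) (v w : I -> E) :
  (forall i, w i = A^T *m v i + b) -> \det (frame_mx w) = \det (frame_mx v) * \det A.
Proof.
by move=> /frame_mx_linear ->; rewrite det_mulmx det_lblock det1 mulr1.
Qed.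

Lemma maximal_copy_exists K L : compact K -> K° !=set0 -> compact L -> L° !=set0 ->
  exists p' v, maximal_copy K L p' v.
Proof.
move=> Kc Ki Lc Li; have [p' p'U Lp'] := frame_inside Li.
have Kcl : closed K by apply: compact_closed => //; exact: norm_hausdorff.
pose P : set (prod_topology (fun _ : I => E)) :=
  \bigcap_(y in L) [set v | K (transport p' v y)].
have Pcl : closed P.
  apply: closed_bigI => y _; have := @closed_comp _ _ _ K (fun v _ => @comb_cont R n (n + 1) (fun j => bary p' y 0 j) v).
  exact.
(* a small copy of L fits in K *)
have [w Pw wU] : exists2 w, P w & frame_mx w \in unitmx.
  have [C [_ LC]] := compact_bounded Lc.
  case: Ki => x /nbhs_ballP[e /= e0 xe].
  pose D := Num.max C 0 + 1.
  have D0 : 0 < D by rewrite ltr_wpDl // le_max lexx orbT.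
  have CD : C < D by rewrite ltr_pwDr // le_max lexx.
  pose t := e / (2 * D).
  have t0 : 0 < t by rewrite divr_gt0 ?mulr_gt0.
  pose w j := t *: p' j + x.
  have wt y : transport p' w y = t *: y + x.
    rewrite /transport /w; under eq_bigr do rewrite scalerDr scalerA mulrC -scalerA.
    by rewrite big_split /= -scaler_sumr -scaler_suml bary_sum // scale1r bary_point.
  exists w.
    move=> y Ly; rewrite /= wt; apply: xe; rewrite -ball_normE /= opprD addrCA subrr addr0 normrN.
    rewrite normrZ gtr0_norm //; apply: (@le_lt_trans _ _ (t * D)).
      by rewrite ler_pM2l // LC.
    have -> : t * D = e / 2 by rewrite /t; field; rewrite gt_eqF.
    by lra.
  rewrite unitmxE (@det_frame_linear t%:M x p' w) ?det_scalar => [|i]; last first.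
    by rewrite tr_scalar_mx mul_scalar_mx.
  by rewrite unitrM -unitmxE p'U unitfE expf_neq0 // gt_eqF.
have PK (u : I -> E) : P u -> forall i, K (u i).
  move=> Pu i; have := Pu _ (Lp' i); rewrite /= /transport (bigD1 i) //= big1.
    by rewrite addr0 bary_vertex // eqxx scale1r.
  by move=> j ji; rewrite bary_vertex // eq_sym (negbTE ji) scale0r.
have [||v [Pv Kv vm]] := @tuple_max R n (n + 1) (fun=> K) P (fun q => `|\det (frame_mx q)|) (fun=> Kc) Pcl.
- exact: norm_det_frame_cont.
- by exists w => //; exact: PK.
exists p', v; split => //.
  rewrite unitmxE unitfE -normr_gt0; apply: lt_le_trans (vm w Pw (PK w Pw)).
  by rewrite normr_gt0 -unitfE -unitmxE.
by move=> u Pu; apply: vm => //; exact: PK.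
Qed.

Lemma transport_comb (p' v : I -> E) (J : finType) (w : J -> R) (q : J -> E) :
  frame_mx p' \in unitmx -> \sum_j w j = 1 ->
  transport p' v (\sum_j w j *: q j) = \sum_j w j *: transport p' v (q j).
Proof.
move=> p'U w1; rewrite /transport; under eq_bigr do rewrite bary_comb // summxE scaler_suml.
rewrite exchange_big; apply: eq_bigr => j _ /=.
by rewrite scaler_sumr; apply: eq_bigr => i _; rewrite mxE scalerA.
Qed.

Lemma transport_cont (p' v : I -> E) : continuous (transport p' v).
Proof.
apply: col_cont => k.
rewrite (_ : (fun _ => _) = fun y => \sum_j bary p' y 0 j * v j k 0); last first.
  by apply/funext => y; rewrite summxE; apply: eq_bigr => j _; rewrite mxE.
apply: sum_cont => j y.
apply: (@continuousM R E (fun y : E => bary p' y 0 j) (fun=> v j k 0)).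
  exact: bary_cont.
exact: cst_continuous.
Qed.

(** Otherwise there are functionals [f i] of sum zero and points [q i] of [K]
    with [n \sum_i h i + \sum_i f i (q i) < 0], where [h i] is the maximum of [f i] on
    the copy.  Moving each point [z] of the copy towards every [q i] with the small
    weight [s (h i - f i z)] is an affine operation, since these weights have the
    constant sum [s H]; it keeps the copy in [K], and the trace of its linear part
    shows that the volume grows. *)
Lemma maximal_copy_cover K L p' v : (0 < n)%N -> convex_body K -> convex_body L ->
  maximal_copy K L p' v ->
  exists t, forall x, K x -> exists2 y, L y & t = x + n%:R *: transport p' v y.
Proof.
move=> n0 [Kc Kx Ki] [Lc Lx Li] [p'U vU LK vm].
have K0 : K !=set0 by case: Ki => x /nbhs_singleton; exists x.
pose L1 := transport p' v @` L.
have L1c : compact L1.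
  by apply: continuous_compact => //; exact/continuous_subspaceT/transport_cont.
have L1x : convex_set L1.
  move=> a b s; rewrite !inE => -[a' La <-] [b' Lb <-].
  have ls : s%:num + (1 - s%:num) = 1 by rewrite addrC subrK.
  have c0 : 0 <= s%:num :> R by [].
  have c1 : 0 <= 1 - s%:num :> R by rewrite subr_ge0.
  pose w (i : bool) := if i then s%:num else 1 - s%:num.
  pose q (i : bool) := if i then a' else b'.
  have := @transport_comb p' v bool w q p'U; rewrite !big_bool /= => /(_ ls) E2.
  exists (s%:num *: a' + (1 - s%:num) *: b'); first exact: convex_pair.
  by rewrite E2 /conv /=.
have L10 : L1 !=set0 by case: Li => y /nbhs_singleton Ly; exists (transport p' v y), y.
apply: contrapT => nt.
have [|N [q [f [y [Kq f0 yP neg]]]]] := @homothety_separation R n K L1 n%:R K0 L1c L1x L10.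
  case=> t h; apply: nt; exists t => x /h[_ [y Ly <-]] ->; by exists y.
pose h i := form_at (f i) (y i); pose H := \sum_i h i.
pose W : 'M[R]_n := - (H%:M + \sum_i (f i)^T *m (q i)^T).
have trW : 0 < \tr W.
  rewrite /W linearN linearD /= mxtrace_scalar linear_sum /=.
  under eq_bigr do rewrite -trmx_mul mxtrace_tr mxtrace_mulC trace_mx11.
  by rewrite oppr_gt0 -mulr_natl; exact: neg.
have e0 : 0 < (`|H| + 1)^-1 by rewrite invr_gt0 ltr_wpDl.
have [s /andP[s0 sH] big] := det_perturbation trW e0.
have sH1 : 0 <= 1 - s * H.
  rewrite subr_ge0; apply: (@le_trans _ _ (s * (`|H| + 1))).
    by rewrite ler_pM2l // (le_trans (ler_norm _)) // lerDl.
  by rewrite -ler_pdivlMr ?div1r // ltr_wpDl.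
pose psi z := (1 - s * H) *: z + s *: \sum_i (h i - form_at (f i) z) *: q i.
have fsum z : \sum_i form_at (f i) z = 0.
  by rewrite /form_at -summxE -mulmx_suml f0 mul0mx mxE.
have psiK z : L1 z -> K (psi z).
  move=> Lz; pose w (i : 'I_1 + 'I_N.+1) :=
    match i with inl _ => 1 - s * H | inr i => s * (h i - form_at (f i) z) end.
  pose r (i : 'I_1 + 'I_N.+1) := match i with inl _ => z | inr i => q i end.
  have := @convex_sum R n K _ w r Kx; rewrite !big_sumType /= !big_ord1.
  have -> : psi z = (1 - s * H) *: z + \sum_i (s * (h i - form_at (f i) z)) *: q i.
    by rewrite /psi scaler_sumr; congr (_ + _); apply: eq_bigr => i _; rewrite scalerA.
  apply.
  - case=> i //=; rewrite mulr_ge0 ?(ltW s0) // subr_ge0.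
    by have [_] := yP i; apply.
  - by rewrite -mulr_sumr sumrB fsum subr0 subrK.
  - by case=> i //=; case: Lz => a La <-; exact: LK.
pose v' j := psi (v j).
have trans z : transport p' v' z = psi (transport p' v z).
  have w1 := bary_sum p'U z; rewrite /transport /v' /psi.
  have comm (a b : R) (x : E) : a *: (b *: x) = b *: (a *: x) by rewrite !scalerA mulrC.
  under eq_bigr do rewrite scalerDr comm [X in _ + X]comm.
  rewrite big_split /= -!scaler_sumr; congr (_ + s *: _).
  transitivity (\sum_j \sum_i (bary p' z 0 j * (h i - form_at (f i) (v j))) *: q i).
    apply: eq_bigr => j _; rewrite scaler_sumr.
    by apply: eq_bigr => i _; rewrite scalerA.
  rewrite exchange_big; apply: eq_bigr => i _ /=.
  under eq_bigr do rewrite mulrBr.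
  by rewrite -scaler_suml sumrB -mulr_suml w1 mul1r form_at_sum.
have /vm : forall z, L z -> K (transport p' v' z).
  by move=> z Lz; rewrite trans; apply: psiK; exists z.
rewrite (@det_frame_linear (1%:M + s *: W) (s *: \sum_i h i *: q i) v) => [|i].
  rewrite normrM ger_pMr ?normr_gt0 -?unitfE -?unitmxE //.
  by rewrite leNgt (lt_le_trans big) // ler_norm.
have WT : W^T *m v i = - (H *: v i + \sum_k form_at (f k) (v i) *: q k).
  rewrite /W linearN /= linearD /= tr_scalar_mx linear_sum /= mulNmx mulmxDl mul_scalar_mx.
  rewrite mulmx_suml; congr (- (_ + _)); apply: eq_bigr => k _.
  rewrite trmx_mul !trmxK -mulmxA [f k *m v i]mx11_scalar mul_mx_scalar.
  by [].
rewrite linearD linearZ /= trmx1 mulmxDl mul1mx -scalemxAl WT /v' /psi.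
have -> : \sum_k (h k - form_at (f k) (v i)) *: q k =
    \sum_k h k *: q k - \sum_k form_at (f k) (v i) *: q k.
  by rewrite -sumrB; apply: eq_bigr => k _; rewrite scalerBl.
move: (\sum_k h k *: q k) (\sum_k _) => a b.
by apply/matrixP => x z; rewrite !mxE; ring.
Qed.

End MaximalCopy.

(** * Bodies far from being symmetric are near a simplex *)

Section Asymmetry.
Variables (R : realType) (n : nat).
Local Notation E := 'cV[R]_n.
Implicit Types (K L : set E) (f : 'rV[R]_n).

Definition separating K L (lam : R) N := exists q : 'I_N -> E,
  exists f : 'I_N -> 'rV[R]_n, exists y : 'I_N -> E,
  [/\ forall i, K (q i), \sum_i f i = 0,
      forall i, L (y i) /\ forall x, L x -> form_at (f i) x <= form_at (f i) (y i) &
      lam * \sum_i form_at (f i) (y i) + \sum_i form_at (f i) (q i) < 0].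

Lemma form_atZl a f x : form_at (a *: f) x = a * form_at f x.
Proof. by rewrite /form_at -scalemxAl mxE. Qed.

Lemma dependence (N m : nat) (A : 'M[R]_(N, m)) : (m < N)%N ->
  exists2 c : 'rV[R]_N, c *m A = 0 & exists i, 0 < c 0 i.
Proof.
move=> mN; have : kermx A != 0.
  by rewrite -mxrank_eq0 mxrank_ker subn_eq0 -ltnNge (leq_ltn_trans (rank_leq_col _)).
case/rowV0Pn => c /sub_kermxP cA c0.
have [i ci] : exists i, c 0 i != 0.
  apply/existsP; apply: contraNT c0 => /existsPn h.
  by apply/eqP/rowP => i; rewrite mxE; apply/eqP; have := h i; rewrite negbK.
have [ci0|ci0] := ltP 0 (c 0 i); first by exists c; last exists i.
exists (- c); first by rewrite mulNmx cA oppr0.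
by exists i; rewrite mxE oppr_gt0 lt_neqAle ci.
Qed.

(** Caratheodory reduction: the data [(f i, u i)] live in dimension [n + 1], so
    that more than [n + 1] of them have a linear relation; subtracting a multiple
    of it makes one weight vanish and keeps both conditions. *)
Lemma separating_drop K L lam N : (n < N)%N -> separating K L lam N.+1 ->
  separating K L lam N.
Proof.
move=> nN [q [f [y [Kq f0 yP neg]]]].
pose u i := lam * form_at (f i) (y i) + form_at (f i) (q i).
pose A : 'M[R]_(N.+1, n + 1) := \matrix_i row_mx (f i) (u i)%:M.
have [|c cA [k ck]] := @dependence _ _ A; first by rewrite addn1.
have [cf cu] : \sum_i c 0 i *: f i = 0 /\ \sum_i c 0 i * u i = 0.
  move: cA; rewrite mulmx_sum_row => /rowP h; split.
    apply/rowP => j; rewrite summxE [RHS]mxE; have := h (lshift 1 j).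
    rewrite summxE [RHS]mxE => cAj; rewrite -[RHS]cAj.
    by apply: eq_bigr => i _; rewrite rowK mxE [RHS]mxE row_mxEl.
  have := h (rshift n ord0); rewrite summxE [RHS]mxE => cAj; rewrite -[RHS]cAj.
  by apply: eq_bigr => i _; rewrite rowK mxE row_mxEr mxE eqxx mulr1n.
have [k0 _ k0m] := @arg_maxP _ _ _ k xpredT (fun i => c 0 i) isT.
have {}k0m i : c 0 i <= c 0 k0 by exact: k0m.
have c0 : 0 < c 0 k0 by apply: lt_le_trans ck (k0m _).
pose mu i := 1 - c 0 i / c 0 k0.
have mu0 i : 0 <= mu i by rewrite subr_ge0 ler_pdivrMr // mul1r k0m.
have muk : mu k0 = 0 by rewrite /mu divff ?subrr // gt_eqF.
have drop (V : nmodType) (F : 'I_N.+1 -> V) : F k0 = 0 ->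
    \sum_(j < N) F (lift k0 j) = \sum_i F i.
  by move=> F0; rewrite [RHS](bigD1_ord k0) //= F0 add0r.
have muf : \sum_i mu i *: f i = 0.
  under eq_bigr do rewrite scalerBl scale1r mulrC -scalerA.
  by rewrite sumrB f0 -scaler_sumr cf scaler0 subrr.
exists (q \o lift k0), (fun j => mu (lift k0 j) *: f (lift k0 j)), (y \o lift k0).
split=> [j||j|]; first exact: Kq.
- by rewrite (drop _ (fun i => mu i *: f i)) // muk scale0r.
- have [Ly h] := yP (lift k0 j); split=> // x Lx.
  by rewrite !form_atZl ler_wpM2l // h.
rewrite mulr_sumr -big_split /=.
under eq_bigr do rewrite !form_atZl mulrCA -mulrDr.
rewrite (drop _ (fun i => mu i * u i)) ?muk ?mul0r //.
under eq_bigr do rewrite mulrBl mul1r mulrAC.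
rewrite sumrB -mulr_suml cu mul0r subr0 /u big_split /= -mulr_sumr.
exact: neg.
Qed.

Lemma separating_small K L lam N : separating K L lam N ->
  exists2 M, (M <= n + 1)%N & separating K L lam M.
Proof.
elim: N => [|N IH] h; first by exists 0%N.
have [le|lt] := leqP N n; first by exists N.+1; rewrite // addn1.
exact: IH (separating_drop lt h).
Qed.

(** The coordinates are the normalised gaps [(h i - f i) / H] between the
    functionals and their maxima on [K].  Their values at the points [q i] have a sum
    larger than [1 + lam >= n], while each is at most one: so at least [n + 1] of
    them are needed, and at most [n + 1] are. *)
Lemma asymmetric_coordinates K (lam : R) : compact K -> convex_set K -> K !=set0 ->
  n%:R - 1 <= lam ->
  ~ (exists c, forall x, K x -> exists2 y, K y & c = x + lam *: y) ->
  exists f : 'I_(n + 1) -> 'rV[R]_n, exists be : 'I_(n + 1) -> R,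
  exists p : 'I_(n + 1) -> E, let b i x := be i - form_at (f i) x in
  [/\ forall x, \sum_i b i x = 1, forall i x, K x -> 0 <= b i x,
      forall i, K (p i) /\ forall x, K x -> b i x <= b i (p i) &
      1 + lam < \sum_i b i (p i)].
Proof.
move=> Kc Kx K0 lamn nc.
have [N [q [f [y h]]]] := homothety_separation K0 Kc Kx K0 nc.
have [|M Mn {q f y h N}[q [f [y [Kq f0 yP neg]]]]] := @separating_small K K lam N.+1.
  by exists q, f, y.
set h := fun i => form_at (f i) (y i); pose H := \sum_i h i.
have fsum x : \sum_i form_at (f i) x = 0.
  by rewrite /form_at -summxE -mulmx_suml f0 mul0mx mxE.
have gap x : \sum_i (h i - form_at (f i) x) = H by rewrite sumrB fsum subr0.
have gap0 i x : K x -> 0 <= h i - form_at (f i) x.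
  by move=> Kx'; rewrite subr_ge0; have [_] := yP i; apply.
have H0 : 0 < H.
  case: K0 => x Kx0; rewrite lt_neqAle -{2}(gap x) sumr_ge0 ?andbT; last first.
    by move=> i _; apply: gap0.
  apply/eqP => H0; move: neg; rewrite -/H -H0 mulr0 add0r ltNge => /negP; apply.
  have e i z : K z -> form_at (f i) z = h i.
    move=> Kz; apply/eqP; rewrite eq_sym -subr_eq0.
    have /eqP := gap z; rewrite -H0 psumr_eq0 => [/allP|j _]; last exact: gap0.
    by apply; rewrite mem_index_enum.
  under eq_bigr do rewrite e //.
  by rewrite -/H -H0.
pose b i x := h i / H - form_at (H^-1 *: f i) x.
have bE i x : b i x = (h i - form_at (f i) x) / H.
  by rewrite /b form_atZl mulrBl [H^-1 * _]mulrC.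
have b1 x : \sum_i b i x = 1.
  by under eq_bigr do rewrite bE; rewrite -mulr_suml gap divff // gt_eqF.
have b0 i x : K x -> 0 <= b i x.
  by move=> Kx'; rewrite bE divr_ge0 ?gap0 // ltW.
have ble i x : K x -> b i x <= 1.
  by move=> Kx'; rewrite -(b1 x) (bigD1 i) //= lerDl sumr_ge0 // => j _; apply: b0.
have bq : 1 + lam < \sum_i b i (q i).
  under eq_bigr do rewrite bE; rewrite -mulr_suml ltr_pdivlMr // sumrB -/H.
  by move: neg; rewrite -/H; lra.
have nM : (n < M)%N.
  rewrite -(ltr_nat R); apply: (@le_lt_trans _ _ (1 + lam)); first by lra.
  apply: (lt_le_trans bq); rewrite -[in leRHS](card_ord M) -sumr_const.
  by apply: ler_sum => i _; apply: ble.
have EM : M = (n + 1)%N by apply/eqP; rewrite eqn_leq Mn addn1.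
subst M; have /choice[p pP] i : exists x, K x /\ forall z, K z -> b i z <= b i x.
  have [|x xK xm] := @compact_EVT_max _ R (b i) K K0 Kc.
    apply/continuous_subspaceT/sub_cont; first exact: cst_continuous.
    exact: form_at_cont.
  by rewrite inE in xK; exists x; split=> // z Kz; apply: xm; rewrite inE.
exists (fun i => H^-1 *: f i), (fun i => h i / H), p; split=> //.
apply: lt_le_trans bq _; apply: ler_sum => i _.
by have [_] := pP i; apply.
Qed.

End Asymmetry.

Section Stochastic.
Variable R : realType.

(** [y1] is the value at the index of the largest defect [a] and [M] the largest
    value elsewhere, [e] being the entry that links the second index to the
    first. *)
Lemma coupled_bound (a b d e ka y1 M : R) : 0 <= e -> e <= d -> d <= b -> b <= a -> a + b < 1 ->
  0 <= ka -> 0 <= y1 -> 0 <= M ->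
  (1 - a) * y1 <= ka * a + a * M ->
  (1 - d) * M <= ka * d + e * y1 + (d - e) * M ->
  (1 - a - b) * M <= ka * b /\ (1 - a - b) * y1 <= ka * a.
Proof.
move=> e0 ed db ba ab ka0 y0 M0 h1 h2.
have a1 : 0 < 1 - a by lra.
have b1 : 0 < 1 - b by lra.
have ab0 : 0 < 1 - a - b by lra.
have HM : (1 - a - b) * M <= ka * b.
  have [y1M|My1] := leP M y1.
    have k1 : (1 - d) * M <= d * (ka + y1).
      by have : e * (y1 - M) <= d * (y1 - M); [rewrite ler_wpM2r // subr_ge0|lra].
    have k2 : (1 - b) * M <= b * (ka + y1).
      have : (1 - b) * M <= (1 - d) * M by rewrite ler_wpM2r //; lra.
      have : d * (ka + y1) <= b * (ka + y1) by rewrite ler_wpM2r // addr_ge0.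
      lra.
    have k3 : (1 - a) * ((1 - b) * M) <= (1 - a) * (b * (ka + y1)) by rewrite ler_pM2l.
    have k4 : b * ((1 - a) * y1) <= b * (ka * a + a * M) by rewrite ler_wpM2l //; lra.
    by lra.
  have k1 : (1 - 2 * d) * M <= ka * d.
    by have : e * y1 <= e * M; [rewrite ler_wpM2l // ltW|lra].
  have : (1 - a - b) * M <= (1 - 2 * d) * M by rewrite ler_wpM2r //; lra.
  have : ka * d <= ka * b by rewrite ler_wpM2l.
  by lra.
split=> //.
have k : a * ((1 - a - b) * M) <= a * (ka * b) by rewrite ler_wpM2l //; lra.
have : (1 - a - b) * ((1 - a) * y1) <= (1 - a - b) * (ka * a + a * M) by rewrite ler_pM2l.
move=> k'; rewrite -(ler_pM2l a1); lra.
Qed.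

(** With [A := a + b] the left side is at most
    [(1 - A^2 / 2 + (e - A)) / (1 - A)], which increases with [A <= e]. *)
Lemma ratio_bound (a b S e : R) : 0 <= b -> b <= a -> b <= S -> a + S <= e -> e < 1 ->
  (1 - a - b + a * (1 - a) + S * (1 - b)) / (1 - a - b) <= (1 - e ^+ 2 / 2) / (1 - e).
Proof.
move=> b0 ba bS aSe e1.
have A1 : 0 < 1 - a - b by lra.
have E1 : 0 < 1 - e by lra.
rewrite ler_pdivrMr // mulrAC ler_pdivlMr //.
pose A := a + b; pose d := e - A.
have d0 : 0 <= d by rewrite /d /A; lra.
have num : 1 - a - b + a * (1 - a) + S * (1 - b) <= 1 - A ^+ 2 / 2 + d.
  have : (S - b) * b >= 0 by rewrite mulr_ge0 // subr_ge0.
  have := sqr_ge0 (a - b); rewrite /d /A; lra.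
have : (1 - a - b + a * (1 - a) + S * (1 - b)) * (1 - e) <= (1 - A ^+ 2 / 2 + d) * (1 - e).
  by rewrite ler_pM2r.
move/le_trans; apply; rewrite -subr_ge0.
have -> : (1 - e ^+ 2 / 2) * (1 - a - b) - (1 - A ^+ 2 / 2 + d) * (1 - e) =
  d * (e ^+ 2 / 2 + (1 - e) * d / 2) by rewrite /d /A; field.
have := mulr_ge0 (ltW E1) d0; have := sqr_ge0 e => h1 h2.
by apply: mulr_ge0 => //; lra.
Qed.

Section Matrix.
Variables (m : nat) (P : 'M[R]_m) (e : R).
Hypotheses (m1 : (1 < m)%N) (P0 : forall i j, 0 <= P i j)
  (P1 : forall i, \sum_j P i j = 1) (Pe : \sum_i (1 - P i i) <= e) (e1 : e < 1).
Let de i := 1 - P i i.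

Let offdiag i : \sum_(j | j != i) P i j = de i.
Proof. by rewrite /de -(P1 i) [in RHS](bigD1 i) //= addrAC subrr add0r. Qed.

Let de0 i : 0 <= de i.
Proof. by rewrite -offdiag sumr_ge0. Qed.

Let top_two : exists k l, [/\ k != l, forall i, de i <= de k & forall i, i != k -> de i <= de l].
Proof.
have [k _ kP] := @arg_maxP _ _ _ (Ordinal (ltnW m1)) xpredT de isT.
have [l0 l0k] : exists l, l != k.
  have : (1 < #|'I_m|)%N by rewrite card_ord.
  by move=> /card_gt1P[x [y [_ _ xy]]]; case: (eqVneq x k) xy => [-> ky|]; [exists y; rewrite eq_sym|exists x].
have [l lk lP] := @arg_maxP _ _ _ l0 (fun i => i != k) de l0k.
exists k, l; split; first by rewrite eq_sym.
- by move=> i; exact: kP.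
- by move=> i ik; exact: lP.
Qed.

Let sum_split (k : 'I_m) (F : 'I_m -> R) : \sum_i F i = F k + \sum_(i | i != k) F i.
Proof. by rewrite (bigD1 k). Qed.

(** A maximum principle: the system bounds [y] at the index [k] of the largest
    defect by the maximum elsewhere, and that maximum by [y k].  With [ka = 0] it
    gives the injectivity of [P]. *)
Lemma inverse_bound k l (ka : R) (y : 'I_m -> R) : k != l -> (forall i, de i <= de k) ->
  (forall i, i != k -> de i <= de l) -> 0 <= ka -> (forall i, 0 <= y i) ->
  (forall i, (1 - de i) * y i <= ka * de i + \sum_(j | j != i) P i j * y j) ->
  [/\ de k + de l <= e, (1 - de k - de l) * y k <= ka * de k &
   forall i, i != k -> (1 - de k - de l) * y i <= ka * de l].
Proof.
move=> kl kP lP ka0 y0 h.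
have ab : de k + de l <= e.
  apply: le_trans Pe; rewrite (sum_split k) lerD2l.
  by rewrite (bigD1 l) 1?eq_sym //= lerDl sumr_ge0 // => i _; apply: de0.
have lk : l != k by rewrite eq_sym.
have [i0 i0k i0P] := @arg_maxP _ _ _ l (fun i => i != k) y lk.
have {}i0P i : i != k -> y i <= y i0 by exact: i0P.
have Pk : P i0 k <= de i0.
  by rewrite -offdiag (bigD1 k) 1?eq_sym //= lerDl sumr_ge0.
have h1 : (1 - de k) * y k <= ka * de k + de k * y i0.
  apply: le_trans (h k) _; rewrite lerD2l -offdiag mulr_suml ler_sum // => j jk.
  by rewrite ler_wpM2l // i0P.
have h2 : (1 - de i0) * y i0 <= ka * de i0 + P i0 k * y k + (de i0 - P i0 k) * y i0.
  apply: le_trans (h i0) _; rewrite -addrA lerD2l -offdiag.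
  rewrite (bigD1 k) 1?eq_sym //= lerD2l [in leRHS](bigD1 k) 1?eq_sym //= addrAC subrr add0r.
  rewrite mulr_suml ler_sum // => j /andP[_ jk]; by rewrite ler_wpM2l // i0P.
have [hM hy] := coupled_bound (P0 i0 k) Pk (lP _ i0k) (kP l) (le_lt_trans ab e1) ka0
  (y0 k) (y0 i0) h1 h2.
split=> // i ik; apply: le_trans hM; rewrite ler_wpM2l ?i0P //.
by move: ab e1; lra.
Qed.

Lemma stochastic_unit : P \in unitmx.
Proof.
have [k [l [kl kP lP]]] := top_two.
rewrite -unitmx_tr -row_free_unit -kermx_eq0; apply/rowV0P => x /sub_kermxP xP.
have eqn i : P i i * x 0 i = - \sum_(j | j != i) P i j * x 0 j.
  move/rowP/(_ i): xP; rewrite !mxE (sum_split i) mxE mulrC => /eqP.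
  rewrite addr_eq0 => /eqP ->; congr (- _); apply: eq_bigr => j _.
  by rewrite mxE mulrC.
have [|||ab yk yi] := @inverse_bound k l 0 (fun i => `|x 0 i|) kl kP lP => //.
  move=> i; rewrite mul0r add0r /de subKr -[X in X * _](ger0_norm (P0 i i)) -normrM eqn normrN.
  apply: le_trans (ler_norm_sum _ _ _) _; apply: ler_sum => j _.
  by rewrite normrM ger0_norm.
have pos : 0 < 1 - de k - de l by move: ab e1; lra.
apply/rowP => i; rewrite mxE; apply/eqP; rewrite -normr_le0 -(pmulr_rle0 _ pos).
have [->|/yi] := eqVneq i k; first by move: yk; rewrite mul0r.
by rewrite mul0r.
Qed.

(** Each row [i] of the inverse [g] satisfies
    [P i i * g i = (unit row i) - \sum_(a <> i) P i a * g a].  Replacing the rows on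
    the right by their positive parts bounds [be *m g] below, uniformly for [be] in
    the box; the masses of the positive parts obey [inverse_bound]. *)
Lemma stochastic_box : exists ze : 'I_m -> R,
  [/\ forall j, 0 <= ze j, 1 + \sum_j ze j <= (1 - e ^+ 2 / 2) / (1 - e) &
    forall be : 'rV[R]_m, (forall i, 0 <= be 0 i <= P i i) ->
      forall j, - ze j <= (be *m invmx P) 0 j].
Proof.
have PU := stochastic_unit; have [k [l [kl kP lP]]] := top_two.
pose g := invmx P; pose gp i j := Num.max (g i j) 0; pose gm i j := Num.max (- g i j) 0.
have gp0 i j : 0 <= gp i j by rewrite le_max lexx orbT.
have gm0 i j : 0 <= gm i j by rewrite le_max lexx orbT.
have gle i j : g i j <= gp i j by rewrite le_max lexx.
have gE i j : g i j = gp i j - gm i j.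
  by rewrite /gp /gm /Num.max; do 2!case: ifPn; rewrite ?oppr_lt0 -?leNgt; lra.
have gsum i : \sum_j g i j = 1.
  have one : P *m const_mx 1 = const_mx 1 :> 'cV[R]_m.
    apply/colP => a; rewrite mxE [RHS]mxE -[RHS](P1 a).
    by apply: eq_bigr => j _; rewrite mxE mulr1.
  have : g *m const_mx 1 = const_mx 1 :> 'cV[R]_m by rewrite -{1}one mulKmx.
  move/colP/(_ i); rewrite mxE [RHS]mxE => g1; rewrite -[RHS]g1.
  by apply: eq_bigr => j _; rewrite mxE mulr1.
have rowE i j : P i i * g i j = (i == j)%:R - \sum_(a | a != i) P i a * g a j.
  have : (P *m g) i j = (i == j)%:R by rewrite mulmxV // mxE.
  by rewrite mxE (sum_split i) => <-; rewrite addrK.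
have Pii i : P i i = 1 - de i by rewrite /de subKr.
have dei1 i : de i < 1.
  apply: le_lt_trans e1; apply: le_trans Pe.
  by rewrite (sum_split i) lerDl sumr_ge0 // => ? _; apply: de0.
have Ppos i : 0 < P i i by rewrite Pii subr_gt0.
pose y i := \sum_j gm i j.
have y0 i : 0 <= y i by apply: sumr_ge0.
have tau i : \sum_j gp i j = 1 + y i.
  by rewrite -(gsum i) /y -big_split; apply: eq_bigr => j _ /=; rewrite gE subrK.
have yle i : (1 - de i) * y i <= 1 * de i + \sum_(j | j != i) P i j * y j.
  rewrite -Pii mul1r -offdiag -big_split /= mulr_sumr.
  under [leRHS]eq_bigr do rewrite -[X in X + _]mulr1 -mulrDr -tau mulr_sumr.
  rewrite exchange_big; apply: ler_sum => j _.
  have s0 : 0 <= \sum_(a | a != i) P i a * gp a j by apply: sumr_ge0 => a _; rewrite mulr_ge0.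
  rewrite /gm /Num.max; case: ifP => _; rewrite ?mulr0 // mulrN rowE opprB lerBlDr.
  apply: (@le_trans _ _ (\sum_(a | a != i) P i a * gp a j)).
    by apply: ler_sum => a _; rewrite ler_wpM2l.
  by rewrite lerDl ler0n.
have [ab yk yi] := inverse_bound kl kP lP ler01 y0 yle.
pose ze j := \sum_i \sum_(a | a != i) P i a * gp a j.
exists ze; split=> [j||be hbe j].
- by apply: sumr_ge0 => i _; apply: sumr_ge0 => a _; rewrite mulr_ge0.
- have pos : 0 < 1 - de k - de l by move: ab e1; lra.
  pose S := \sum_(i | i != k) de i.
  have zE : \sum_j ze j = \sum_i \sum_(a | a != i) P i a * (1 + y a).
    rewrite exchange_big; apply: eq_bigr => i _; rewrite exchange_big.
    by apply: eq_bigr => a _; rewrite -mulr_sumr tau.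
  pose T1 := (1 - de l) / (1 - de k - de l); pose T2 := (1 - de k) / (1 - de k - de l).
  have T21 : T2 <= T1 by rewrite ler_pM2r ?invr_gt0 // lerD2l lerN2 kP.
  have t1 : 1 + y k <= T1 by rewrite ler_pdivlMr // mulrC; move: yk; lra.
  have t2 i : i != k -> 1 + y i <= T2.
    by move=> /yi yi'; rewrite ler_pdivlMr // mulrC; move: yi'; lra.
  apply: (@le_trans _ _ ((1 - de k - de l + de k * (1 - de k) + S * (1 - de l))
     / (1 - de k - de l))); last first.
    apply: ratio_bound => //.
      by rewrite /S (bigD1 l) 1?eq_sym //= lerDl sumr_ge0.
    by apply: le_trans Pe; rewrite (sum_split k).
  have -> : (1 - de k - de l + de k * (1 - de k) + S * (1 - de l)) / (1 - de k - de l) =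
     1 + (de k * T2 + S * T1) by rewrite /T1 /T2; field; rewrite gt_eqF.
  rewrite lerD2l zE (sum_split k); apply: lerD.
    by rewrite -offdiag mulr_suml ler_sum // => a ak; rewrite ler_wpM2l // t2.
  rewrite /S mulr_suml ler_sum // => i ik; rewrite -offdiag mulr_suml ler_sum // => a ai.
  rewrite ler_wpM2l //; have [->//|ak] := eqVneq a k.
  exact: le_trans (t2 a ak) T21.
rewrite mxE /ze -sumrN; apply: ler_sum => i _.
have /andP[b0 b1] := hbe i; pose t := be 0 i / P i i.
have t0 : 0 <= t by rewrite divr_ge0.
have t1 : t <= 1 by rewrite ler_pdivrMr // mul1r.
have -> : be 0 i = t * P i i by rewrite divfK // gt_eqF.
rewrite -mulrA rowE mulrBr.
have s0 : 0 <= \sum_(a | a != i) P i a * gp a j by apply: sumr_ge0 => a _; rewrite mulr_ge0.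
have s1 : \sum_(a | a != i) P i a * g a j <= \sum_(a | a != i) P i a * gp a j.
  by apply: ler_sum => a _; rewrite ler_wpM2l.
have h1 : t * \sum_(a | a != i) P i a * g a j <= t * \sum_(a | a != i) P i a * gp a j.
  by rewrite ler_wpM2l.
have h2 : t * \sum_(a | a != i) P i a * gp a j <= \sum_(a | a != i) P i a * gp a j.
  by rewrite ler_piMl.
have h3 : 0 <= t * (i == j)%:R by rewrite mulr_ge0 ?ler0n.
by move: h1 h2 h3; lra.
Qed.

End Matrix.
End Stochastic.

Section NearSimplex.
Variables (R : realType) (n : nat).
Local Notation E := 'cV[R]_n.
Implicit Types (K L : set E).

(** [K] contains the simplex with vertices [p] and lies in a homothetic copy of
    it of ratio [1 + \sum_j ze j]. *)
Definition sandwiched K (G : R) := exists p : 'I_(n + 1) -> E,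
  exists ze : 'I_(n + 1) -> R,
  [/\ frame_mx p \in unitmx /\ (forall i, K (p i)), forall j, 0 <= ze j,
      1 + \sum_j ze j <= G & forall x, K x -> forall j, - ze j <= bary p x 0 j].

(** [K] lies in a translate of [- lam K]. *)
Definition in_reflection K (lam : R) :=
  exists c, forall x, K x -> exists2 y, K y & c = x + lam *: y.

(** On [K] the asymmetric coordinates stay between [0] and their maxima
    [P i i], and [P] is the change of coordinates from the frame [p] to them: this is
    the box of [stochastic_box]. *)
Lemma asymmetric_sandwiched K (lam : R) : (0 < n)%N -> compact K -> convex_set K ->
  K !=set0 -> n%:R - 1 < lam -> ~ in_reflection K lam ->
  sandwiched K ((1 - (n%:R - lam) ^+ 2 / 2) / (1 - (n%:R - lam))).
Proof.
move=> n0 Kc Kx K0 ln /(asymmetric_coordinates Kc Kx K0 (ltW ln)).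
case=> f [be [p /= [b1 b0 pP big]]]; pose b i x := be i - form_at (f i) x.
pose P : 'M[R]_(n + 1) := \matrix_(i, j) b j (p i).
pose B : 'M[R]_(n + 1) :=
  col_mx (\matrix_(k, j) (- f j 0 k)) (\row_j be j).
have homB x : homog x *m B = \row_j b j x.
  apply/rowP => j; rewrite mul_row_col mul1mx [RHS]mxE mxE [X in _ + X]mxE addrC.
  rewrite /b form_atE mxE -sumrN; congr (_ + _); apply: eq_bigr => k _.
  by rewrite !mxE mulrN mulrC.
have PE : P = frame_mx p *m B.
  apply/row_matrixP => i; rewrite row_mul rowK homB.
  by apply/rowP => j; rewrite !mxE.
have [m1 P0 P1 Pe e1] : [/\ (1 < n + 1)%N, forall i j, 0 <= P i j,
   forall i, \sum_j P i j = 1, \sum_i (1 - P i i) <= n%:R - lam & n%:R - lam < 1].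
  split; rewrite ?addn1 //; last by lra.
  - by move=> i j; rewrite mxE b0 //; have [] := pP i.
  - by move=> i; under eq_bigr do rewrite mxE; exact: b1.
  rewrite sumrB sumr_const card_ord natrD.
  by under eq_bigr do rewrite mxE; move: big; clear; lra.
have PU : P \in unitmx := stochastic_unit m1 P0 P1 Pe e1.
have pU : frame_mx p \in unitmx by move: PU; rewrite PE unitmx_mul => /andP[].
have BU : B \in unitmx by move: PU; rewrite PE unitmx_mul => /andP[].
have [ze [ze0 ze1 zeP]] := stochastic_box m1 P0 P1 Pe e1.
exists p, ze; split=> //; first by split=> // i; have [] := pP i.
move=> x Kx' j.
have -> : bary p x = (\row_j b j x) *m invmx P.
  have -> : invmx P = invmx B *m invmx (frame_mx p).
    have := @mulKmx _ _ _ P PU (invmx B *m invmx (frame_mx p)).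
    rewrite {2}PE -mulmxA (mulmxA B) mulmxV // mul1mx mulmxV // mulmx1.
    by move->.
  by rewrite -homB mulmxA mulmxK.
apply: zeP => i; rewrite !mxE b0 //=.
by have [_] := pP i; apply.
Qed.

Lemma sandwiched_distance K L G : convex_set K -> convex_set L -> sandwiched K G ->
  sandwiched L G -> (BM_distance K L <= (G ^+ 2)%:E)%E.
Proof.
move=> Kx Lx [p [ze [[pU Kp] ze0 zeG zeP]]] [p' [ze' [[p'U Lp'] ze'0 ze'G ze'P]]].
pose Z := 1 + \sum_j ze j; pose Z' := 1 + \sum_j ze' j.
have Z1 : 1 <= Z by rewrite lerDl sumr_ge0.
have Z'1 : 1 <= Z' by rewrite lerDl sumr_ge0.
have [Z0 Z'0] : 0 < Z /\ 0 < Z' by lra.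
have inside (M M' : set E) (q q' : 'I_(n + 1) -> E) (xi : 'I_(n + 1) -> R) : convex_set M -> (forall i, M (q i)) ->
    frame_mx q' \in unitmx -> (forall j, 0 <= xi j) ->
    (forall x, M' x -> forall j, - xi j <= bary q' x 0 j) ->
    forall y, M' y ->
    M (\sum_j ((1 + \sum_j xi j)^-1 * bary q' y 0 j + (1 + \sum_j xi j)^-1 * xi j) *: q j).
  move=> Mx Mq q'U xi0 xiP y M'y.
  have S0 : 0 < 1 + \sum_j xi j by rewrite ltr_pwDl // sumr_ge0.
  apply: convex_sum => // [i|].
    rewrite -mulrDr mulr_ge0 // ?invr_ge0 ?(ltW S0) //.
    by have := xiP y M'y i; lra.
  by rewrite big_split /= -!mulr_sumr bary_sum // -mulrDr mulVf // gt_eqF.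
have HL := inside K L p p' ze' Kx Kp p'U ze'0 ze'P.
have HK := inside L K p' p ze Lx Lp' pU ze0 zeP.
have ss0 : 0 < Z'^-1 * Z^-1 by rewrite mulr_gt0 ?invr_gt0.
have sum_a : \sum_j Z^-1 * ze j = 1 - Z^-1.
  have <- : Z^-1 * Z = 1 by rewrite mulVf // gt_eqF.
  by rewrite -mulr_sumr /Z; ring.
have := frames_admissible pU p'U ss0 HL HK sum_a.
move/BM_distance_le; apply; rewrite -invfM invrK expr2.
by apply: ler_pM => //; exact: ltW.
Qed.

End NearSimplex.

(** * The alternative in every dimension *)

Section ReflectionDistance.
Variables (R : realType) (n : nat).
Local Notation E := 'cV[R]_n.
Local Notation I := 'I_(n + 1).
Implicit Types (K L : set E).

(** [y] is an affine combination of [x] and of the centre [(1 + mu)^-1 *: c] of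
    the reflection. *)
Lemma bary_reflect (q : I -> E) (c x y : E) (mu : R) : frame_mx q \in unitmx -> 0 < mu ->
  c = x + mu *: y -> forall j, bary q y 0 j =
    - mu^-1 * bary q x 0 j + (1 + mu) / mu * bary q ((1 + mu)^-1 *: c) 0 j.
Proof.
move=> qU mu0 cE j; have mu1 : 0 < 1 + mu by lra.
pose w (i : bool) := if i then - mu^-1 else (1 + mu) / mu.
pose r (i : bool) := if i then x else (1 + mu)^-1 *: c.
have w1 : \sum_i w i = 1.
  by rewrite big_bool /=; field; rewrite gt_eqF.
have := bary_comb q r w1; rewrite !big_bool /=.
have -> : - mu^-1 *: x + ((1 + mu) / mu) *: ((1 + mu)^-1 *: c) = y.
  rewrite scalerA mulrAC divff ?gt_eqF // mul1r cE scalerDr addrA scaleNr addNr add0r.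
  by rewrite scalerA mulVf ?scale1r // gt_eqF.
by move=> ->; rewrite mxE [X in X + _]mxE [X in _ + X]mxE.
Qed.

Lemma bary_transport (p' v : I -> E) y j : frame_mx p' \in unitmx ->
  frame_mx v \in unitmx -> bary v (transport p' v y) 0 j = bary p' y 0 j.
Proof. by move=> p'U vU; rewrite (@bary_uniq _ _ _ vU (bary p' y)) // bary_sum. Qed.

(** The maximal copy gives a map of [L] into [K] and a map of [K] into [L] of
    ratio [- 1 / n]; composing one of them with the reflection of the symmetric body
    makes the signs agree. *)
Lemma reflection_distance K L (lam : R) : (0 < n)%N -> 0 < lam ->
  convex_body K -> convex_body L -> in_reflection K lam \/ in_reflection L lam ->
  (BM_distance K L <= (n%:R * lam)%:E)%E.
Proof.
move=> n0 l0 Kb Lb refl; have [Kc Kx Ki] := Kb; have [Lc Lx Li] := Lb.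
have [p' [v mc]] := maximal_copy_exists Kc Ki Lc Li.
have [p'U vU LK _] := mc.
have [t tP] := maximal_copy_cover n0 Kb Lb mc.
have nR : 0 < n%:R :> R by rewrite ltr0n.
have nl0 : 0 < n%:R * lam by rewrite mulr_gt0.
pose tb j := (1 + n%:R) / n%:R * bary v ((1 + n%:R)^-1 *: t) 0 j.
have tb1 : \sum_j tb j = (1 + n%:R) / n%:R by rewrite -mulr_sumr bary_sum // mulr1.
have back x : K x -> exists2 y, L y &
    forall j, bary p' y 0 j = - n%:R^-1 * bary v x 0 j + tb j.
  move=> /tP[y Ly tE]; exists y => // j.
  by rewrite -(bary_transport _ _ p'U vU) (bary_reflect vU nR tE).
case: refl => -[c cP].
  pose cb j := (1 + lam) / lam * bary v ((1 + lam)^-1 *: c) 0 j.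
  have ss : - lam^-1 * - n%:R^-1 = (n%:R * lam)^-1 by rewrite mulrNN invfM mulrC.
  have ss0 : 0 < - lam^-1 * - n%:R^-1 by rewrite ss invr_gt0.
  have HL y : L y -> K (\sum_j (- lam^-1 * bary p' y 0 j + cb j) *: v j).
    move=> /LK/cP[k Kk cE].
    have <- : \sum_j bary v k 0 j *: v j =
       \sum_j (- lam^-1 * bary p' y 0 j + cb j) *: v j.
      apply: eq_bigr => j _; congr (_ *: _).
      by rewrite (bary_reflect vU l0 cE) bary_transport.
    by rewrite bary_point.
  have HK x : K x -> L (\sum_j (- n%:R^-1 * bary v x 0 j + tb j) *: p' j).
    move=> /back[y Ly yE]; under eq_bigr do rewrite -yE.
    by rewrite bary_point.
  have sum_a : \sum_j tb j = 1 - - n%:R^-1.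
    by rewrite tb1; field; rewrite gt_eqF.
  have := frames_admissible vU p'U ss0 HL HK sum_a.
  by move/BM_distance_le; apply; rewrite ss invrK.
pose cb j := (1 + lam) / lam * bary p' ((1 + lam)^-1 *: c) 0 j.
have cb1 : \sum_j cb j = (1 + lam) / lam by rewrite -mulr_sumr bary_sum // mulr1.
have ss : 1 * (n%:R * lam)^-1 = (n%:R * lam)^-1 by rewrite mul1r.
have ss0 : 0 < 1 * (n%:R * lam)^-1 by rewrite ss invr_gt0.
have HL y : L y -> K (\sum_j (1 * bary p' y 0 j + 0) *: v j).
  by move=> /LK; under [X in _ -> K X]eq_bigr do rewrite mul1r addr0.
have HK x : K x -> L (\sum_j ((n%:R * lam)^-1 * bary v x 0 j + (cb j - lam^-1 * tb j)) *: p' j).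
  move=> /back[y Ly yE]; have [z Lz cE] := cP y Ly.
  have <- : \sum_j bary p' z 0 j *: p' j =
      \sum_j ((n%:R * lam)^-1 * bary v x 0 j + (cb j - lam^-1 * tb j)) *: p' j.
    apply: eq_bigr => j _; congr (_ *: _).
    by rewrite (bary_reflect p'U l0 cE) yE -/(cb j) invfM; ring.
  by rewrite bary_point.
have sum_a : \sum_j (cb j - lam^-1 * tb j) = 1 - (n%:R * lam)^-1.
  by rewrite sumrB cb1 -mulr_sumr tb1; field; rewrite !gt_eqF.
have := frames_admissible vU p'U ss0 HL HK sum_a.
by move/BM_distance_le; apply; rewrite ss invrK.
Qed.

Lemma distance_dichotomy K L (lam : R) : (0 < n)%N -> n%:R - 1 < lam -> 0 < lam ->
  convex_body K -> convex_body L ->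
  (BM_distance K L <= (n%:R * lam)%:E)%E \/
  (BM_distance K L <=
    (((1 - (n%:R - lam) ^+ 2 / 2) / (1 - (n%:R - lam))) ^+ 2)%:E)%E.
Proof.
move=> n0 ln l0 Kb Lb; have [Kc Kx Ki] := Kb; have [Lc Lx Li] := Lb.
have [K0 L0] : K !=set0 /\ L !=set0.
  by split; [case: Ki => x|case: Li => x] => /nbhs_singleton; exists x.
have [rK|nK] := pselect (in_reflection K lam).
  by left; apply: reflection_distance => //; left.
have [rL|nL] := pselect (in_reflection L lam).
  by left; apply: reflection_distance => //; right.
right; apply: sandwiched_distance => //; exact: asymmetric_sandwiched.
Qed.

End ReflectionDistance.

(** * Simplices of maximal volume inside a body *)

Lemma det3 (R : comRingType) (A : 'M[R]_3) (a := fun i j : nat => A (inord i) (inord j)) :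
  \det A = a 0%N 0%N * (a 1%N 1%N * a 2%N 2%N - a 1%N 2%N * a 2%N 1%N)
         - a 0%N 1%N * (a 1%N 0%N * a 2%N 2%N - a 1%N 2%N * a 2%N 0%N)
         + a 0%N 2%N * (a 1%N 0%N * a 2%N 1%N - a 1%N 1%N * a 2%N 0%N).
Proof.
have E i j : A i j = a i j by rewrite /a !inord_val.
rewrite (expand_det_row _ ord0) !big_ord_recl big_ord0 /cofactor.
rewrite !(expand_det_row _ ord0) !big_ord_recl !big_ord0 /cofactor.
rewrite !det_mx11 !mxE !E /= /bump /=.
by rewrite ?expr0 ?expr1 /= !mul1r !addr0 ?exprS ?expr0; ring.
Qed.

Section Inscribed.
Variables (R : realType) (n : nat).
Local Notation E := 'cV[R]_n.
Local Notation I := 'I_(n + 1).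
Implicit Types (K : set E) (v w : I -> E) (m : I -> R) (s : {perm I}).

(** [v] spans a simplex of maximal volume in [K]; [m j] is the height of [K]
    below the facet opposite to [v j], in units of the height of that simplex. *)
Definition extremal_simplex K v w m :=
  [/\ frame_mx v \in unitmx, forall i, K (v i),
      forall q, (forall i, K (q i)) -> `|\det (frame_mx q)| <= `|\det (frame_mx v)|,
      forall j, K (w j) /\ bary v (w j) 0 j = - m j &
      forall j x, K x -> - m j <= bary v x 0 j].

Lemma extremal_exists K : compact K -> K° !=set0 ->
  exists v w m, extremal_simplex K v w m.
Proof.
move=> Kc Ki; have [q0 q0U Kq0] := frame_inside Ki.
have [] := @tuple_max R n (n + 1) (fun=> K) setT (fun q => `|\det (frame_mx q)|).
- by [].
- exact: closedT.
- exact: norm_det_frame_cont.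
- by exists q0.
move=> v [_ Kv vmax].
have vU : frame_mx v \in unitmx.
  rewrite unitmxE unitfE -normr_gt0; apply: lt_le_trans (vmax q0 _ Kq0) => //.
  by rewrite normr_gt0 -unitfE -unitmxE.
have /choice[w wP] j : exists x, K x /\ forall y, K y -> bary v x 0 j <= bary v y 0 j.
  have [||x xK xm] := @compact_EVT_min _ R (fun x => bary v x 0 j) K _ Kc.
  - by exists (v j).
  - exact/continuous_subspaceT/bary_cont.
  by rewrite inE in xK; exists x; split=> // y Ky; apply: xm; rewrite inE.
exists v, w, (fun j => - bary v (w j) 0 j); split => //.
- by move=> q Kq; apply: vmax.
- by move=> j; rewrite opprK; have [] := wP j.
- by move=> j x Kx; rewrite opprK; have [_] := wP j; apply.
Qed.

Lemma frame_perm s v : frame_mx (v \o s) = row_perm s (frame_mx v).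
Proof. by apply/matrixP => i j; rewrite !mxE. Qed.

Lemma bary_perm s v x j : frame_mx v \in unitmx -> bary (v \o s) x 0 j = bary v x 0 (s j).
Proof.
move=> vU.
have sU : frame_mx (v \o s) \in unitmx.
  by rewrite frame_perm row_permE unitmx_mul vU unitmx_perm.
rewrite (@bary_uniq _ _ _ sU (\row_j bary v x 0 (s j))) ?mxE //.
- rewrite -(bary_sum vU x) [RHS](reindex_inj (@perm_inj _ s)).
  by apply: eq_bigr => i _; rewrite mxE.
- rewrite -[RHS](bary_point vU x) [RHS](reindex_inj (@perm_inj _ s)).
  by apply: eq_bigr => i _; rewrite mxE.
Qed.

Lemma extremal_perm s K v w m : extremal_simplex K v w m ->
  extremal_simplex K (v \o s) (w \o s) (m \o s).
Proof.
case=> vU Kv vmax wP mP; split=> //.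
- by rewrite frame_perm row_permE unitmx_mul vU unitmx_perm.
- by move=> i; apply: Kv.
- move=> q Kq; rewrite frame_perm row_permE det_mulmx det_perm normrM normrX.
  by rewrite normrN1 expr1n mul1r vmax.
- by move=> j; rewrite bary_perm //; apply: wP.
- by move=> j x Kx; rewrite bary_perm //; apply: mP.
Qed.

(** The determinant of the barycentric coordinates of [n + 1] points of [K] is
    the ratio of the volumes of two simplices in [K]. *)
Lemma extremal_det K v w m q : extremal_simplex K v w m -> (forall i, K (q i)) ->
  `|\det (\matrix_i bary v (q i))| <= 1.
Proof.
case=> vU Kv vmax _ _ Kq.
have d0 : 0 < `|\det (frame_mx v)| by rewrite normr_gt0 -unitfE -unitmxE.
rewrite -(ler_pM2r d0) mul1r -normrM -det_mulmx.
rewrite (_ : _ *m _ = frame_mx q) ?vmax //.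
by apply/row_matrixP => i; rewrite row_mul !rowK bary_frame.
Qed.

Lemma extremal_depth_ge0 K v w m : (0 < n)%N -> extremal_simplex K v w m ->
  forall j, 0 <= m j.
Proof.
move=> n0 [vU Kv _ _ mP] j.
have [i ij] : exists i : I, i != j.
  have : (1 < #|I|)%N by rewrite card_ord addn1.
  move=> /card_gt1P[a [b [_ _ ab]]].
  by case: (eqVneq a j) ab => [-> ba|]; [exists b; rewrite eq_sym|exists a].
by have := mP j (v i) (Kv i); rewrite bary_vertex // (negbTE ij) oppr_le0.
Qed.

(** Replacing the vertex [v j] by [x] multiplies the volume by the coordinate
    [j] of [x]. *)
Lemma extremal_le1 K v w m x j : extremal_simplex K v w m -> K x -> bary v x 0 j <= 1.
Proof.
move=> ext Kx; have [vU Kv _ _ _] := ext.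
pose q i := if i == j then x else v i.
have Kq i : K (q i) by rewrite /q; case: ifP.
have := extremal_det ext Kq; apply: le_trans.
suff -> : \det (\matrix_i bary v (q i)) = bary v x 0 j by exact: ler_norm.
have adj1 : \adj (1%:M : 'M[R]_(n + 1)) = 1%:M.
  by rewrite -[LHS]mul1mx mul_mx_adj det1.
have cof k : cofactor (\matrix_i bary v (q i)) j k = (k == j)%:R.
  transitivity (cofactor (1%:M : 'M[R]_(n + 1)) j k); last first.
    by move/matrixP/(_ k j): adj1; rewrite !mxE.
  congr (_ * \det _); apply/matrixP => a b; rewrite [LHS]mxE [LHS]mxE [LHS]mxE /q.
  by rewrite [lift j a == j]eq_sym (negbTE (neq_lift _ _)) bary_vertex // !mxE.
rewrite (expand_det_row _ j) (bigD1 j) //= big1 ?addr0 => [|k kj].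
  by rewrite cof eqxx mulr1 [LHS]mxE /q eqxx.
by rewrite cof (negbTE kj) mulr0.
Qed.

End Inscribed.

(** * Planar bodies and their triangles of maximal area *)

Section Plane.
Variable R : realType.
Local Notation E := 'cV[R]_2.
Local Notation I := 'I_(2 + 1).
Implicit Types (K L : set E) (v w : I -> E) (m : I -> R).

Definition i0 : I := @inord 2 0.
Definition i1 : I := @inord 2 1.
Definition i2 : I := @inord 2 2.

Lemma I_cases (P : I -> Prop) : P i0 -> P i1 -> P i2 -> forall i, P i.
Proof.
move=> P0 P1 P2 [[|[|[|k]]] h] //.
- by rewrite (_ : Ordinal h = i0) //; apply: val_inj; rewrite /= inordK.
- by rewrite (_ : Ordinal h = i1) //; apply: val_inj; rewrite /= inordK.
- by rewrite (_ : Ordinal h = i2) //; apply: val_inj; rewrite /= inordK.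
Qed.

Lemma I_neq : [/\ i0 != i1, i0 != i2 & i1 != i2].
Proof. by rewrite -!val_eqE /= !inordK. Qed.

Lemma sum_I (V : nmodType) (f : I -> V) : \sum_i f i = f i0 + f i1 + f i2.
Proof.
rewrite !big_ord_recl big_ord0 addr0 addrA; congr (f _ + f _ + f _);
  by apply: val_inj; rewrite /= inordK.
Qed.

Lemma distinct_cover (i j k : I) : uniq [:: i; j; k] -> [:: i; j; k] =i predT.
Proof.
move=> u; apply/subset_cardP; last exact: subset_predT.
by rewrite (card_uniqP u) card_ord.
Qed.

Lemma sum_distinct (V : nmodType) (f : I -> V) i j k : uniq [:: i; j; k] ->
  \sum_l f l = f i + f j + f k.
Proof.
move=> u; have p : perm_eq (index_enum I) [:: i; j; k].
  apply: uniq_perm; rewrite ?index_enum_uniq // => l.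
  by rewrite distinct_cover // mem_index_enum.
by rewrite (perm_big _ p) !big_cons big_nil /= addr0 addrA.
Qed.

Lemma det_I (A : 'M[R]_(2 + 1)) :
  \det A = A i0 i0 * (A i1 i1 * A i2 i2 - A i1 i2 * A i2 i1)
         - A i0 i1 * (A i1 i0 * A i2 i2 - A i1 i2 * A i2 i0)
         + A i0 i2 * (A i1 i0 * A i2 i1 - A i1 i1 * A i2 i0).
Proof. exact: det3. Qed.

Lemma affine_le (l h p q M u : R) : l <= u <= h -> p + q * l <= M -> p + q * h <= M ->
  p + q * u <= M.
Proof.
case/andP=> lu uh pl ph; have [q0|q0] := leP 0 q.
  by apply: le_trans ph; rewrite lerD2l ler_wpM2l.
by apply: le_trans pl; rewrite lerD2l ler_wnM2l // ltW.
Qed.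

(** The left side is affine in each of [a], [b], [c], hence maximal at a corner
    of the box. *)
Lemma corner_product_le (x y z a b c : R) : 0 <= z -> z <= y -> y <= x -> x <= 1 ->
  x <= a <= 1 -> y <= b <= 1 -> z <= c <= 1 ->
  a * b + (1 + x - a) * c + (1 + y - b) * (1 + z - c) <= 1 + x + y * z.
Proof.
move=> z0 zy yx x1 ha hb hc.
have [y0 x0] : 0 <= y /\ 0 <= x by lra.
have [y1 z1] : y <= 1 /\ z <= 1 by lra.
have N : [/\ 0 <= (x - z) * (1 - y), 0 <= (x - y) * (1 - z), 0 <= (y - z) * (1 - x),
   0 <= (1 - y) * (1 - z) & [/\ 0 <= (1 - x) * (1 - y), 0 <= (1 - x) * (1 - z),
   0 <= y * (x - z), 0 <= z * (x - y) & [/\ 0 <= x * (y - z), 0 <= y * z, 0 <= x * y & 0 <= x * z]]].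
  by split; last (split; last split); rewrite mulr_ge0; lra.
case: N => n1 n2 n3 n4 [n5 n6 n7 n8 [n9 n10 n11 n12]].
have vert c' : z <= c' <= 1 -> forall b', y <= b' <= 1 -> forall a', a' = x \/ a' = 1 ->
    a' * b' + (1 + x - a') * c' + (1 + y - b') * (1 + z - c') <= 1 + x + y * z.
  move=> hc' b' hb' a' ha'.
  have -> : a' * b' + (1 + x - a') * c' + (1 + y - b') * (1 + z - c') =
     ((1 + x - a') * c' + (1 + y) * (1 + z - c')) + (a' - (1 + z - c')) * b' by ring.
  suff H b'' : b'' = y \/ b'' = 1 ->
     ((1 + x - a') * c' + (1 + y) * (1 + z - c')) + (a' - (1 + z - c')) * b'' <= 1 + x + y * z.
    by apply: affine_le hb' _ _; apply: H; [left|right].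
  move=> hb''.
  have -> : ((1 + x - a') * c' + (1 + y) * (1 + z - c')) + (a' - (1 + z - c')) * b'' =
    (a' * b'' + (1 + y - b'') * (1 + z)) + ((1 + x - a') - (1 + y - b'')) * c' by ring.
  by apply: affine_le hc' _ _; case: ha' => ->; case: hb'' => ->; lra.
have -> : a * b + (1 + x - a) * c + (1 + y - b) * (1 + z - c) =
  ((1 + x) * c + (1 + y - b) * (1 + z - c)) + (b - c) * a by ring.
apply: affine_le ha _ _.
  have := vert c hc b hb x (or_introl erefl); lra.
have := vert c hc b hb 1 (or_intror erefl); lra.
Qed.

End Plane.

(** * The region of sorted depths lies in two tetrahedra *)

Section Faces.
Variable R : realType.

(** If the divided difference [a * (x + l + u) + b] is nonnegative, the cubic is
    below its chord between [l] and [u]. *)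
Lemma cubic_le0 (x l u a b c d : R) : l <= x <= u -> 0 <= a * (x + l + u) + b ->
  a * l ^+ 3 + b * l ^+ 2 + c * l + d <= 0 ->
  a * u ^+ 3 + b * u ^+ 2 + c * u + d <= 0 -> l < u ->
  a * x ^+ 3 + b * x ^+ 2 + c * x + d <= 0.
Proof.
move=> /andP[lx xu] k fl fu lu.
have lu' : 0 < u - l by rewrite subr_gt0.
rewrite -(pmulr_rle0 _ lu').
have -> : (u - l) * (a * x ^+ 3 + b * x ^+ 2 + c * x + d) =
  (u - x) * (a * l ^+ 3 + b * l ^+ 2 + c * l + d) +
  (x - l) * (a * u ^+ 3 + b * u ^+ 2 + c * u + d) -
  (u - l) * ((x - l) * (u - x) * (a * (x + l + u) + b)) by ring.
have h1 : (u - x) * (a * l ^+ 3 + b * l ^+ 2 + c * l + d) <= 0.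
  by rewrite mulr_ge0_le0 ?subr_ge0.
have h2 : (x - l) * (a * u ^+ 3 + b * u ^+ 2 + c * u + d) <= 0.
  by rewrite mulr_ge0_le0 ?subr_ge0.
have h3 : 0 <= (u - l) * ((x - l) * (u - x) * (a * (x + l + u) + b)).
  by rewrite !mulr_ge0 ?subr_ge0 // ltW.
by lra.
Qed.

(** The constant [34 / 55] here and below is slightly above the inverse of the
    golden ratio, at which the two area conditions meet when [z = 0] and [x = y]. *)
Lemma wide_cubic (x : R) : 34/55 <= x <= 7 / 9 ->
  x ^+ 3 - 869/1899 * x ^+ 2 - 1595/1899 * x + 869/1899 <= 0.
Proof.
move=> h; have := @cubic_le0 x (34/55) (7/9) 1 (- (869/1899)) (- (1595/1899)) (869/1899) h.
case/andP: h => lx _; rewrite !mul1r !mulNr; apply; [|clear x lx|clear x lx|clear x lx]; lra.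
Qed.

Lemma round_cubic (x : R) : 34/55 <= x <= 25/32 ->
  58/125 * x ^+ 3 - (67/125+2/49) * x ^+ 2 + 13/115 * x + 2/49 <= 0.
Proof.
move=> h; have := @cubic_le0 x (34/55) (25/32) (58/125) (- (67/125+2/49)) (13/115) (2/49) h.
case/andP: h => lx _; rewrite !mulNr; apply; [|clear x lx|clear x lx|clear x lx]; lra.
Qed.

(** The points beyond the plane through [(1, 0, 0)], [P] and [Q] violate one of the
    two area conditions. *)
Lemma wide_face (x y z : R) : 0 <= z -> z <= y -> y <= x -> x * (1 + y) <= 1 ->
  (1 + x) * (y + z) <= 1 ->
  x + 391 / 633 * (y - z) + 7 / 9 * z <= 1.
Proof.
move=> z0 zy yx C1 C2.
have x0 : 0 <= x by lra.
have [s|s] := leP y (2 / 7).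
  suff : x + 7/9*y <= 1 by lra.
  rewrite -subr_ge0 -(pmulr_rge0 _ (_ : 0 < 1 + y)); last by lra.
  have : 0 <= y * (2/7 - y) by rewrite mulr_ge0; lra.
  by lra.
have x7 : x <= 7 / 9 by nra.
pose c : R := 869/1899.
have e1 : (1 + x) * (x + 391 / 633 * (y - z) + 7 / 9 * z) <=
   (1+x) * x + c * (1+x)*y + 304/1899 by rewrite /c; lra.
have x1 : 0 < 1 + x by lra.
rewrite -(ler_pM2l x1) mulr1 (le_trans e1) //.
have [u|u] := leP x (34/55).
  by have : 0 <= x * (34/55 - x); [rewrite mulr_ge0; lra|rewrite /c; lra].
rewrite -(ler_pM2l (_ : 0 < x)); last by lra.
have /wide_cubic : 34/55 <= x <= 7/9 by rewrite (ltW u).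
have : y * x <= 1 - x by lra.
move=> e2; have : (1 + x) * (y * x) <= (1 + x) * (1 - x) by rewrite ler_pM2l.
rewrite /c; clear -x0; lra.
Qed.

(** The same for the plane through [P], [Q] and the point [H] near
    [x = y = z = (sqrt 3 - 1) / 2], where the second condition is an equality. *)
Lemma round_face (x y z : R) : 0 <= z -> z <= y -> y <= x -> x * (1 + y) <= 1 ->
  (1 + x) * (y + z) <= 1 ->
  x <= y + 16 / 9 * z ->
  (y - z) * (1024 / 633) + 2 * (x - y) + (z - 9 / 16 * (x - y)) * (1024 / 375) <= 1.
Proof.
move=> z0 zy yx C1 C2.
move=> h.
have [s|s] := leP x (375 / 1024); first by lra.
have x1 : 0 < 1 + x by lra.
have e : (y - z) * (1024 / 633) + 2 * (x - y) + (z - 9 / 16 * (x - y)) * (1024 / 375)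
 <= 58/125*x + 128/115 * (y+z) + 2/49*y by lra.
apply: (le_trans e).
rewrite -(ler_pM2l x1) mulr1.
have [u|u] := leP x (34/55).
  have q : (x - 375/1024)*(34/55 - x) >= 0 by rewrite mulr_ge0; lra.
  have : y * (1 + x) <= x * (1 + x) by rewrite ler_pM2r.
  by lra.
have x8 : x <= 25/32 by nra.
rewrite -(ler_pM2l (_ : 0 < x)); last by lra.
have /round_cubic : 34/55 <= x <= 25/32 by rewrite (ltW u).
have : x * ((1+x)*(y+z)) <= x by rewrite ger_pMr //; lra.
have : (x * (1+y))*(1+x) <= 1+x by rewrite ger_pMl.
by lra.
Qed.
End Faces.

(** * A certificate for all pairs of depths *)

Section Cells.
Import ZArith.
Local Open Scope Z_scope.

Definition zvec := (Z * Z * Z)%type.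
Definition zcell := (zvec * zvec * zvec * zvec)%type.
Definition z12 := (Z * Z * Z * Z * Z * Z * Z * Z * Z * Z * Z * Z)%type.

(** A subdivision tree for pairs of tetrahedra.  A cut bisects an edge of the
    second tetrahedron (if the boolean is true) or of the first one.  A leaf holds an
    orientation, a permutation of the three depths, a weight [p] and parameters for
    the vertices of both tetrahedra. *)
Inductive cert :=
| Leaf of bool & nat & Z & z12 & z12
| Cut of bool & nat & nat & cert & cert.

(** Depths are multiples of [1 / unit_m] and parameters multiples of
    [1 / unit_a]. *)
Definition unit_m : Z := 4194304.
Definition unit_a : Z := 256.

Definition z38 : Z := 38.
Definition z4096 : Z := 4096.
Definition z123 : Z := 123.
Definition z64 : Z := 64.
Definition z2 : Z := 2.
Definition z1 : Z := 1.

Definition cell_of (c : z12) : zcell :=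
  let '(a1, a2, a3, b1, b2, b3, c1, c2, c3, d1, d2, d3) := c in
  ((a1, a2, a3), (b1, b2, b3), (c1, c2, c3), (d1, d2, d3)).

Definition perm3 T (k : nat) (v : T * T * T) : T * T * T :=
  let '(x, y, z) := v in
  match k with
  | 0%nat => (x, y, z) | 1%nat => (x, z, y) | 2%nat => (y, x, z)
  | 3%nat => (y, z, x) | 4%nat => (z, x, y) | _ => (z, y, x)
  end.

Definition map_cell X Y (f : X -> Y) (c : X * X * X * X) : Y * Y * Y * Y :=
  let '(a, b, c, d) := c in (f a, f b, f c, f d).

Definition all_cell X (f : X -> bool) (c : X * X * X * X) : bool :=
  let '(a, b, c, d) := c in [&& f a, f b, f c & f d].

Definition zip_cell X Y (c : X * X * X * X) (c' : Y * Y * Y * Y) :=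
  let '(a, b, c, d) := c in let '(a', b', c', d') := c' in
  ((a, a'), (b, b'), (c, c'), (d, d')).

Definition zroom (o : bool) (q : zvec) : zvec :=
  let '(x, y, z) := q in
  if o then (unit_m - x, unit_m - y, unit_m - z) else (y + z, x + z, x + y).

Definition zsize (o : bool) (q : zvec) : Z :=
  let '(x, y, z) := q in if o then z2 * unit_m else unit_m + (x + y + z).

Definition zdot (m a : zvec) : Z :=
  let '(x, y, z) := m in let '(a, b, c) := a in x * a + y * b + z * c.

Definition zfits (m a d : zvec) : bool :=
  let '(x, y, z) := m in let '(a, b, c) := a in let '(d1, d2, d3) := d in
  [&& unit_m * a + y * b <=? unit_a * d3, unit_m * a + z * c <=? unit_a * d2,
      unit_m * b + x * a <=? unit_a * d3, unit_m * b + z * c <=? unit_a * d1,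
      unit_m * c + x * a <=? unit_a * d2 & unit_m * c + y * b <=? unit_a * d1].

Definition znneg (a : zvec) : bool :=
  let '(a, b, c) := a in [&& 0 <=? a, 0 <=? b & 0 <=? c].

Definition zside (o : bool) (S T al : zcell) : bool :=
  all_cell (fun qa : zvec * zvec =>
    znneg qa.2 && all_cell (fun m => zfits m qa.2 (zroom o qa.1)) S)
    (zip_cell T al).

(** Certifies [F * G <= (123 / 76)^2 < 2.62] by the inequality of arithmetic and
    geometric means for [(p / 64) F] and [(64 / p) G], which unlike the product is
    compatible with averages. *)
Definition zamgm (p F G : Z) : bool :=
  z38 * (p * p * F + z4096 * G) <=? z123 * z64 * p * (unit_m * unit_a).

Definition zprod (o : bool) (p : Z) (S T al be : zcell) : bool :=
  all_cell (fun mb : zvec * zvec => all_cell (fun qa : zvec * zvec =>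
    let F := unit_a * zsize o qa.1 - zdot mb.1 qa.2 in
    let G := unit_a * zsize o mb.1 - zdot qa.1 mb.2 in
    [&& z1 <=? F, z1 <=? G & zamgm p F G])
    (zip_cell T al)) (zip_cell S be).

Definition zmid (a b : zvec) : zvec :=
  let '(x, y, z) := a in let '(x', y', z') := b in
  (Z.div2 (x + x'), Z.div2 (y + y'), Z.div2 (z + z')).

Definition zeven (a b : zvec) : bool :=
  let '(x, y, z) := a in let '(x', y', z') := b in
  [&& Z.even (x + x'), Z.even (y + y') & Z.even (z + z')].

Definition cell_get X (c : X * X * X * X) (i : nat) : X :=
  let '(x, y, z, t) := c in
  match i with 0%nat => x | 1%nat => y | 2%nat => z | _ => t end.

Definition cell_set X (c : X * X * X * X) (i : nat) (v : X) :=
  let '(x, y, z, t) := c in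
  match i with
  | 0%nat => (v, y, z, t) | 1%nat => (x, v, z, t)
  | 2%nat => (x, y, v, t) | _ => (x, y, z, v)
  end.

(** The midpoint of an edge is exact only if the sums of its coordinates are
    even, which is part of the check. *)
Fixpoint zcheck (c : cert) (S T : zcell) : bool :=
  match c with
  | Leaf o k p al be =>
    let T' := map_cell (perm3 k) T in
    let al := cell_of al in let be := cell_of be in
    [&& 0 <? p, zside o S T' al, zside o T' S be & zprod o p S T' al be]
  | Cut b i j c1 c2 =>
    let X := if b then T else S in
    let v := cell_get X i in let w := cell_get X j in
    let X1 := cell_set X i (zmid v w) in let X2 := cell_set X j (zmid v w) in
    [&& leq i 3, leq j 3, ~~ eqn i j, zeven v w &
      if b then zcheck c1 S X1 && zcheck c2 S X2
      else zcheck c1 X1 T && zcheck c2 X2 T]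
  end.

End Cells.

Section Sound.
Variable R : realType.
Implicit Types (m q a d : R * R * R).

(** [room o q] bounds below the sum of two coordinates on a body of depths [q], and
    [extent o q] is the total of the three coordinates [g_j + q_j] (parallel, [o]
    false) or [1 - g_j] (opposite, [o] true). *)
Definition room (o : bool) q : R * R * R :=
  let '(x, y, z) := q in
  if o then (1 - x, 1 - y, 1 - z) else (y + z, x + z, x + y).

Definition extent (o : bool) q : R :=
  let '(x, y, z) := q in if o then 2 else 1 + (x + y + z).

Definition dot3 m a : R :=
  let '(x, y, z) := m in let '(a, b, c) := a in x * a + y * b + z * c.

Definition fits m a d : Prop :=
  let '(x, y, z) := m in let '(a, b, c) := a in let '(d1, d2, d3) := d in
  [/\ [/\ 0 <= a, 0 <= b & 0 <= c], a + y * b <= d3 /\ a + z * c <= d2,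
      b + x * a <= d3 /\ b + z * c <= d1 & c + x * a <= d2 /\ c + y * b <= d1].

(** The parameters [a] and [b] inscribe bodies with depths [m] and [m'] in each
    other with ratios whose product is at least [100 / 262]. *)
Definition close_pair m m' : Prop :=
  exists o k a b, let q := perm3 k m' in
  [/\ fits m a (room o q), fits q b (room o m),
      0 < extent o q - dot3 m a, 0 < extent o m - dot3 q b &
      (extent o q - dot3 m a) * (extent o m - dot3 q b) <= 262 / 100].

Section Average.
Variables (t t' : 'I_4 -> R).
Definition weights (s : 'I_4 -> R) := (forall e, 0 <= s e) /\ \sum_e s e = 1.
Hypotheses (tw : weights t) (tw' : weights t').

Definition avg2 (h : 'I_4 -> 'I_4 -> R) : R := \sum_e \sum_f t e * t' f * h e f.

Lemma avg2_le h h' : (forall e f, h e f <= h' e f) -> avg2 h <= avg2 h'.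
Proof.
move=> hh; apply: ler_sum => e _; apply: ler_sum => f _.
by apply: ler_wpM2l; rewrite ?mulr_ge0 ?(tw.1) ?(tw'.1).
Qed.

Lemma avg2_prod (u v : 'I_4 -> R) :
  avg2 (fun e f => u e * v f) = (\sum_e t e * u e) * (\sum_f t' f * v f).
Proof.
rewrite mulr_suml; apply: eq_bigr => e _; rewrite mulr_sumr.
by apply: eq_bigr => f _; ring.
Qed.

Lemma avg2D h h' : avg2 (fun e f => h e f + h' e f) = avg2 h + avg2 h'.
Proof.
rewrite -big_split; apply: eq_bigr => e _; rewrite -big_split.
by apply: eq_bigr => f _ /=; ring.
Qed.

Lemma avg2Z c h : avg2 (fun e f => c * h e f) = c * avg2 h.
Proof.
rewrite /avg2 mulr_sumr; apply: eq_bigr => e _; rewrite mulr_sumr.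
by apply: eq_bigr => f _ /=; ring.
Qed.

Lemma avg2B h h' : avg2 (fun e f => h e f - h' e f) = avg2 h - avg2 h'.
Proof.
rewrite -[RHS]/(_ + - _) -mulN1r -avg2Z -avg2D.
by apply: eq_bigr => e _; apply: eq_bigr => f _; ring.
Qed.

Lemma avg2_l (u : 'I_4 -> R) : avg2 (fun e _ => u e) = \sum_e t e * u e.
Proof.
rewrite -[RHS]mulr1 -(tw'.2) -[in RHS](eq_bigr _ (fun f _ => mulr1 (t' f))).
by rewrite -avg2_prod; apply: eq_bigr => e _; apply: eq_bigr => f _; rewrite mulr1.
Qed.

Lemma avg2_r (v : 'I_4 -> R) : avg2 (fun _ f => v f) = \sum_f t' f * v f.
Proof.
rewrite -[RHS]mul1r -(tw.2) -[in RHS](eq_bigr _ (fun f _ => mulr1 (t f))).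
by rewrite -avg2_prod; apply: eq_bigr => e _; apply: eq_bigr => f _; rewrite mul1r.
Qed.

Lemma avg2_cst c : avg2 (fun _ _ => c) = c.
Proof. by rewrite (avg2_l (fun=> c)) -mulr_suml (tw.2) mul1r. Qed.

End Average.

(** Locked, so that large integers are never unfolded to unary numbers. *)
Definition zr : BinNums.Z -> R := locked (fun z => (int_of_Z z)%:~R).
Lemma zrE z : zr z = (int_of_Z z)%:~R.
Proof. by rewrite /zr -lock. Qed.
Lemma zr0 : zr BinNums.Z0 = 0. Proof. by rewrite zrE. Qed.

Lemma zrD x y : zr (BinInt.Z.add x y) = zr x + zr y.
Proof. by rewrite !zrE -[BinInt.Z.add x y]/(x + y) rmorphD /= intrD. Qed.
Lemma zrB x y : zr (BinInt.Z.sub x y) = zr x - zr y.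
Proof. by rewrite !zrE -[BinInt.Z.sub x y]/(x - y) rmorphB /= intrB. Qed.
Lemma zrM x y : zr (BinInt.Z.mul x y) = zr x * zr y.
Proof. by rewrite !zrE -[BinInt.Z.mul x y]/(x * y) rmorphM /= intrM. Qed.
Lemma zr_le x y : BinInt.Z.leb x y -> zr x <= zr y.
Proof. by rewrite !zrE ler_int => h; lia. Qed.
Lemma zr_lt x y : BinInt.Z.ltb x y -> zr x < zr y.
Proof. by rewrite !zrE ltr_int => h; lia. Qed.

Definition um : R := zr unit_m.
Definition ua : R := zr unit_a.

Lemma umE : zr unit_m = um. Proof. reflexivity. Qed.
Lemma uaE : zr unit_a = ua. Proof. reflexivity. Qed.

Lemma um_gt0 : 0 < um.
Proof. rewrite -zr0 -umE; apply: zr_lt; reflexivity. Qed.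
Lemma ua_gt0 : 0 < ua.
Proof. rewrite -zr0 -uaE; apply: zr_lt; reflexivity. Qed.

Definition mean (u : R) (t : 'I_4 -> R) (c : zcell) : R * R * R :=
  (\sum_e t e * (zr (cell_get c e).1.1 / u),
   \sum_e t e * (zr (cell_get c e).1.2 / u),
   \sum_e t e * (zr (cell_get c e).2 / u)).

Definition hull (c : zcell) m := exists2 t, weights t & m = mean um t c.

Lemma all_cellP X (f : X -> bool) c : all_cell f c -> forall e : 'I_4, f (cell_get c e).
Proof.
by case: c => [[[x y] z] w] /= /and4P[? ? ? ?] [[|[|[|[|e]]]]].
Qed.

Lemma zip_get X Y (c : X * X * X * X) (c' : Y * Y * Y * Y) (e : nat) :
  cell_get (zip_cell c c') e = (cell_get c e, cell_get c' e).
Proof.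
by case: c => [[[x y] z] w]; case: c' => [[[x' y'] z'] w']; case: e => [|[|[|e]]].
Qed.

Lemma map_get X Y (f : X -> Y) c e : cell_get (map_cell f c) e = f (cell_get c e).
Proof. by case: c => [[[x y] z] w]; case: e => [|[|[|e]]]. Qed.

Lemma hull_perm k c m : hull c m -> hull (map_cell (perm3 k) c) (perm3 k m).
Proof.
case=> t tw ->; exists t => //; rewrite /mean.
under [X in _ = (X, _, _)]eq_bigr do rewrite map_get.
under [X in _ = (_, X, _)]eq_bigr do rewrite map_get.
under [X in _ = (_, _, X)]eq_bigr do rewrite map_get.
have E (e : 'I_4) : cell_get c e =
  ((cell_get c e).1.1, (cell_get c e).1.2, (cell_get c e).2).
  by case: (cell_get c e) => [[]].
case: k => [|[|[|[|[|k]]]]] /=; (congr (_, _, _);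
  apply: eq_bigr => e _; by rewrite {2}E).
Qed.

Lemma mean_fits o S T al t t' : weights t -> weights t' -> zside o S T al ->
  fits (mean um t S) (mean ua t' al) (room o (mean um t' T)).
Proof.
move=> tw tw' /all_cellP H.
have {}H (e f : 'I_4) : zfits (cell_get S e) (cell_get al f) (zroom o (cell_get T f)) /\
    znneg (cell_get al f).
  by have := H f; rewrite zip_get /= => /andP[-> /all_cellP]; split.
have [um0 ua0] := (um_gt0, ua_gt0).
(* both sides of a constraint are affine in each of the two averages, so that it
   is enough to have it for every pair of vertices *)
have key (y b a d : 'I_4 -> BinNums.Z) (D : R) :
    (forall e f, BinInt.Z.leb (BinInt.Z.add (BinInt.Z.mul unit_m (a f))
        (BinInt.Z.mul (y e) (b f))) (BinInt.Z.mul unit_a (d f))) ->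
    D = \sum_f t' f * (zr (d f) / um) ->
    \sum_f t' f * (zr (a f) / ua)
     + (\sum_e t e * (zr (y e) / um)) * (\sum_f t' f * (zr (b f) / ua)) <= D.
  move=> h ->; rewrite -(avg2_r t' tw) -avg2_prod -(avg2_r t' tw) -avg2D.
  apply: avg2_le => // e f; have /zr_le := h e f.
  rewrite zrD !zrM umE uaE => hh; rewrite -subr_ge0.
  have -> : zr (d f) / um - (zr (a f) / ua + zr (y e) / um * (zr (b f) / ua)) =
     (ua * zr (d f) - (um * zr (a f) + zr (y e) * zr (b f))) / (um * ua).
    by field; rewrite !gt_eqF.
  by rewrite divr_ge0 ?subr_ge0 // ltW // mulr_gt0.
have nn (a : 'I_4 -> BinNums.Z) : (forall f, BinInt.Z.leb BinNums.Z0 (a f)) ->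
    0 <= \sum_f t' f * (zr (a f) / ua).
  move=> h; apply: sumr_ge0 => f _; rewrite mulr_ge0 ?(tw'.1) // divr_ge0 ?(ltW ua0) //.
  by have /zr_le := h f; rewrite zr0.
have lin1 (d : 'I_4 -> BinNums.Z) :
    1 - \sum_e t' e * (zr (d e) / um) =
    \sum_f t' f * (zr (BinInt.Z.sub unit_m (d f)) / um).
  rewrite -{1}(tw'.2) -sumrB; apply: eq_bigr => f _.
  by rewrite zrB umE; field; rewrite gt_eqF.
have lin2 (d d' : 'I_4 -> BinNums.Z) :
    \sum_e t' e * (zr (d e) / um) + \sum_e t' e * (zr (d' e) / um) =
    \sum_f t' f * (zr (BinInt.Z.add (d f) (d' f)) / um).
  rewrite -big_split; apply: eq_bigr => f _ /=.
  by rewrite zrD; field; rewrite gt_eqF.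
have room1 f : (zroom o (cell_get T f)).1.1 = (if o
    then BinInt.Z.sub unit_m (cell_get T f).1.1
    else BinInt.Z.add (cell_get T f).1.2 (cell_get T f).2).
  by case: (cell_get T f) => [[]]; case: (o).
have room2 f : (zroom o (cell_get T f)).1.2 = (if o
    then BinInt.Z.sub unit_m (cell_get T f).1.2
    else BinInt.Z.add (cell_get T f).1.1 (cell_get T f).2).
  by case: (cell_get T f) => [[]]; case: (o).
have room3 f : (zroom o (cell_get T f)).2 = (if o
    then BinInt.Z.sub unit_m (cell_get T f).2
    else BinInt.Z.add (cell_get T f).1.1 (cell_get T f).1.2).
  by case: (cell_get T f) => [[]]; case: (o).
have roomE : room o (mean um t' T) =
    (\sum_f t' f * (zr (zroom o (cell_get T f)).1.1 / um),
     \sum_f t' f * (zr (zroom o (cell_get T f)).1.2 / um),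
     \sum_f t' f * (zr (zroom o (cell_get T f)).2 / um)).
  under [X in _ = (X, _, _)]eq_bigr do rewrite room1.
  under [X in _ = (_, X, _)]eq_bigr do rewrite room2.
  under [X in _ = (_, _, X)]eq_bigr do rewrite room3.
  by rewrite /room /mean; case: (o); rewrite ?lin1 ?lin2.
rewrite roomE /mean; split; split.
1-3: apply: nn => f; have := (H f f).2.
1-3: by case: (cell_get al f) => [[? ?] ?] /and3P[].
all: apply: (key _ _ _ _ _ _ erefl) => e f; have := (H e f).1.
all: by case: (cell_get S e) (cell_get al f) (zroom o (cell_get T f))
       => [[? ?] ?] [[? ?] ?] [[? ?] ?] /and5P[? ? ? ? /andP[? ?]].
Qed.

Lemma two_term_amgm (P F G q k : R) : 0 < P -> 0 < F -> 0 < G -> 0 < q -> 0 <= k ->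
  P ^+ 2 * F + q * G <= k * P -> F * G <= k ^+ 2 / (4 * q).
Proof.
move=> P0 F0 G0 q0 k0 h; have P2 : 0 < P ^+ 2 by rewrite exprn_gt0.
rewrite ler_pdivlMr ?mulr_gt0 // -(ler_pM2l P2) -exprMn [P * k]mulrC.
have X0 : 0 <= P ^+ 2 * F + q * G by rewrite addr_ge0 ?mulr_ge0 ?ltW.
apply: (@le_trans _ _ ((P ^+ 2 * F + q * G) ^+ 2)); last first.
  by rewrite ler_sqr // nnegrE (le_trans X0).
rewrite -subr_ge0.
have -> : (P ^+ 2 * F + q * G) ^+ 2 - P ^+ 2 * (F * G * (4 * q)) =
  (P ^+ 2 * F - q * G) ^+ 2 by ring.
exact: sqr_ge0.
Qed.

(** The linear inequality behind [zamgm] holds at all pairs of vertices, hence for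
    the averages, where the inequality of means gives back the product. *)
Lemma mean_prod o p S T al be t t' : weights t -> weights t' ->
  BinInt.Z.ltb BinNums.Z0 p -> zprod o p S T al be ->
  let F := extent o (mean um t' T) - dot3 (mean um t S) (mean ua t' al) in
  let G := extent o (mean um t S) - dot3 (mean um t' T) (mean ua t be) in
  [/\ 0 < F, 0 < G & F * G <= 262 / 100].
Proof.
move=> tw tw' p0 /all_cellP H F G.
pose F0 (e f : 'I_4) := BinInt.Z.sub (BinInt.Z.mul unit_a (zsize o (cell_get T f)))
  (zdot (cell_get S e) (cell_get al f)).
pose G0 (e f : 'I_4) := BinInt.Z.sub (BinInt.Z.mul unit_a (zsize o (cell_get S e)))
  (zdot (cell_get T f) (cell_get be e)).
have {}H (e f : 'I_4) :
    [&& BinInt.Z.leb z1 (F0 e f), BinInt.Z.leb z1 (G0 e f) & zamgm p (F0 e f) (G0 e f)].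
  have := H e; rewrite zip_get => /all_cellP /(_ f); rewrite zip_get.
  exact.
have [um0 ua0] := (um_gt0, ua_gt0).
have sizeE c (s : 'I_4 -> R) : weights s ->
    extent o (mean um s c) = \sum_e s e * (zr (zsize o (cell_get c e)) / um).
  move=> sw; rewrite /extent /mean; case: (o).
    transitivity (2 * \sum_e s e); first by rewrite (sw.2) mulr1.
    rewrite mulr_sumr; apply: eq_bigr => e _.
    have -> : zsize true (cell_get c e) = BinInt.Z.mul z2 unit_m.
      by case: (cell_get c e) => [[]].
    rewrite zrM umE.
    have -> : zr z2 = 2 by rewrite zrE.
    by field; rewrite gt_eqF.
  rewrite -{1}(sw.2) -!big_split; apply: eq_bigr => e _ /=.
  case: (cell_get c e) => [[x y] z]; rewrite /zsize !zrD umE /=.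
  by field; rewrite gt_eqF.
have dotE c c' (s s' : 'I_4 -> R) :
    dot3 (mean um s c) (mean ua s' c') =
    avg2 s s' (fun e f => zr (zdot (cell_get c e) (cell_get c' f)) / (um * ua)).
  rewrite /dot3 /mean -!avg2_prod -!avg2D; apply: eq_bigr => e _.
  apply: eq_bigr => f _; case: (cell_get c e) (cell_get c' f) => [[x y] z] [[a b] d].
  rewrite /zdot !zrD !zrM /=; field; rewrite !gt_eqF //.
have avg2C c c' : avg2 t' t (fun e f => zr (zdot (cell_get c e) (cell_get c' f)) / (um * ua))
    = avg2 t t' (fun e f => zr (zdot (cell_get c f) (cell_get c' e)) / (um * ua)).
  rewrite /avg2 exchange_big; apply: eq_bigr => e _; apply: eq_bigr => f _.
  by rewrite [t' f * _]mulrC.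
have FE : F = avg2 t t' (fun e f => zr (F0 e f) / (um * ua)).
  rewrite /F sizeE // dotE -(avg2_r t' tw) -avg2B.
  apply: eq_bigr => e _; apply: eq_bigr => f _; rewrite /F0 zrB zrM uaE.
  by field; rewrite !gt_eqF.
have GE : G = avg2 t t' (fun e f => zr (G0 e f) / (um * ua)).
  rewrite /G sizeE // dotE avg2C -(avg2_l t tw') -avg2B.
  apply: eq_bigr => e _; apply: eq_bigr => f _; rewrite /G0 zrB zrM uaE.
  by field; rewrite !gt_eqF.
have ua1 : 0 < um * ua by rewrite mulr_gt0.
have pos h : (forall e f, BinInt.Z.leb z1 (h e f)) ->
    0 < avg2 t t' (fun e f => zr (h e f) / (um * ua)).
  move=> h1; apply: (@lt_le_trans _ _ (1 / (um * ua))); first by rewrite divr_gt0.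
  rewrite -[X in X <= _](avg2_cst tw tw'); apply: avg2_le => // e f.
  rewrite ler_pM2r ?invr_gt0 //; have /zr_le := h1 e f.
  by have -> : zr z1 = 1 by rewrite zrE.
have F_gt0 : 0 < F by rewrite FE; apply: pos => e f; have /and3P[] := H e f.
have G_gt0 : 0 < G by rewrite GE; apply: pos => e f; have /and3P[] := H e f.
split => //; set P := zr p.
have P0 : 0 < P by have /zr_lt := p0; rewrite zr0.
pose k := 123 * 64 / 38 : R; pose q := 4096 : R.
have q0 : 0 < q by rewrite ltr0n.
have lin : P ^+ 2 * F + q * G <= k * P.
  rewrite FE GE -!(avg2Z t t') -avg2D -[leRHS](avg2_cst tw tw').
  apply: avg2_le => // e f; have /and3P[_ _ /zr_le] := H e f.
  rewrite !zrM zrD !zrM umE uaE -/P.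
  have -> : zr z4096 = q by rewrite zrE.
  have -> : zr z123 * zr z64 = zr z38 * k.
    by rewrite !zrE /k mulrCA mulfV ?mulr1 // pnatr_eq0.
  have z0 : 0 < zr z38 by rewrite -zr0; apply: zr_lt.
  move: (k) (q) (zr z38) z0 => k' q' z z0 h.
  rewrite -(ler_pM2r ua1) -(ler_pM2l z0); apply: le_trans (le_trans h _).
    rewrite le_eqVlt; apply/orP; left; apply/eqP; field.
    by rewrite !gt_eqF.
  by rewrite !mulrA.
have k0 : 0 <= k by rewrite /k divr_ge0 ?mulr_ge0 ?ler0n.
apply: le_trans (two_term_amgm P0 F_gt0 G_gt0 q0 k0 lin) _.
by rewrite /k /q; lra.
Qed.

End Sound.

Section Sound2.
Variable R : realType.
Implicit Types (m q a d : R * R * R).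
Local Notation zr := (@zr R).

Lemma cell_set_same X (c : X * X * X * X) (i : 'I_4) v : cell_get (cell_set c i v) i = v.
Proof. by case: c => [[[x y] z] w]; case: i => [[|[|[|[|i]]]]]. Qed.

Lemma cell_set_other X (c : X * X * X * X) (i j : 'I_4) v :
  j != i -> cell_get (cell_set c i v) j = cell_get c j.
Proof.
by case: c => [[[x y] z] w]; case: i => [[|[|[|[|i]]]] ?] //; case: j => [[|[|[|[|j]]]] ?].
Qed.

(** Of the two ends of the edge, the one with the smaller weight is replaced by
    the midpoint. *)
Lemma hull_bisect c (i j : 'I_4) m : i != j -> zeven (cell_get c i) (cell_get c j) ->
  let v := zmid (cell_get c i) (cell_get c j) in
  hull c m -> hull (cell_set c i v) m \/ hull (cell_set c j v) m.
Proof.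
move=> ij ev v [t [t0 t1] ->].
have half (x y : BinNums.Z) : BinInt.Z.even (BinInt.Z.add x y) ->
    zr (BinInt.Z.div2 (BinInt.Z.add x y)) = (zr x + zr y) / 2.
  move: (BinInt.Z.add x y) (zrD R x y) => a <- ev_a.
  have := BinInt.Z.div2_odd a; rewrite -BinInt.Z.negb_even ev_a BinInt.Z.add_0_r => E.
  rewrite [in RHS]E zrM; have -> : zr (BinNums.Zpos (BinNums.xO BinNums.xH)) = 2 by rewrite zrE.
  by field.
have [v1 v2 v3] : [/\ zr v.1.1 = (zr (cell_get c i).1.1 + zr (cell_get c j).1.1) / 2,
    zr v.1.2 = (zr (cell_get c i).1.2 + zr (cell_get c j).1.2) / 2 &
    zr v.2 = (zr (cell_get c i).2 + zr (cell_get c j).2) / 2].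
  move: ev; rewrite {}/v; case: (cell_get c i) (cell_get c j) => [[x y] z] [[x' y'] z'].
  by move=> /and3P[? ? ?]; rewrite /= !half.
clearbody v; clear ev; wlog tij : i j ij v1 v2 v3 / t i <= t j.
  move=> W; have [le|lt] := leP (t i) (t j); first exact: (W i j).
  apply/or_comm; apply: W; rewrite 1?eq_sym ?(ltW lt) //.
  1-3: lra.
left; pose s e := if e == i then 2 * t i else if e == j then t j - t i else t e.
have sum (x y : 'I_4 -> R) : (forall e, e != i -> y e = x e) ->
    y i = (x i + x j) / 2 -> \sum_e s e * y e = \sum_e t e * x e.
  move=> H Hi; rewrite (bigD1 i) // [RHS](bigD1 i) //= (bigD1 j) 1?eq_sym //=.
  rewrite [X in _ = _ + X](bigD1 j) 1?eq_sym //= /s eqxx eq_sym (negbTE ij) eqxx.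
  rewrite Hi (H j) 1?eq_sym // !addrA; congr (_ + _); last first.
    by apply: eq_bigr => e /andP[ei ej]; rewrite (negbTE ei) (negbTE ej) H.
  by field.
exists s.
  split=> [e|]; first by rewrite /s; case: ifP => // _; [rewrite mulr_ge0|case: ifP => // _; rewrite subr_ge0].
  rewrite -t1 -[LHS](eq_bigr _ (fun e _ => mulr1 (s e))) -[RHS](eq_bigr _ (fun e _ => mulr1 (t e))).
  by apply: (sum (fun=> 1) (fun=> 1)) => //; field.
congr (_, _, _); apply/esym; (apply: sum => [e ei|]; first by rewrite cell_set_other).
- by rewrite cell_set_same v1; field; rewrite gt_eqF ?um_gt0.
- by rewrite cell_set_same v2; field; rewrite gt_eqF ?um_gt0.
- by rewrite cell_set_same v3; field; rewrite gt_eqF ?um_gt0.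
Qed.

Lemma zcheck_sound c S T m m' : zcheck c S T -> hull S m -> hull T m' -> close_pair m m'.
Proof.
elim: c S T => [rev k p al be|b i j c1 IH1 c2 IH2] S T /=.
  move=> /and4P[p0 sK sL pr] hS /(hull_perm k).
  case: hS => t tw -> hT; case: hT => t' tw' Em'.
  have [F0 G0 FG] := mean_prod tw tw' p0 pr.
  exists rev, k, (mean (ua R) t' (cell_of al)), (mean (ua R) t (cell_of be)).
  by rewrite /= Em'; split => //; apply: mean_fits.
move=> /and5P[i4 j4 nij]; rewrite -ltnS in i4; rewrite -ltnS in j4.
pose i' := Ordinal i4; pose j' := Ordinal j4; have ij : i' != j' by [].
case: b => ev /andP[ch1 ch2] hS hT.
  by have [/(IH1 _ _ ch1 hS)|/(IH2 _ _ ch2 hS)] := @hull_bisect T i' j' m' ij ev hT.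
have [h1|h2] := @hull_bisect S i' j' m ij ev hS; first exact: (IH1 _ _ ch1).
exact: (IH2 _ _ ch2).
Qed.

End Sound2.

(** * The data of the certificate *)

Section Certificates.
Import ZArith.
Local Open Scope Z_scope.
(* leaves with parallel and with opposite sides, cuts of the first and of the second
   tetrahedron *)
Local Notation A := (Leaf false).
Local Notation B := (Leaf true).
Local Notation S := (Cut false).
Local Notation T := (Cut true).

Definition cert0 : cert :=
S 1 0
(S 3 0
(S 2 0
(A 0 54 (0,0,0,256,0,0,158,158,1,232,129,104) (0,0,0,128,0,0,79,79,0,136,0,0))
(S 2 1
(A 0 58 (0,0,0,256,0,0,158,158,1,232,129,104) (79,79,0,128,0,0,143,79,0,136,0,0))
(S 3 2
(T 1 0
(T 3 0
(A 0 69 (0,0,0,128,0,0,158,158,3,93,69,29) (79,79,0,143,79,0,158,158,1,147,115,0))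
(A 0 62 (93,69,29,128,0,0,158,158,3,186,139,58) (79,79,0,143,79,0,158,158,0,145,112,7)))
(A 0 60 (128,0,0,256,0,0,158,158,3,186,139,58) (79,79,0,143,79,0,158,158,0,147,79,0)))
(A 0 60 (0,0,0,256,0,0,158,158,1,222,130,94) (79,79,0,143,79,0,147,79,0,136,0,0)))))
(T 1 0
(T 3 0
(T 2 0
(A 0 76 (0,0,0,128,0,0,79,79,0,125,17,38) (116,64,52,128,0,0,158,158,1,232,129,104))
(T 2 1
(A 0 72 (79,79,0,128,0,0,143,79,0,125,17,38) (116,64,52,128,0,0,158,158,1,232,129,104))
(A 0 67 (79,79,0,143,79,0,158,158,0,125,17,38) (94,67,30,128,0,0,158,158,1,188,135,60))))
(S 2 1
(T 2 1
(A 0 64 (123,39,39,128,0,0,143,79,0,247,79,79) (123,39,39,128,0,0,143,79,0,247,79,79))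
(A 0 62 (123,39,39,143,79,0,158,158,0,247,79,79) (112,38,48,128,0,0,143,79,0,225,76,96)))
(T 2 1
(A 0 66 (112,38,48,128,0,0,143,79,0,225,76,96) (123,39,39,143,79,0,158,158,0,247,79,79))
(A 0 64 (112,38,48,143,79,0,158,158,0,225,76,96) (112,38,48,143,79,0,158,158,0,225,76,96)))))
(T 2 1
(A 0 63 (128,0,0,256,0,0,207,79,0,250,35,76) (136,0,0,128,0,0,158,158,0,256,16,16))
(B 0 60 (236,32,71,176,48,3,97,97,2,171,21,43) (204,25,54,238,29,63,97,97,2,171,21,43)))))
(T 1 0
(S 2 1
(S 1 0
(S 3 0
(A 0 64 (0,0,0,128,0,0,158,158,1,256,51,64) (128,0,0,192,0,0,207,79,0,184,25,56))
(T 3 0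
(T 2 0
(A 0 79 (0,0,0,128,0,0,79,79,0,126,32,34) (180,64,52,192,0,0,207,79,0,232,129,104))
(B 0 69 (176,113,3,238,58,63,97,97,2,204,51,54) (208,19,80,248,12,56,176,48,6,177,11,49)))
(A 0 66 (126,32,34,128,0,0,158,158,0,253,61,67) (184,25,56,192,0,0,207,79,0,250,35,76))))
(B 0 72 (256,0,0,256,0,0,97,97,0,184,0,0) (242,22,49,256,0,0,176,48,3,171,21,43)))
(T 3 0
(T 2 0
(A 0 77 (0,0,0,128,0,0,79,79,0,126,16,34) (128,0,0,207,79,0,158,158,1,232,129,104))
(T 2 1
(A 0 75 (79,79,0,128,0,0,143,79,0,126,16,34) (128,0,0,207,79,0,158,158,1,232,129,104))
(A 0 70 (79,79,0,143,79,0,158,158,0,126,16,34) (128,0,0,207,79,0,158,158,1,188,135,60))))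
(B 0 68 (204,25,54,238,29,63,97,97,2,171,21,43) (236,32,71,176,48,3,97,97,2,171,21,43))))
(B 0 64 (256,0,0,256,0,0,97,97,0,184,0,0) (256,0,0,256,0,0,97,97,0,184,0,0))).

Definition cert1 : cert :=
T 1 0
(S 2 0
(S 1 0
(S 3 0
(A 0 56 (0,0,0,128,0,0,139,139,103,233,124,105) (0,0,0,79,79,0,125,17,38,86,12,26))
(T 3 0
(T 2 0
(A 0 72 (0,0,0,128,0,0,79,79,0,116,52,52) (76,55,55,79,79,0,116,64,52,153,111,111))
(T 2 1
(A 0 66 (79,79,0,128,0,0,143,79,0,116,52,52) (78,50,50,79,79,0,116,64,52,156,100,100))
(S 3 1
(A 0 58 (69,69,52,133,69,55,139,139,103,115,62,51) (58,57,57,79,79,0,94,67,30,107,106,67))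
(T 3 2
(S 3 2
(A 0 58 (65,65,53,128,64,57,131,131,107,126,94,83) (58,57,57,107,106,67,93,69,29,100,99,68))
(T 2 0
(A 0 65 (58,58,57,122,58,57,87,87,85,116,84,84) (68,55,55,125,102,63,117,96,85,136,111,111))
(S 3 0
(A 0 57 (96,96,82,127,63,57,128,128,109,124,92,84) (58,57,57,107,106,67,100,99,68,87,86,86))
(T 2 1
(A 0 63 (87,87,85,122,58,57,119,87,86,116,84,84) (103,79,79,127,98,58,119,91,87,138,106,106))
(S 3 1
(A 0 58 (96,96,82,127,95,85,128,128,109,124,92,82) (87,86,86,107,106,67,100,99,68,111,111,91))
(S 3 2
(A 0 59 (92,92,83,124,92,86,123,123,111,121,89,83) (87,86,86,111,111,91,100,99,68,108,107,92))
(S 3 0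
(T 3 2
(T 2 0
(A 0 61 (91,91,84,123,91,86,107,107,98,120,104,100) (95,84,84,121,108,89,117,105,101,110,99,99))
(B 0 60 (90,90,84,112,80,77,75,75,69,102,86,82) (115,114,114,115,114,94,109,109,93,107,107,107)))
(A 0 61 (91,91,84,123,91,86,120,104,100,120,88,84) (100,81,81,128,104,85,124,101,101,116,95,95)))
(B 0 64 (101,101,99,109,77,77,71,71,71,125,93,92) (107,107,107,115,114,94,109,109,93,100,100,100)))))))))
(A 0 65 (58,58,56,122,58,57,116,84,84,116,52,52) (74,52,52,124,103,63,111,65,47,148,104,104))))))
(T 2 1
(A 0 61 (116,52,52,128,0,0,143,79,0,233,105,105) (85,27,27,79,79,0,123,39,39,170,54,54))
(S 3 1
(A 0 55 (115,62,51,133,69,55,139,139,103,229,125,101) (69,39,39,79,79,0,112,38,48,122,77,38))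
(S 3 2
(A 0 57 (116,58,52,128,64,57,131,131,107,232,117,104) (69,39,39,122,77,38,112,38,48,119,68,68))
(S 3 0
(T 2 0
(A 0 58 (116,57,52,127,63,57,124,92,84,233,115,105) (82,29,29,122,77,38,142,50,50,124,43,43))
(T 3 2
(A 0 56 (124,92,84,127,63,57,128,128,109,184,120,110) (63,49,49,116,91,52,109,85,77,94,74,74))
(A 0 56 (124,92,84,127,63,57,184,120,110,233,115,105) (79,32,32,122,77,38,137,54,54,119,47,47))))
(T 2 0
(A 0 64 (116,52,52,122,58,57,116,84,84,233,105,105) (124,43,43,122,77,38,142,50,50,165,58,58))
(T 3 2
(T 2 1
(T 3 1
(A 0 63 (116,84,84,122,58,57,119,87,86,148,84,84) (106,73,73,129,91,52,122,84,84,142,98,98))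
(B 0 62 (125,93,92,133,69,69,109,77,77,120,56,56) (147,82,82,161,96,56,152,84,84,128,72,72)))
(T 2 0
(B 0 62 (125,93,92,109,77,77,98,82,82,120,56,56) (143,85,85,161,96,56,147,88,88,125,74,74))
(T 3 2
(T 2 1
(B 0 60 (98,82,82,109,77,77,90,74,74,96,64,63) (132,98,98,149,110,71,136,101,101,116,85,85))
(B 0 60 (98,82,82,90,74,74,72,72,70,96,64,63) (120,106,106,134,120,81,123,110,91,104,93,93)))
(B 0 60 (98,82,82,109,77,77,96,64,63,120,56,56) (138,89,89,155,100,61,142,91,91,121,77,77)))))
(S 3 1
(A 0 57 (124,92,82,127,63,56,185,121,108,231,115,103) (119,47,47,122,77,38,137,54,54,148,64,44))
(T 3 0
(A 0 60 (116,84,84,122,58,57,174,110,110,175,95,94) (113,61,61,144,79,59,130,70,70,150,82,82))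
(T 3 1
(A 0 60 (175,95,94,122,58,57,174,110,110,177,81,81) (113,61,61,144,79,59,130,70,70,150,82,82))
(B 0 60 (147,67,66,158,62,61,120,56,56,169,40,40) (157,63,63,152,66,47,162,64,64,137,55,55)))))))))))))
(T 3 0
(T 2 0
(A 0 72 (0,0,0,128,0,0,79,79,0,100,58,36) (79,79,0,158,158,1,116,64,52,153,111,111))
(T 2 1
(A 0 67 (79,79,0,128,0,0,143,79,0,100,58,36) (79,79,0,158,158,1,116,64,52,156,100,100))
(T 3 2
(T 2 0
(S 2 1
(B 0 64 (158,158,51,176,112,2,137,137,0,158,126,2) (176,157,12,97,97,10,158,126,12,117,96,96))
(T 1 0
(A 0 65 (79,79,0,111,79,0,118,118,1,147,115,0) (79,79,1,147,115,1,104,69,40,131,121,121))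
(B 0 64 (176,144,2,176,112,2,137,137,0,158,126,2) (176,157,12,158,126,12,159,131,95,117,96,96))))
(T 2 1
(B 0 64 (137,137,0,176,112,2,137,105,0,158,126,2) (176,152,12,97,97,10,162,124,98,120,91,91))
(T 3 2
(S 2 1
(S 3 1
(A 0 62 (118,118,3,150,118,3,158,158,1,152,136,3) (79,79,3,158,158,7,147,115,3,156,155,76))
(T 2 0
(B 0 63 (137,137,0,137,105,0,117,117,1,128,112,0) (172,154,75,130,130,0,158,126,24,109,98,98))
(S 3 0
(A 0 57 (138,138,2,150,118,3,158,158,1,152,136,3) (79,79,3,156,155,76,147,115,3,107,106,67))
(S 3 2
(A 0 58 (138,138,2,150,118,3,158,158,1,152,136,3) (107,106,67,156,155,76,147,115,3,128,127,72))
(T 2 1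
(B 0 62 (117,117,1,137,105,0,117,101,1,128,112,0) (142,123,83,130,130,0,136,118,78,110,95,95))
(S 3 1
(A 0 61 (138,138,1,154,138,1,158,158,0,152,136,2) (107,106,67,156,155,76,128,127,72,136,135,96))
(S 3 0
(A 0 58 (114,114,88,130,114,89,130,130,101,128,112,88) (107,106,67,136,135,96,128,127,72,111,111,91))
(S 3 2
(A 0 59 (112,112,89,128,112,90,128,128,102,126,110,89) (111,111,91,136,135,96,128,127,72,122,121,94))
(B 0 62 (88,88,79,92,76,68,73,73,66,100,84,76) (115,114,94,115,114,75,112,111,84,100,100,100))))))))))
(T 2 0
(S 3 0
(A 0 58 (118,118,3,150,118,3,138,138,2,152,136,3) (79,79,3,147,115,3,98,70,34,116,104,65))
(B 0 62 (137,137,0,137,105,0,117,117,1,128,112,0) (140,126,87,158,126,24,148,132,84,109,98,98)))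
(S 3 0
(A 0 55 (138,138,2,150,118,3,158,158,1,152,136,3) (79,79,3,147,115,3,92,71,28,107,106,67))
(S 3 1
(A 0 57 (138,138,2,150,118,3,158,158,1,152,136,3) (107,106,67,147,115,3,92,71,28,128,127,72))
(S 3 2
(A 0 56 (116,116,87,129,97,82,132,132,100,128,112,94) (107,106,67,128,127,72,92,71,28,100,99,68))
(S 3 0
(A 0 58 (114,114,88,128,96,82,130,130,101,126,110,95) (107,106,67,128,127,72,100,99,68,111,111,91))
(B 0 62 (88,88,79,109,77,76,73,73,65,98,82,81) (115,114,94,124,123,68,118,118,86,100,100,100))))))))
(B 0 64 (137,137,0,137,105,0,128,112,0,158,126,2) (171,155,76,97,97,10,156,128,92,115,94,94)))))
(A 0 65 (79,79,0,143,79,0,147,115,0,100,58,36) (79,79,0,158,158,1,111,65,47,148,104,104)))))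
(T 2 1
(T 3 1
(A 0 66 (100,58,36,128,0,0,143,79,0,164,58,36) (79,79,0,158,158,1,128,25,54,177,33,74))
(T 3 0
(A 0 66 (100,58,36,164,58,36,143,79,0,149,88,53) (79,79,0,158,158,1,122,45,57,161,84,84))
(A 0 59 (149,88,53,164,58,36,143,79,0,199,117,71) (79,79,0,158,158,0,123,39,39,170,54,54))))
(T 2 0
(T 3 0
(A 0 65 (100,58,36,143,79,0,147,115,0,149,88,53) (79,79,0,158,158,1,112,61,48,149,100,100))
(B 0 64 (148,86,52,176,112,2,158,126,2,156,45,28) (163,128,49,97,97,2,194,68,68,143,50,50)))
(T 3 2
(T 2 1
(B 0 62 (158,126,2,176,112,2,137,105,0,140,76,2) (168,138,59,97,97,5,175,97,97,128,72,72))
(T 2 0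
(B 0 63 (158,126,2,137,105,0,128,112,0,140,76,2) (168,138,59,97,97,5,169,101,101,125,74,74))
(S 2 1
(S 3 1
(A 0 58 (152,136,3,150,118,3,158,158,1,206,142,49) (79,79,0,158,158,1,147,115,0,164,137,58))
(T 3 2
(S 3 0
(A 0 56 (152,136,3,150,118,3,158,158,1,186,154,3) (79,79,1,162,145,66,147,115,1,111,99,60))
(S 3 2
(A 0 57 (152,136,3,150,118,3,158,158,1,186,154,3) (111,99,60,162,145,66,147,115,1,133,119,77))
(T 2 1
(B 0 62 (128,112,0,137,105,0,117,101,1,119,87,0) (149,110,71,126,126,46,142,106,66,116,85,85))
(S 3 1
(A 0 60 (152,136,2,154,138,1,158,158,0,186,154,2) (111,99,60,162,145,66,133,119,77,141,126,87))
(S 3 0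
(A 0 58 (128,112,88,130,114,89,130,130,101,159,127,100) (111,99,60,141,126,87,133,119,77,116,103,83))
(S 3 2
(A 0 58 (126,110,89,128,112,90,128,128,102,157,125,101) (116,103,83,141,126,87,133,119,77,127,113,93))
(B 0 62 (100,84,76,92,76,68,73,73,66,97,65,59) (119,107,87,120,106,67,116,104,84,104,93,93))))))))
(B 0 61 (128,112,0,137,105,0,119,87,0,140,76,2) (168,138,59,123,123,43,158,126,6,121,77,77))))
(S 3 0
(A 0 55 (152,136,3,150,118,3,158,158,1,215,151,0) (79,79,0,147,115,0,94,67,30,116,91,52))
(T 3 2
(S 3 1
(A 0 57 (152,136,3,150,118,3,158,158,1,186,154,3) (111,99,60,147,115,1,93,69,29,133,119,77))
(S 3 2
(A 0 56 (128,112,94,129,97,82,132,132,100,159,127,107) (111,99,60,133,119,77,93,69,29,104,93,72))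
(S 3 0
(A 0 58 (126,110,95,128,96,82,130,130,101,157,125,108) (111,99,60,133,119,77,104,93,72,116,103,83))
(B 0 62 (98,82,81,109,77,76,73,73,65,96,64,63) (119,107,87,129,115,73,123,110,91,104,93,93)))))
(B 0 61 (128,112,0,137,105,0,119,87,0,140,76,2) (155,100,61,158,126,6,163,105,99,121,77,77)))))))
(B 0 63 (158,126,2,176,112,2,140,76,2,156,45,28) (163,128,49,97,97,2,186,74,74,137,55,55)))))))
(T 3 0
(T 2 0
(A 0 77 (0,0,0,128,0,0,79,79,0,112,38,48) (116,64,52,158,158,1,232,129,104,153,111,111))
(T 2 1
(A 0 70 (79,79,0,128,0,0,143,79,0,112,38,48) (116,64,52,158,158,1,232,129,104,156,100,100))
(T 3 2
(T 2 0
(S 1 0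
(T 1 0
(A 0 65 (79,79,0,111,79,0,118,118,1,145,112,5) (104,69,40,147,115,1,208,138,80,131,121,121))
(B 0 63 (161,129,43,176,112,2,137,137,0,151,119,21) (159,131,95,158,126,12,159,53,31,117,96,96)))
(S 3 1
(A 0 72 (79,79,0,143,79,0,118,118,2,145,112,7) (147,115,1,158,158,3,208,138,80,172,155,12))
(S 3 2
(A 0 69 (79,79,0,143,79,0,118,118,2,145,112,6) (147,115,1,172,155,12,208,138,80,166,136,102))
(B 0 64 (162,162,40,176,112,2,137,137,0,158,126,2) (158,126,12,130,130,0,125,103,61,117,96,96)))))
(T 2 1
(B 0 64 (137,137,0,176,112,2,137,105,0,151,119,21) (162,124,98,97,97,10,159,53,31,120,91,91))
(T 3 2
(S 1 0
(S 2 0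
(T 2 0
(B 0 63 (137,137,0,137,105,0,117,117,1,128,112,0) (148,132,84,158,126,24,145,104,49,109,98,98))
(S 3 1
(A 0 58 (138,138,2,150,118,3,158,158,1,152,136,3) (92,71,28,147,115,3,138,106,42,128,127,72))
(S 3 0
(A 0 57 (121,121,67,132,100,73,138,138,77,133,117,74) (92,71,28,128,127,72,138,106,42,100,99,68))
(S 3 2
(A 0 58 (118,118,69,129,97,75,135,135,79,130,114,76) (100,99,68,128,127,72,138,106,42,121,120,73))
(B 0 63 (90,90,74,109,77,76,75,75,62,98,82,81) (118,118,86,124,123,68,112,112,64,100,100,100))))))
(T 2 0
(B 0 64 (137,137,0,137,105,0,117,117,1,128,112,0) (145,104,49,158,126,24,154,55,26,109,98,98))
(S 3 2
(A 0 64 (138,138,1,150,118,2,158,158,0,152,136,2) (138,106,42,147,115,3,184,142,56,142,141,78))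
(S 3 1
(A 0 63 (138,138,1,150,118,2,158,158,0,152,136,2) (138,106,42,147,115,3,142,141,78,128,127,72))
(S 3 0
(A 0 61 (138,138,1,150,118,2,158,158,0,152,136,2) (138,106,42,128,127,72,142,141,78,121,120,73))
(B 0 63 (94,94,63,110,78,74,78,78,52,103,87,69) (112,112,64,124,123,68,107,106,43,100,100,100)))))))
(S 3 1
(A 0 67 (118,118,2,150,118,2,158,158,0,152,136,2) (147,115,3,158,158,7,184,142,56,156,155,76))
(T 2 0
(B 0 64 (137,137,0,137,105,0,117,117,1,128,112,0) (158,126,24,130,130,0,154,55,26,109,98,98))
(S 3 2
(A 0 64 (138,138,1,150,118,2,158,158,0,152,136,2) (147,115,3,156,155,76,184,142,56,142,141,78))
(S 3 0
(A 0 63 (138,138,1,150,118,2,158,158,0,152,136,2) (147,115,3,156,155,76,142,141,78,128,127,72))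
(T 2 1
(B 0 62 (117,117,1,137,105,0,117,101,1,128,112,0) (136,118,78,130,130,0,118,101,54,110,95,95))
(S 3 1
(A 0 64 (138,138,1,154,138,1,158,158,0,152,136,2) (128,127,72,156,155,76,142,141,78,136,135,96))
(S 3 2
(B 0 63 (117,117,1,117,101,1,97,97,2,128,112,0) (124,123,68,115,114,75,107,106,43,104,103,72))
(B 0 62 (90,90,75,92,76,68,75,75,62,100,84,76) (124,123,68,115,114,75,104,103,72,100,100,100))))))))))
(B 0 64 (137,137,0,137,105,0,128,112,0,151,119,21) (156,128,92,97,97,10,157,53,29,115,94,94)))))
(A 0 68 (79,79,0,143,79,0,145,112,5,112,38,48) (111,65,47,158,158,1,222,130,94,148,104,104)))))
(T 2 1
(S 1 0
(A 0 65 (120,42,42,128,0,0,143,79,0,240,84,84) (123,39,39,147,111,0,247,79,79,170,54,54))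
(B 0 69 (162,93,93,215,66,87,176,112,2,169,24,40) (158,114,3,97,97,2,171,42,43,148,46,46)))
(T 2 0
(T 3 0
(A 0 66 (112,38,48,143,79,0,145,112,5,168,58,72) (112,61,48,158,158,1,225,123,97,149,100,100))
(B 0 65 (167,56,71,176,112,2,151,119,21,169,24,40) (194,68,68,97,97,2,166,45,38,143,50,50)))
(T 3 2
(T 2 1
(B 0 62 (151,119,21,176,112,2,137,105,0,140,76,2) (175,97,97,97,97,5,160,51,32,128,72,72))
(T 2 0
(B 0 63 (151,119,21,137,105,0,128,112,0,140,76,2) (169,101,101,97,97,5,158,51,30,125,74,74))
(S 1 0
(T 3 2
(S 2 0
(S 3 1
(A 0 58 (152,136,3,150,118,3,158,158,1,186,154,3) (93,69,29,147,115,1,139,104,43,133,119,77))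
(S 3 0
(A 0 56 (133,117,74,132,100,73,138,138,77,163,131,91) (93,69,29,133,119,77,139,104,43,104,93,72))
(S 3 2
(A 0 59 (130,114,76,129,97,75,135,135,79,159,127,93) (104,93,72,133,119,77,139,104,43,126,112,78))
(B 0 62 (98,82,81,109,77,76,75,75,62,96,64,63) (123,110,91,129,115,73,117,105,69,104,93,93)))))
(S 3 2
(A 0 61 (152,136,2,150,118,2,158,158,0,186,154,2) (139,104,43,147,115,1,186,139,58,148,132,84))
(S 3 1
(A 0 61 (152,136,2,150,118,2,158,158,0,186,154,2) (139,104,43,147,115,1,148,132,84,133,119,77))
(S 3 0
(A 0 59 (152,136,2,150,118,2,158,158,0,186,154,2) (139,104,43,133,119,77,148,132,84,126,112,78))
(B 0 61 (103,87,69,110,78,74,78,78,52,96,64,63) (117,105,69,129,115,73,111,99,47,104,93,93))))))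
(B 0 62 (128,112,0,137,105,0,119,87,0,140,76,2) (163,105,99,158,126,6,156,52,28,121,77,77)))
(S 3 1
(A 0 64 (152,136,2,150,118,2,158,158,0,201,137,50) (147,115,0,158,158,1,188,135,60,164,137,58))
(T 3 2
(S 3 2
(A 0 61 (152,136,2,150,118,2,158,158,0,186,154,2) (147,115,1,162,145,66,186,139,58,148,132,84))
(S 3 0
(A 0 61 (152,136,2,150,118,2,158,158,0,186,154,2) (147,115,1,162,145,66,148,132,84,133,119,77))
(T 2 1
(B 0 63 (128,112,0,137,105,0,117,101,1,119,87,0) (142,106,66,126,126,46,123,92,59,116,85,85))
(S 3 1
(A 0 61 (152,136,2,154,138,1,158,158,0,186,154,2) (133,119,77,162,145,66,148,132,84,141,126,87))
(S 3 2
(B 0 60 (128,112,0,117,101,1,97,97,2,119,87,0) (129,115,73,120,106,67,111,99,47,108,96,76))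
(B 0 62 (100,84,76,92,76,68,75,75,62,97,65,59) (129,115,73,120,106,67,108,96,76,104,93,93)))))))
(B 0 63 (128,112,0,137,105,0,119,87,0,140,76,2) (158,126,6,123,123,43,156,52,28,121,77,77)))))))
(B 0 65 (151,119,21,176,112,2,140,76,2,169,24,40) (186,74,74,97,97,2,163,46,35,137,55,55)))))))
(T 2 1
(T 1 0
(S 2 0
(A 0 58 (128,0,0,192,0,0,207,79,0,233,63,105) (0,0,0,158,158,0,126,32,34,174,43,46))
(B 0 64 (215,66,87,239,27,46,176,48,2,169,24,40) (204,51,54,97,97,2,171,42,43,151,36,40)))
(B 0 59 (239,27,46,256,0,0,176,48,2,169,24,40) (256,0,0,97,97,0,184,0,0,162,0,0)))
(T 2 0
(S 2 0
(T 3 0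
(A 0 63 (128,0,0,207,79,0,143,79,0,180,32,52) (0,0,0,158,158,1,125,34,34,172,48,48))
(S 1 0
(S 3 0
(A 0 51 (180,62,52,196,68,58,132,68,58,233,124,105) (0,0,0,79,79,0,125,34,34,86,24,24))
(A 0 59 (180,52,52,207,79,0,143,79,0,233,105,105) (86,24,24,79,79,0,125,34,34,172,48,48)))
(B 0 63 (173,75,45,176,48,2,176,112,2,156,45,28) (176,113,3,97,97,2,202,56,56,149,41,41))))
(B 0 65 (215,66,87,176,48,2,176,112,2,169,24,40) (202,56,56,97,97,2,171,42,43,149,41,41)))
(T 3 2
(S 2 0
(S 1 0
(S 3 0
(A 0 52 (132,68,58,196,68,58,139,139,103,194,130,110) (0,0,0,79,79,0,110,42,46,72,35,35))
(S 3 1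
(A 0 53 (133,69,55,197,69,55,139,139,103,195,131,106) (72,35,35,79,79,0,110,42,46,132,66,9))
(T 2 1
(T 1 0
(S 3 2
(A 0 55 (128,64,57,160,64,57,161,97,85,187,123,109) (75,40,40,133,77,2,109,58,45,129,69,69))
(S 3 0
(A 0 55 (127,63,57,159,63,57,159,95,86,184,120,110) (75,40,40,133,77,2,129,69,69,112,60,60))
(S 3 1
(A 0 57 (127,63,56,159,63,56,159,95,85,185,121,108) (112,60,60,133,77,2,129,69,69,144,77,57))
(T 3 0
(T 2 0
(A 0 63 (122,58,57,154,58,57,136,72,72,148,84,84) (117,60,60,150,77,57,135,69,69,156,80,80))
(B 0 60 (132,68,68,155,59,59,117,53,53,133,69,69) (149,79,79,149,79,59,153,81,81,130,69,69)))
(B 0 60 (133,69,69,155,59,59,117,53,53,120,56,56) (149,79,79,149,79,59,153,81,81,130,69,69))))))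
(B 0 57 (155,59,59,164,36,35,117,53,53,120,56,56) (179,64,64,169,72,4,188,67,67,139,49,49)))
(T 2 0
(S 3 2
(A 0 55 (128,64,57,161,97,85,129,97,85,187,123,109) (75,40,40,133,77,2,109,58,45,129,69,69))
(S 3 0
(A 0 55 (127,63,57,159,95,86,127,95,86,184,120,110) (75,40,40,133,77,2,129,69,69,112,60,60))
(S 3 1
(A 0 57 (127,63,56,159,95,85,127,95,85,185,121,108) (112,60,60,133,77,2,129,69,69,144,77,57))
(T 3 0
(T 1 0
(A 0 63 (122,58,57,136,72,72,119,87,86,148,84,84) (107,72,72,137,93,73,123,83,83,142,97,97))
(B 0 60 (132,68,68,117,53,53,109,77,77,133,69,69) (149,79,79,149,79,59,153,81,81,130,69,69)))
(B 0 60 (133,69,69,117,53,53,109,77,77,120,56,56) (149,79,79,149,79,59,153,81,81,130,69,69))))))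
(S 3 2
(A 0 57 (129,97,85,161,97,85,131,131,107,187,123,109) (64,48,48,118,88,49,94,67,30,111,82,79))
(S 3 0
(A 0 56 (127,95,86,159,95,86,128,128,109,184,120,110) (64,48,48,118,88,49,111,82,79,96,72,72))
(S 3 1
(A 0 56 (127,95,85,159,95,85,128,128,109,185,121,108) (96,72,72,118,88,49,111,82,79,123,92,72))
(T 3 2
(T 2 1
(B 0 60 (109,77,77,117,53,53,94,62,62,96,64,63) (139,86,86,139,86,66,142,89,89,121,75,75))
(T 2 0
(B 0 60 (109,77,77,94,62,62,90,74,74,96,64,63) (133,97,97,133,97,77,137,99,99,116,85,85))
(B 0 59 (90,74,74,94,62,62,72,72,70,96,64,63) (120,105,105,120,105,85,124,108,92,105,92,92))))
(B 0 60 (109,77,77,117,53,53,96,64,63,120,56,56) (140,85,85,139,86,66,144,88,88,122,75,75))))))))))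
(T 2 1
(B 0 62 (176,112,2,176,48,2,137,73,0,140,76,2) (176,113,6,97,97,5,188,67,67,139,49,49))
(T 2 0
(B 0 62 (176,112,2,137,73,0,137,105,0,140,76,2) (176,130,6,97,97,5,176,94,94,130,69,69))
(S 2 1
(S 3 1
(A 0 58 (150,118,3,182,118,3,158,158,1,206,142,49) (79,79,0,158,158,1,147,115,0,172,129,6))
(S 3 0
(A 0 56 (150,118,3,182,118,3,158,158,1,215,151,0) (79,79,0,172,129,6,147,115,0,118,88,49))
(S 3 2
(A 0 58 (150,118,3,182,118,3,158,158,1,215,151,0) (118,88,49,172,129,6,147,115,0,141,106,66))
(S 3 1
(A 0 60 (150,118,2,182,118,2,158,158,0,215,151,0) (118,88,49,172,129,6,141,106,66,150,112,73))
(S 3 0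
(A 0 58 (129,97,77,161,97,77,130,130,101,188,124,97) (118,88,49,150,112,73,141,106,66,123,92,72))
(S 3 2
(A 0 59 (128,96,77,160,96,77,128,128,102,186,122,98) (123,92,72,150,112,73,141,106,66,134,101,81))
(B 0 61 (111,79,71,119,55,49,73,73,66,121,57,52) (126,95,75,126,95,56,123,93,73,110,83,83))))))))
(S 3 0
(A 0 55 (150,118,3,182,118,3,158,158,1,215,151,0) (79,79,0,147,115,0,94,67,30,118,88,49))
(S 3 1
(A 0 58 (150,118,3,182,118,3,158,158,1,215,151,0) (118,88,49,147,115,0,94,67,30,141,106,66))
(S 3 2
(A 0 57 (129,97,82,161,97,82,132,132,100,188,124,104) (118,88,49,141,106,66,94,67,30,111,82,79))
(S 3 0
(A 0 58 (128,96,82,160,96,82,130,130,101,186,122,105) (118,88,49,141,106,66,111,82,79,123,92,72))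
(B 0 61 (109,77,76,117,53,53,73,73,65,120,56,55) (126,95,75,137,102,62,131,97,97,110,83,83))))))))))
(T 2 1
(B 0 64 (176,112,2,176,48,2,137,73,0,140,76,2) (188,67,67,97,97,5,160,51,32,139,49,49))
(T 2 0
(B 0 62 (176,112,2,137,73,0,137,105,0,140,76,2) (176,94,94,97,97,5,160,51,32,130,69,69))
(S 1 0
(T 3 2
(S 2 0
(T 2 1
(S 3 1
(A 0 58 (150,118,3,182,118,3,170,138,2,186,154,3) (101,63,37,147,115,1,152,95,56,154,96,57))
(B 1 61 (110,72,78,117,53,53,94,62,62,95,63,63) (164,100,102,120,104,74,151,55,94,121,75,75)))
(S 3 1
(A 0 58 (150,118,3,170,138,2,158,158,1,186,154,3) (93,69,29,147,115,1,139,104,43,134,117,78))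
(S 3 0
(A 0 56 (132,100,73,149,117,83,138,138,77,163,131,91) (93,69,29,134,117,78,139,104,43,105,91,73))
(S 3 2
(A 0 58 (129,97,75,146,114,84,135,135,79,159,127,93) (105,91,73,134,117,78,139,104,43,127,111,79))
(B 0 62 (109,77,76,94,62,62,75,75,62,96,64,63) (124,108,92,129,114,74,118,103,70,105,92,92))))))
(S 3 2
(B 0 61 (137,105,0,137,73,0,97,97,2,119,87,0) (138,103,42,158,125,12,150,54,22,118,88,54))
(T 2 1
(S 3 1
(A 0 62 (150,118,2,182,118,2,170,138,1,186,154,2) (152,95,56,147,115,1,171,107,107,154,96,57))
(B 1 63 (110,72,78,117,53,53,94,62,62,95,63,63) (151,55,94,120,104,74,129,65,81,121,75,75)))
(S 3 1
(A 0 61 (150,118,2,170,138,1,158,158,0,186,154,2) (139,104,43,147,115,1,149,130,85,134,117,78))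
(S 3 0
(A 0 59 (150,118,2,170,138,1,158,158,0,186,154,2) (139,104,43,134,117,78,149,130,85,127,111,79))
(B 0 61 (110,78,74,94,62,62,78,78,52,96,64,63) (118,103,70,129,114,74,112,98,48,105,92,92)))))))
(S 2 0
(S 3 1
(A 0 59 (150,118,3,182,118,3,186,154,3,215,151,0) (102,63,38,147,115,0,153,94,57,155,96,56))
(B 1 61 (110,72,78,117,53,53,95,63,63,119,56,55) (166,101,101,121,105,74,152,56,93,122,75,75)))
(B 0 63 (137,105,0,137,73,0,119,87,0,140,76,2) (152,93,56,157,125,13,156,52,28,122,75,75))))
(S 3 1
(A 0 64 (150,118,2,182,118,2,158,158,0,201,137,50) (147,115,0,158,158,1,188,135,60,172,129,6))
(S 3 2
(B 0 61 (137,105,0,137,73,0,97,97,2,140,76,2) (158,125,6,130,116,0,151,52,23,118,88,54))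
(S 3 0
(B 0 61 (137,105,0,137,73,0,97,97,2,140,76,2) (158,125,6,130,116,0,118,88,54,137,102,62))
(S 3 1
(B 0 61 (137,105,0,137,73,0,97,97,2,140,76,2) (137,102,62,130,116,0,118,88,54,126,95,56))
(S 3 2
(B 0 61 (137,105,0,137,73,0,97,97,2,140,76,2) (137,102,62,126,95,56,118,88,54,115,85,83))
(B 0 61 (111,79,71,119,55,49,75,75,62,121,57,52) (137,102,62,126,95,56,115,85,83,110,83,83)))))))))))
(S 2 0
(S 1 0
(S 3 0
(A 0 51 (132,68,58,196,68,58,194,130,110,233,124,105) (0,0,0,79,79,0,118,40,40,81,28,28))
(S 3 1
(A 0 53 (133,69,55,197,69,55,195,131,106,229,125,101) (81,28,28,79,79,0,118,40,40,133,65,1))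
(S 3 2
(A 0 54 (128,64,57,192,64,57,187,123,109,232,117,104) (81,28,28,133,65,1,118,40,40,140,48,48))
(S 3 0
(A 0 56 (127,63,57,191,63,57,184,120,110,233,115,105) (81,28,28,133,65,1,140,48,48,121,42,42))
(S 3 1
(A 0 56 (127,63,56,191,63,56,185,121,108,231,115,103) (121,42,42,133,65,1,140,48,48,155,54,19))
(T 3 0
(T 1 0
(A 0 60 (122,58,57,154,58,57,174,110,110,177,81,81) (113,61,61,144,79,59,130,70,70,150,82,82))
(B 0 60 (155,59,59,164,36,35,120,56,56,158,62,61) (160,56,56,160,56,36,165,57,57,140,48,48)))
(B 0 60 (158,62,61,164,36,35,120,56,56,169,40,40) (160,56,56,154,61,41,165,57,57,140,48,48))))))))
(B 0 62 (176,112,2,176,48,2,140,76,2,156,45,28) (176,113,3,97,97,2,190,66,66,140,48,48)))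
(B 0 65 (176,112,2,176,48,2,140,76,2,169,24,40) (190,66,66,97,97,2,171,28,43,140,48,48)))))).

Definition cert2 : cert :=
S 2 0
(T 2 0
(T 1 0
(S 1 0
(A 0 64 (0,0,0,79,79,0,116,52,52,138,133,133) (0,0,0,79,79,0,116,52,52,138,133,133))
(T 3 0
(A 0 76 (0,0,0,79,79,0,100,58,36,58,57,57) (69,69,52,139,139,103,116,62,52,147,130,130))
(T 3 1
(A 0 71 (58,57,57,79,79,0,100,58,36,107,106,67) (69,69,52,139,139,103,115,62,51,143,131,131))
(S 2 1
(S 3 1
(T 3 2
(A 0 72 (58,57,57,107,106,67,95,66,31,100,99,68) (65,65,53,131,131,107,126,94,83,143,143,117))
(T 3 0
(A 0 71 (58,57,57,107,106,67,100,99,68,87,86,86) (64,64,54,128,128,109,124,92,84,140,140,119))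
(S 1 0
(A 0 63 (95,92,92,117,113,74,109,106,77,126,123,123) (58,58,57,87,87,85,116,84,84,127,127,124))
(S 2 1
(S 3 1
(S 1 0
(S 3 0
(S 2 0
(A 0 66 (91,91,91,112,112,72,105,104,73,122,121,121) (87,87,85,102,102,99,101,93,93,104,104,102))
(B 0 67 (122,117,117,138,131,92,126,120,94,107,102,102) (99,91,91,86,86,84,98,82,82,92,92,90)))
(B 0 69 (120,118,118,135,133,93,123,122,91,105,103,103) (92,92,90,86,86,84,98,82,82,83,83,82)))
(B 0 68 (115,114,114,129,129,89,118,118,86,100,100,100) (86,86,84,72,72,70,98,82,82,83,83,82)))
(A 0 67 (91,89,89,111,110,71,104,103,72,121,119,119) (87,87,85,121,121,119,116,100,100,127,127,124)))
(A 0 66 (98,85,85,120,105,65,112,98,80,130,114,114) (87,87,85,116,100,100,116,84,84,127,127,124))))))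
(A 0 66 (63,61,61,115,114,50,108,55,44,126,123,123) (58,58,56,128,128,122,116,84,84,138,133,133)))
(A 0 63 (72,57,57,115,114,50,116,52,52,144,114,114) (58,58,56,116,84,84,116,52,52,138,133,133))))))
(S 1 0
(S 3 0
(A 0 54 (69,69,52,139,139,103,116,62,52,147,130,130) (0,0,0,79,79,0,100,58,36,58,57,57))
(S 3 1
(A 0 58 (69,69,52,139,139,103,115,62,51,143,131,131) (58,57,57,79,79,0,100,58,36,107,106,67))
(T 2 1
(S 3 2
(A 0 57 (65,65,53,131,131,107,126,94,83,143,131,131) (58,57,57,107,106,67,100,58,36,100,99,68))
(T 3 1
(S 3 0
(A 0 58 (64,64,54,128,128,109,124,92,84,140,140,119) (58,57,57,107,106,67,100,99,68,87,86,86))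
(T 1 0
(A 0 65 (58,58,57,87,87,85,116,84,84,127,127,124) (95,92,92,117,113,74,109,106,77,126,123,123))
(S 3 1
(A 0 58 (96,96,82,128,128,109,124,92,82,140,140,119) (87,86,86,107,106,67,100,99,68,111,111,91))
(S 3 2
(A 0 59 (92,92,83,123,123,111,121,89,83,135,135,121) (87,86,86,111,111,91,100,99,68,108,107,92))
(S 3 0
(T 2 1
(T 3 1
(T 1 0
(A 0 61 (91,91,84,107,107,98,120,104,100,128,128,117) (91,89,89,116,115,95,113,111,97,106,104,104))
(B 0 60 (90,90,84,75,75,69,102,86,82,87,87,81) (115,114,114,115,114,94,109,109,93,107,107,107)))
(A 0 61 (91,91,84,128,128,117,120,104,100,133,133,123) (91,89,89,116,115,95,113,111,97,106,104,104)))
(A 0 60 (91,91,84,120,104,100,120,88,84,133,133,123) (98,85,85,125,110,90,121,106,105,114,100,100)))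
(B 0 64 (101,101,99,71,71,71,125,93,92,95,95,94) (107,107,107,115,114,94,109,109,93,100,100,100)))))))
(A 0 63 (58,58,57,127,127,124,116,84,84,138,135,135) (63,61,61,115,114,50,112,100,80,126,123,123))))
(A 0 65 (58,58,56,116,84,84,116,52,52,138,133,133) (72,57,57,115,114,50,116,52,52,144,114,114)))))
(T 2 1
(S 2 1
(T 3 1
(S 3 1
(A 0 64 (79,79,0,158,158,1,147,115,0,156,155,76) (79,79,0,158,158,1,147,115,0,156,155,76))
(S 3 0
(A 0 60 (79,79,0,158,158,1,147,115,0,167,167,32) (79,79,0,156,155,76,147,115,0,107,106,67))
(S 3 2
(A 0 61 (79,79,0,158,158,1,147,115,0,167,167,26) (107,106,67,156,155,76,147,115,0,128,127,72))
(T 1 0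
(A 0 65 (79,79,0,118,118,1,147,115,0,169,168,10) (117,113,74,167,167,32,140,135,84,126,123,123))
(S 3 1
(A 0 62 (118,118,2,158,158,0,147,115,0,169,168,14) (107,106,67,156,155,76,128,127,72,136,135,96))
(S 3 0
(A 0 60 (97,97,76,130,130,101,126,94,74,142,142,111) (107,106,67,136,135,96,128,127,72,111,111,91))
(S 3 2
(A 0 61 (96,96,76,128,128,102,125,93,75,140,140,111) (111,111,91,136,135,96,128,127,72,122,121,94))
(B 0 63 (103,103,93,73,73,66,127,95,86,97,97,88) (115,114,94,115,114,75,112,111,84,100,100,100)))))))))
(S 3 1
(T 3 0
(A 0 68 (79,79,0,156,155,76,147,115,0,107,106,67) (79,79,0,158,158,1,147,115,0,167,167,32))
(T 3 2
(A 0 67 (107,106,67,156,155,76,147,115,0,128,127,72) (79,79,0,158,158,1,147,115,0,167,167,26))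
(S 1 0
(A 0 63 (117,113,74,167,167,32,140,135,84,126,123,123) (79,79,0,118,118,1,147,115,0,169,168,10))
(T 3 1
(A 0 66 (107,106,67,156,155,76,128,127,72,136,135,96) (118,118,2,158,158,0,147,115,0,169,168,14))
(T 3 0
(A 0 69 (107,106,67,136,135,96,128,127,72,111,111,91) (97,97,76,130,130,101,126,94,74,142,142,111))
(T 3 2
(A 0 67 (111,111,91,136,135,96,128,127,72,122,121,94) (96,96,76,128,128,102,125,93,75,140,140,111))
(B 0 65 (115,114,94,115,114,75,112,111,84,100,100,100) (103,103,93,73,73,66,127,95,86,97,97,88))))))))
(A 0 64 (79,79,0,167,167,16,147,115,0,126,123,123) (79,79,0,167,167,16,147,115,0,126,123,123))))
(T 3 1
(T 1 0
(A 0 64 (79,79,0,118,118,1,147,115,0,167,167,16) (79,79,0,147,115,0,104,64,40,126,123,123))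
(S 3 0
(A 0 56 (118,118,3,158,158,1,147,115,0,167,167,32) (79,79,0,147,115,0,95,66,31,107,106,67))
(S 3 1
(A 0 58 (118,118,3,158,158,1,147,115,0,167,167,26) (107,106,67,147,115,0,95,66,31,128,127,72))
(S 3 2
(A 0 57 (99,99,75,132,132,100,127,95,79,145,145,109) (107,106,67,128,127,72,95,66,31,100,99,68))
(S 3 0
(A 0 59 (97,97,76,130,130,101,125,93,80,142,142,111) (107,106,67,128,127,72,100,99,68,111,111,91))
(B 0 62 (103,103,92,73,73,65,125,93,92,98,98,87) (115,114,94,124,123,68,118,118,86,100,100,100)))))))
(A 0 64 (79,79,0,167,167,16,147,115,0,144,114,114) (79,79,0,147,115,0,108,55,44,126,123,123))))
(T 3 0
(A 0 65 (79,79,0,147,115,0,100,58,36,107,106,67) (79,79,0,158,158,1,112,63,48,144,114,114))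
(T 3 1
(A 0 65 (107,106,67,147,115,0,100,58,36,130,124,74) (79,79,0,158,158,1,112,61,48,144,114,114))
(T 3 2
(A 0 67 (107,106,67,130,124,74,100,58,36,100,99,68) (66,66,50,132,132,100,114,59,50,140,126,126))
(S 2 1
(S 3 1
(S 1 0
(A 0 63 (117,113,74,140,135,84,109,106,77,126,123,123) (79,79,0,118,118,1,147,115,0,172,172,2))
(T 3 0
(A 0 70 (107,106,67,128,127,72,100,99,68,111,111,91) (97,97,76,130,130,101,125,93,80,142,142,111))
(B 0 66 (115,114,94,124,123,68,118,118,86,100,100,100) (103,103,92,73,73,65,125,93,92,98,98,87))))
(A 0 63 (115,114,50,144,127,63,112,100,80,126,123,123) (79,79,0,172,172,2,147,115,0,140,126,126)))
(A 0 63 (115,114,50,148,132,52,125,95,93,144,114,114) (79,79,0,147,115,0,116,52,52,140,126,126)))))))))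
(S 1 0
(S 3 0
(A 0 52 (116,62,52,139,139,103,233,124,105,147,130,130) (0,0,0,79,79,0,112,38,48,69,39,39))
(S 3 1
(A 0 55 (115,62,51,139,139,103,229,125,101,143,131,131) (69,39,39,79,79,0,112,38,48,118,80,41))
(S 3 2
(A 0 57 (116,58,52,131,131,107,232,117,104,143,131,131) (69,39,39,118,80,41,112,38,48,119,68,68))
(S 3 0
(T 1 0
(A 0 58 (116,57,52,124,92,84,233,115,105,142,133,133) (82,29,29,118,80,41,142,50,50,124,43,43))
(T 3 1
(T 2 1
(A 0 56 (124,92,84,128,128,109,184,120,110,140,140,119) (63,49,49,116,91,52,109,85,77,94,74,74))
(A 0 56 (124,92,84,184,120,110,233,115,105,140,140,119) (77,33,33,122,77,38,133,57,57,116,50,50)))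
(A 0 57 (124,92,84,140,140,119,233,115,105,142,133,133) (77,33,33,118,80,41,133,57,57,116,50,50))))
(T 1 0
(A 0 64 (116,52,52,116,84,84,233,105,105,138,135,135) (124,43,43,118,80,41,142,50,50,165,58,58))
(T 3 1
(T 2 1
(T 1 0
(B 0 62 (125,93,92,98,82,82,120,56,56,95,95,94) (143,85,85,158,98,59,147,88,88,125,74,74))
(B 0 60 (98,82,82,72,72,70,120,56,56,95,95,94) (125,98,98,140,111,71,128,101,96,109,85,85)))
(T 3 2
(T 2 0
(A 0 60 (116,84,84,174,110,110,175,95,94,180,116,115) (113,61,61,122,87,47,130,70,70,150,82,82))
(B 0 60 (147,67,66,120,56,56,169,40,40,132,68,68) (157,63,63,156,87,47,162,64,64,137,55,55)))
(A 0 60 (116,84,84,174,110,110,180,116,115,127,127,124) (109,64,64,122,87,47,125,74,74,145,86,86))))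
(T 3 2
(T 2 1
(A 0 61 (116,84,84,127,127,124,180,116,115,185,121,121) (104,74,74,113,100,61,119,85,85,138,99,99))
(A 0 61 (116,84,84,180,116,115,233,105,105,185,121,121) (123,44,44,120,79,39,142,50,50,165,58,58)))
(A 0 62 (116,84,84,127,127,124,185,121,121,138,135,135) (99,83,83,109,109,66,114,96,82,132,111,111)))))))))
(T 1 0
(T 2 0
(S 2 1
(S 3 1
(S 1 0
(A 0 63 (104,64,40,147,115,0,156,97,60,126,123,123) (79,79,0,118,118,1,147,115,0,158,158,40))
(T 3 1
(A 0 70 (95,66,31,147,115,0,142,99,46,128,127,72) (118,118,3,158,158,1,147,115,0,158,158,68))
(T 3 0
(A 0 70 (95,66,31,128,127,72,142,99,46,100,99,68) (104,104,57,138,138,77,129,97,71,151,151,84))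
(T 3 2
(A 0 68 (100,99,68,128,127,72,142,99,46,121,120,73) (101,101,59,135,135,79,126,94,73,148,148,86))
(B 0 66 (118,118,86,124,123,68,112,112,64,100,100,100) (105,105,87,75,75,62,125,93,92,99,99,82))))))
(A 0 63 (108,55,44,147,115,0,163,83,67,126,123,123) (79,79,0,158,158,40,147,115,0,149,100,100)))
(A 0 64 (116,52,52,147,115,0,174,79,78,144,114,114) (79,79,0,147,115,0,116,52,52,149,100,100)))
(T 3 2
(B 0 64 (148,86,52,158,126,2,156,45,28,118,89,54) (160,131,51,97,97,2,194,68,68,143,50,50))
(B 0 64 (148,86,52,158,126,2,118,89,54,100,100,100) (161,161,43,97,97,2,176,114,112,129,86,86))))
(T 3 1
(T 2 1
(T 1 0
(B 0 62 (158,126,2,128,112,0,140,76,2,129,129,2) (165,140,61,97,97,4,169,101,101,125,74,74))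
(S 2 1
(S 3 1
(A 0 58 (152,136,3,158,158,1,206,142,49,156,155,76) (79,79,0,158,158,1,147,115,0,162,138,59))
(S 3 0
(A 0 56 (152,136,3,158,158,1,215,151,0,167,167,32) (79,79,0,162,138,59,147,115,0,116,91,52))
(S 3 2
(A 0 58 (152,136,3,158,158,1,215,151,0,167,167,26) (116,91,52,162,138,59,147,115,0,139,109,70))
(S 3 1
(A 0 60 (152,136,2,158,158,0,215,151,0,169,168,14) (116,91,52,162,138,59,139,109,70,148,116,76))
(S 3 0
(A 0 58 (128,112,88,130,130,101,188,124,97,142,142,111) (116,91,52,148,116,76,139,109,70,121,95,75))
(S 3 2
(A 0 59 (126,110,89,128,128,102,186,122,98,140,140,111) (121,95,75,148,116,76,139,109,70,132,104,85))
(B 0 61 (100,84,76,73,73,66,121,57,52,97,97,88) (125,98,78,125,98,58,122,95,76,109,85,85))))))))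
(S 3 0
(A 0 55 (152,136,3,158,158,1,215,151,0,167,167,32) (79,79,0,147,115,0,95,66,31,116,91,52))
(S 3 1
(A 0 58 (152,136,3,158,158,1,215,151,0,167,167,26) (116,91,52,147,115,0,95,66,31,139,109,70))
(S 3 2
(A 0 57 (128,112,94,132,132,100,188,124,104,145,145,109) (116,91,52,139,109,70,95,66,31,109,85,77))
(S 3 0
(A 0 58 (126,110,95,130,130,101,186,122,105,142,142,111) (116,91,52,139,109,70,109,85,77,121,95,75))
(B 0 61 (98,82,81,73,73,65,120,56,55,98,98,87) (125,98,78,135,105,66,128,101,96,109,85,85))))))))
(B 0 63 (158,126,2,140,76,2,156,45,28,129,129,2) (163,128,49,97,97,2,181,78,78,134,57,57)))
(T 3 2
(B 0 63 (158,126,2,129,129,2,156,45,28,118,89,54) (160,131,51,97,97,2,181,78,78,134,57,57))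
(S 2 1
(S 3 1
(T 3 0
(A 0 64 (147,115,0,156,155,76,142,141,78,128,127,72) (79,79,0,158,158,0,147,115,0,160,160,39))
(T 3 1
(A 0 64 (128,127,72,156,155,76,142,141,78,136,135,96) (79,79,0,158,158,0,147,115,0,160,160,39))
(S 1 0
(A 0 63 (140,135,84,148,145,105,156,148,92,126,123,123) (79,79,0,118,118,1,147,115,0,160,160,35))
(T 3 2
(B 0 64 (124,123,68,115,114,75,111,100,47,104,103,72) (137,137,0,97,97,2,158,126,2,130,130,0))
(B 0 64 (124,123,68,115,114,75,104,103,72,100,100,100) (105,105,87,75,75,62,127,95,86,99,99,83))))))
(A 0 63 (147,115,0,167,167,16,166,128,102,126,123,123) (79,79,0,160,160,35,147,115,0,132,111,111)))
(A 0 61 (147,115,0,167,167,16,183,122,119,144,114,114) (79,79,0,147,115,0,108,55,44,132,111,111))))))))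
(T 2 0
(T 1 0
(T 3 0
(A 0 79 (0,0,0,79,79,0,112,38,48,69,39,39) (116,62,52,139,139,103,233,124,105,147,130,130))
(T 3 1
(A 0 74 (69,39,39,79,79,0,112,38,48,118,80,41) (115,62,51,139,139,103,229,125,101,143,131,131))
(T 3 2
(A 0 72 (69,39,39,118,80,41,112,38,48,119,68,68) (116,58,52,131,131,107,232,117,104,143,131,131))
(T 3 0
(S 1 0
(A 0 70 (82,29,29,118,80,41,142,50,50,124,43,43) (116,57,52,124,92,84,233,115,105,142,133,133))
(S 3 1
(S 2 1
(A 0 73 (63,49,49,116,91,52,109,85,77,94,74,74) (124,92,84,128,128,109,184,120,110,140,140,119))
(A 0 73 (77,33,33,122,77,38,133,57,57,116,50,50) (124,92,84,184,120,110,233,115,105,140,140,119)))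
(A 0 71 (77,33,33,118,80,41,133,57,57,116,50,50) (124,92,84,140,140,119,233,115,105,142,133,133))))
(S 1 0
(A 0 64 (124,43,43,118,80,41,142,50,50,165,58,58) (116,52,52,116,84,84,233,105,105,138,135,135))
(S 3 1
(S 2 1
(S 1 0
(B 0 66 (143,85,85,158,98,59,147,88,88,125,74,74) (125,93,92,98,82,82,120,56,56,95,95,94))
(B 0 68 (125,98,98,140,111,71,128,101,96,109,85,85) (98,82,82,72,72,70,120,56,56,95,95,94)))
(S 3 2
(S 2 0
(A 0 68 (113,61,61,122,87,47,130,70,70,150,82,82) (116,84,84,174,110,110,175,95,94,180,116,115))
(B 0 69 (157,63,63,156,87,47,162,64,64,137,55,55) (147,67,66,120,56,56,169,40,40,132,68,68)))
(A 0 68 (109,64,64,122,87,47,125,74,74,145,86,86) (116,84,84,174,110,110,180,116,115,127,127,124))))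
(S 3 2
(S 2 1
(A 0 67 (104,74,74,113,100,61,119,85,85,138,99,99) (116,84,84,127,127,124,180,116,115,185,121,121))
(A 0 67 (123,44,44,120,79,39,142,50,50,165,58,58) (116,84,84,180,116,115,233,105,105,185,121,121)))
(A 0 66 (99,83,83,109,109,66,114,96,82,132,111,111) (116,84,84,127,127,124,185,121,121,138,135,135)))))))))
(S 1 0
(S 2 0
(T 2 1
(T 3 1
(T 1 0
(A 0 65 (79,79,0,118,118,1,147,115,0,158,158,40) (104,64,40,147,115,0,156,97,60,126,123,123))
(S 3 1
(A 0 58 (118,118,3,158,158,1,147,115,0,158,158,68) (95,66,31,147,115,0,142,99,46,128,127,72))
(S 3 0
(A 0 58 (104,104,57,138,138,77,129,97,71,151,151,84) (95,66,31,128,127,72,142,99,46,100,99,68))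
(S 3 2
(A 0 60 (101,101,59,135,135,79,126,94,73,148,148,86) (100,99,68,128,127,72,142,99,46,121,120,73))
(B 0 62 (105,105,87,75,75,62,125,93,92,99,99,82) (118,118,86,124,123,68,112,112,64,100,100,100))))))
(A 0 65 (79,79,0,158,158,40,147,115,0,149,100,100) (108,55,44,147,115,0,163,83,67,126,123,123)))
(A 0 64 (79,79,0,147,115,0,116,52,52,149,100,100) (116,52,52,147,115,0,174,79,78,144,114,114)))
(S 3 2
(B 0 64 (160,131,51,97,97,2,194,68,68,143,50,50) (148,86,52,158,126,2,156,45,28,118,89,54))
(B 0 64 (161,161,43,97,97,2,176,114,112,129,86,86) (148,86,52,158,126,2,118,89,54,100,100,100))))
(S 3 1
(S 2 1
(S 1 0
(B 0 66 (165,140,61,97,97,4,169,101,101,125,74,74) (158,126,2,128,112,0,140,76,2,129,129,2))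
(T 2 1
(S 3 1
(T 3 1
(A 0 71 (79,79,0,158,158,1,147,115,0,164,137,58) (152,136,3,158,158,1,206,142,49,165,165,3))
(S 2 1
(T 3 0
(A 0 74 (79,79,1,162,145,66,147,115,1,111,99,60) (152,136,3,158,158,1,186,154,3,165,165,3))
(T 3 2
(A 0 71 (111,99,60,162,145,66,147,115,1,133,119,77) (152,136,3,158,158,1,186,154,3,165,165,2))
(S 1 0
(B 0 67 (146,112,73,126,126,43,140,107,68,113,87,87) (128,112,0,113,105,0,119,87,0,113,113,2))
(S 3 1
(T 3 1
(A 0 69 (111,99,60,162,145,66,133,119,77,141,126,87) (155,147,1,158,158,0,186,154,2,161,161,3))
(S 2 1
(B 0 68 (132,124,85,117,110,71,126,119,71,102,97,97) (113,105,0,97,97,2,108,92,1,105,105,2))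
(B 0 67 (141,116,76,125,103,63,135,111,71,109,90,90) (113,105,0,108,92,1,119,87,0,105,105,2))))
(B 0 67 (141,116,76,126,126,43,135,111,71,109,90,90) (113,105,0,105,105,2,119,87,0,113,113,2))))))
(B 0 67 (168,138,59,123,123,43,158,126,6,118,79,79) (128,112,0,119,87,0,140,76,2,113,113,2))))
(B 0 66 (165,140,61,97,97,4,158,126,4,118,79,79) (128,112,0,113,113,2,140,76,2,129,129,2)))
(S 3 1
(S 2 1
(T 3 0
(A 0 74 (79,79,1,147,115,1,93,69,29,111,99,60) (152,136,3,158,158,1,186,154,3,165,165,3))
(T 3 1
(A 0 72 (111,99,60,147,115,1,93,69,29,133,119,77) (152,136,3,158,158,1,186,154,3,165,165,2))
(T 3 2
(A 0 73 (111,99,60,133,119,77,93,69,29,104,93,72) (128,112,94,132,132,100,159,127,107,138,138,105))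
(T 3 0
(A 0 71 (111,99,60,133,119,77,104,93,72,116,103,83) (126,110,95,130,130,101,157,125,108,136,136,106))
(B 0 68 (119,107,87,129,115,73,123,110,91,104,93,93) (98,82,81,73,73,65,96,64,63,86,86,76))))))
(B 0 69 (168,138,59,158,126,6,160,108,96,118,79,79) (128,112,0,119,87,0,140,76,2,113,113,2)))
(B 0 68 (165,140,61,158,126,4,160,108,96,118,79,79) (128,112,0,113,113,2,140,76,2,130,130,0)))))
(B 0 65 (163,128,49,97,97,2,181,78,78,134,57,57) (158,126,2,140,76,2,156,45,28,129,129,2)))
(S 3 2
(B 0 65 (160,131,51,97,97,2,181,78,78,134,57,57) (158,126,2,129,129,2,156,45,28,118,89,54))
(S 3 0
(A 0 65 (79,79,0,158,158,0,107,58,43,132,111,111) (147,115,0,156,155,46,146,135,82,130,124,74))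
(T 2 1
(S 3 1
(A 0 64 (79,79,0,158,158,0,147,115,0,132,111,111) (130,124,74,156,155,46,146,135,82,136,135,96))
(T 3 1
(T 1 0
(A 0 65 (79,79,0,118,118,1,147,115,0,160,160,35) (140,135,84,148,145,105,156,148,92,126,123,123))
(S 3 2
(B 0 64 (137,137,0,97,97,2,158,126,2,130,130,0) (124,123,68,115,114,75,111,100,47,104,103,72))
(B 0 64 (105,105,87,75,75,62,127,95,86,99,99,83) (124,123,68,115,114,75,104,103,72,100,100,100))))
(A 0 65 (79,79,0,160,160,35,147,115,0,142,106,106) (144,127,63,146,146,93,166,128,102,126,123,123))))
(A 0 67 (79,79,0,147,115,0,108,55,44,132,111,111) (148,132,52,167,167,16,183,122,119,144,114,114))))))))
(S 1 0
(S 2 0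
(T 1 0
(B 0 64 (176,114,112,158,126,2,168,41,40,129,86,86) (194,68,68,151,119,21,178,62,62,143,50,50))
(S 3 1
(A 0 61 (147,115,0,158,158,1,225,122,97,149,100,100) (112,38,48,145,112,5,168,58,72,148,91,51))
(S 3 0
(A 0 60 (129,97,71,138,138,77,228,118,100,150,99,99) (112,38,48,148,91,51,168,58,72,119,68,68))
(S 3 2
(B 0 62 (136,104,79,83,83,49,167,44,39,130,86,86) (141,80,80,142,89,49,167,56,71,134,77,77))
(T 3 1
(T 2 1
(B 0 61 (125,93,92,75,75,62,120,56,55,99,99,82) (128,101,96,135,105,66,122,96,74,109,85,85))
(B 0 63 (125,93,92,120,56,55,168,41,40,99,99,82) (158,67,67,147,85,45,150,64,64,134,57,57)))
(B 0 63 (125,93,92,99,99,82,168,41,40,123,103,103) (158,67,67,142,89,49,150,64,64,134,57,57)))))))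
(S 3 2
(B 0 63 (194,68,68,97,97,2,170,36,42,143,50,50) (167,56,71,151,119,21,169,24,40,133,64,69))
(T 1 0
(B 0 65 (176,114,112,158,126,2,168,41,40,129,86,86) (178,62,62,151,119,21,153,53,53,143,50,50))
(S 3 1
(B 0 64 (158,126,2,97,97,2,167,43,39,129,86,86) (167,56,71,151,119,21,133,64,69,142,89,49))
(S 3 0
(B 0 61 (158,126,2,97,97,2,167,43,39,130,86,86) (167,56,71,142,89,49,133,64,69,134,77,77))
(T 3 1
(T 2 1
(B 0 61 (127,95,86,78,78,52,120,56,55,104,104,70) (122,96,74,135,105,66,116,91,52,109,85,85))
(B 0 64 (127,95,86,120,56,55,168,41,40,104,104,70) (150,64,64,147,85,45,143,61,61,134,57,57)))
(B 0 66 (127,95,86,104,104,70,168,41,40,129,88,88) (150,64,64,142,89,49,143,61,61,134,57,57))))))))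
(S 3 1
(S 2 1
(S 1 0
(B 0 66 (169,101,101,97,97,4,159,50,31,125,74,74) (151,119,21,128,112,0,140,76,2,117,117,35))
(T 1 0
(S 3 1
(S 2 1
(T 2 0
(T 3 1
(A 0 71 (93,69,29,147,115,1,140,103,44,133,119,77) (152,136,3,158,158,1,186,154,3,165,165,2))
(T 3 0
(A 0 73 (93,69,29,133,119,77,140,103,44,104,93,72) (133,117,74,138,138,77,163,131,91,145,145,80))
(T 3 2
(A 0 70 (104,93,72,133,119,77,140,103,44,126,112,78) (130,114,76,135,135,79,159,127,93,141,141,82))
(B 0 68 (123,110,91,129,115,73,117,105,69,104,93,93) (98,82,81,75,75,62,96,64,63,87,87,72)))))
(T 3 2
(A 0 67 (140,103,44,147,115,1,186,138,58,148,132,84) (152,136,2,158,158,0,186,154,2,159,159,20))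
(T 3 1
(A 0 67 (140,103,44,147,115,1,148,132,84,133,119,77) (152,136,2,158,158,0,186,154,2,165,165,1))
(T 3 0
(A 0 70 (140,103,44,133,119,77,148,132,84,126,112,78) (152,136,2,158,158,0,186,154,2,165,165,1))
(B 0 68 (117,105,69,129,115,73,111,99,47,104,93,93) (103,87,69,78,78,52,96,64,63,91,91,61))))))
(B 0 66 (160,108,96,158,126,6,155,52,27,118,79,79) (128,112,0,119,87,0,140,76,2,113,113,2)))
(B 0 66 (160,108,96,158,126,4,156,50,28,118,79,79) (128,112,0,113,113,2,140,76,2,117,117,35)))
(S 3 1
(T 3 1
(A 0 64 (147,115,0,158,158,1,188,135,60,164,137,58) (152,136,2,158,158,0,201,137,50,159,159,23))
(S 2 1
(T 3 2
(A 0 67 (147,115,1,162,145,66,186,138,58,148,132,84) (152,136,2,158,158,0,186,154,2,159,159,20))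
(T 3 0
(A 0 67 (147,115,1,162,145,66,148,132,84,133,119,77) (152,136,2,158,158,0,186,154,2,165,165,1))
(S 1 0
(B 0 67 (140,107,68,126,126,43,121,93,57,113,87,87) (128,112,0,113,105,0,119,87,0,113,113,2))
(S 3 1
(T 3 1
(A 0 67 (133,119,77,162,145,66,148,132,84,141,126,87) (155,147,1,158,158,0,186,154,2,161,161,2))
(S 2 1
(B 0 68 (126,119,71,117,110,71,109,103,45,102,97,97) (113,105,0,97,97,2,108,92,1,105,105,2))
(B 0 67 (135,111,71,125,103,63,116,96,52,109,90,90) (113,105,0,108,92,1,119,87,0,105,105,2))))
(B 0 67 (135,111,71,126,126,43,116,96,52,109,90,90) (113,105,0,105,105,2,119,87,0,113,113,2))))))
(B 0 66 (158,126,6,123,123,43,155,52,27,118,79,79) (128,112,0,119,87,0,140,76,2,113,113,2))))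
(B 0 66 (158,126,4,97,97,4,156,50,28,118,79,79) (128,112,0,113,113,2,140,76,2,117,117,35)))))
(B 0 63 (181,78,78,97,97,2,161,46,33,134,57,57) (151,119,21,140,76,2,169,24,40,117,117,35)))
(S 3 2
(B 0 63 (181,78,78,97,97,2,170,28,42,134,57,57) (151,119,21,117,117,35,169,24,40,133,64,69))
(T 1 0
(B 0 65 (160,120,96,158,126,2,162,43,34,115,96,96) (151,119,21,117,117,35,153,53,53,143,50,50))
(S 3 0
(B 0 64 (158,126,2,97,97,2,161,45,33,115,96,96) (151,119,21,117,117,35,133,64,69,142,89,49))
(S 3 1
(B 0 64 (158,126,2,97,97,2,161,45,33,115,96,96) (142,89,49,117,117,35,133,64,69,130,84,44))
(T 3 1
(T 2 1
(S 3 2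
(B 0 61 (158,126,2,97,97,2,140,76,2,130,130,0) (135,105,66,125,98,58,116,91,52,113,88,81))
(B 0 61 (127,95,86,75,75,62,121,57,52,99,99,83) (135,105,66,125,98,58,113,88,81,109,85,85)))
(B 0 64 (158,126,2,140,76,2,165,42,37,130,130,0) (147,85,45,134,81,41,143,61,61,134,57,57)))
(B 0 65 (158,126,2,130,130,0,165,42,37,123,91,91) (142,89,49,130,84,44,143,61,61,134,57,57)))))))))).

Definition cO : zvec := (0, 0, 0).
Definition cE : zvec := (4194304, 0, 0).
Definition cP : zvec := (2592768, 2592768, 0).
Definition cQ : zvec := (3276800, 1179648, 1179648).
Definition cH : zvec := (1536000, 1536000, 1536000).

Lemma ok0 : zcheck cert0 (cO,cE,cP,cQ) (cO,cE,cP,cQ). 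
Proof. by vm_compute. Qed.

Lemma ok1 : zcheck cert1 (cO,cP,cQ,cH) (cO,cE,cP,cQ). 
Proof. by vm_compute. Qed.

Lemma ok2 : zcheck cert2 (cO,cP,cQ,cH) (cO,cP,cQ,cH). 
Proof. by vm_compute. Qed.

End Certificates.

Section Cover.
Variable R : realType.
Local Notation zr := (@zr R).
Local Notation um := (@um R).

Lemma zr_ratio (x a b : BinNums.Z) :
  BinInt.Z.mul b x = BinInt.Z.mul a unit_m -> BinInt.Z.ltb BinNums.Z0 b ->
  zr x / um = zr a / zr b.
Proof.
move=> E b0; have b1 : 0 < zr b by have /(@zr_lt R) := b0; rewrite zr0.
have u0 := um_gt0 R; apply/eqP; rewrite eqr_div; last 2 first.
- by rewrite gt_eqF.
- by rewrite gt_eqF.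
by rewrite /um -!zrM -E BinInt.Z.mul_comm.
Qed.

Lemma hull4 (v0 v1 v2 v3 : zvec) (a b c d : R) :
  0 <= a -> 0 <= b -> 0 <= c -> 0 <= d -> a + b + c + d = 1 ->
  hull (v0, v1, v2, v3)
   (a * (zr v0.1.1 / um) + b * (zr v1.1.1 / um) + c * (zr v2.1.1 / um) + d * (zr v3.1.1 / um),
    a * (zr v0.1.2 / um) + b * (zr v1.1.2 / um) + c * (zr v2.1.2 / um) + d * (zr v3.1.2 / um),
    a * (zr v0.2 / um) + b * (zr v1.2 / um) + c * (zr v2.2 / um) + d * (zr v3.2 / um)).
Proof.
move=> a0 b0 c0 d0 s1; exists (fun e : 'I_4 => nth 0 [:: a; b; c; d] e).
  split; last by rewrite !big_ord_recl big_ord0 /= addr0 !addrA.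
  by case=> [[|[|[|[|e]]]]].
by rewrite /mean !big_ord_recl !big_ord0 /= !addr0 !addrA.
Qed.

Import ZArith.

Lemma root_points : [/\ zr (fst (fst cE)) / um = 1, zr 2592768%Z / um = 633 / 1024,
  zr 3276800%Z / um = 25 / 32, zr 1179648%Z / um = 9 / 32 &
  zr 1536000%Z / um = 375 / 1024].
Proof.
split.
- by rewrite divff // gt_eqF ?um_gt0.
- by rewrite (@zr_ratio _ 633%Z 1024%Z) // !zrE.
- by rewrite (@zr_ratio _ 25%Z 32%Z) // !zrE.
- by rewrite (@zr_ratio _ 9%Z 32%Z) // !zrE.
- by rewrite (@zr_ratio _ 375%Z 1024%Z) // !zrE.
Qed.

(** The two tetrahedra share the face of [0], [P] and [Q], and the two outer faces
    are those of [wide_face] and [round_face]. *)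
Lemma region_cover (x y z : R) : 0 <= z -> z <= y -> y <= x -> x * (1 + y) <= 1 ->
  (1 + x) * (y + z) <= 1 ->
  hull (cO, cE, cP, cQ) (x, y, z) \/ hull (cO, cP, cQ, cH) (x, y, z).
Proof.
move=> z0 zy yx C1 C2; have [rE rP rQ rS rH] := root_points.
have [h|h] := leP (y + 16 / 9 * z) x.
  left; have F := wide_face z0 zy yx C1 C2.
  pose d := z * (32 / 9); pose c := (y - z) * (1024 / 633).
  pose b := x - (y - z) - 25 / 9 * z.
  have := @hull4 cO cE cP cQ (1 - b - c - d) b c d.
  rewrite /= rE rP rQ rS zr0 !mul0r !mulr0 !mulr1 !add0r.
  have -> : b + c * (633 / 1024) + d * (25 / 32) = x by rewrite /b /c /d; field.
  have -> : c * (633 / 1024) + d * (9 / 32) = y by rewrite /c /d; field.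
  have -> : d * (9 / 32) = z by rewrite /d; field.
  apply; last (by lra).
  - by rewrite /b /c /d; clear -F; lra.
  - by rewrite /b; clear -h; lra.
  - by rewrite mulr_ge0 ?subr_ge0 ?divr_ge0 ?ler0n.
  - by rewrite mulr_ge0 ?divr_ge0 ?ler0n.
right; have F := round_face z0 zy yx C1 C2 (ltW h).
pose d := (z - 9 / 16 * (x - y)) * (1024 / 375); pose c := 2 * (x - y).
pose b := (y - z) * (1024 / 633).
have := @hull4 cO cP cQ cH (1 - b - c - d) b c d.
rewrite /= rP rQ rS rH zr0 !mul0r !mulr0 !add0r.
have -> : b * (633 / 1024) + c * (25 / 32) + d * (375 / 1024) = x.
  by rewrite /b /c /d; field.
have -> : b * (633 / 1024) + c * (9 / 32) + d * (375 / 1024) = y.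
  by rewrite /b /c /d; field.
have -> : c * (9 / 32) + d * (375 / 1024) = z by rewrite /c /d; field.
apply; last (by lra).
- by rewrite /b /c /d; clear -F; lra.
- by rewrite mulr_ge0 ?subr_ge0 ?divr_ge0 ?ler0n.
- by rewrite mulr_ge0 ?subr_ge0 ?divr_ge0 ?ler0n.
- by rewrite mulr_ge0 ?divr_ge0 ?ler0n ?subr_ge0; clear -h; lra.
Qed.

Definition sorted_region (m : R * R * R) : Prop :=
  let '(x, y, z) := m in
  [/\ 0 <= z, z <= y, y <= x, x * (1 + y) <= 1 & (1 + x) * (y + z) <= 1].

(** [ok1] covers both pairs of distinct tetrahedra, whence the disjunction. *)
Lemma sorted_close m m' : sorted_region m -> sorted_region m' ->
  close_pair m m' \/ close_pair m' m.
Proof.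
case: m m' => [[x y] z] [[x' y'] z'] [? ? ? ? ?] [? ? ? ? ?].
have [h|h] : hull (cO, cE, cP, cQ) (x, y, z) \/ hull (cO, cP, cQ, cH) (x, y, z).
  exact: region_cover.
all: have [h'|h'] : hull (cO, cE, cP, cQ) (x', y', z') \/ hull (cO, cP, cQ, cH) (x', y', z')
  by exact: region_cover.
- by left; apply: zcheck_sound ok0 h h'.
- by right; apply: zcheck_sound ok1 h' h.
- by left; apply: zcheck_sound ok1 h h'.
- by left; apply: zcheck_sound ok2 h h'.
Qed.

End Cover.

(** * Inscribing planar bodies in each other *)

Section Extremal.
Variable R : realType.
Local Notation E := 'cV[R]_2.
Local Notation I := 'I_(2 + 1).
Variables (K : set E) (v w : I -> E) (m : I -> R).
Hypothesis ext : extremal_simplex K v w m.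
Let t i j := bary v (w i) 0 j.

Lemma low_point_sum i j k : uniq [:: i; j; k] -> t i j + t i k = 1 + m i.
Proof.
have [vU Kv _ wP mP] := ext => u.
have : \sum_l t i l = 1 by exact: bary_sum.
have [_ ti] := wP i; rewrite (sum_distinct _ u) /t ti => h.
by rewrite /t; move: h; clear; lra.
Qed.

Let m0 : forall i, 0 <= m i.
Proof. exact: (@extremal_depth_ge0 R 2 K v w m). Qed.
Let Kw i : K (w i). Proof. by have [_ _ _ wP _] := ext; have [] := wP i. Qed.
Let t_le1 i j : t i j <= 1. Proof. exact: extremal_le1 ext (Kw i). Qed.

Lemma low_point_coord i j : i != j -> m i <= t i j <= 1.
Proof.
move=> ij; rewrite t_le1 andbT.
have [k u] : exists k, uniq [:: i; j; k].
  have [h01 h02 h12] := I_neq; move: i j ij.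
  have h10 : i1 != i0 by rewrite eq_sym.
  have h20 : i2 != i0 by rewrite eq_sym.
  have h21 : i2 != i1 by rewrite eq_sym.
  elim/I_cases; elim/I_cases => /eqP // _; [exists i2|exists i1|exists i2|exists i0|exists i1|exists i0];
    by rewrite /= !inE !negb_or ?h01 ?h02 ?h12 ?h10 ?h20 ?h21.
have := low_point_sum u; have := t_le1 i k; lra.
Qed.

(** The triangles [w_0 v_1 w_1] and [w_0 w_1 w_2] have at most the maximal area.
    The free coordinates of the points [w_i] are eliminated by their bounds. *)
Lemma extremal_region : m i2 <= m i1 -> m i1 <= m i0 ->
  sorted_region (m i0, m i1, m i2).
Proof.
have [h01 h02 h12] := I_neq => z12 z01.
have h10 : i1 != i0 by rewrite eq_sym.
have h20 : i2 != i0 by rewrite eq_sym.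
have h21 : i2 != i1 by rewrite eq_sym.
have [vU Kv _ wP mP] := ext.
have wm i : t i i = - m i by have [] := wP i.
have s0 : t i0 i1 + t i0 i2 = 1 + m i0.
  by apply: low_point_sum; rewrite /= !inE negb_or h01 h02 h12.
have s1 : t i1 i2 + t i1 i0 = 1 + m i1.
  by apply: low_point_sum; rewrite /= !inE negb_or h12 h10 h20.
have s2 : t i2 i0 + t i2 i1 = 1 + m i2.
  by apply: low_point_sum; rewrite /= !inE negb_or h20 h21 h01.
have [a0 a1] := (low_point_coord h01, low_point_coord h02).
have [b0 b1] := (low_point_coord h12, low_point_coord h10).
have [c0 c1] := (low_point_coord h20, low_point_coord h21).
have x1 : m i0 <= 1 by case/andP: a0 => l; exact: le_trans.
have vert i j : bary v (v i) 0 j = (i == j)%:R by exact: bary_vertex.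
split=> //.
  pose q i := if i == i1 then v i1 else if i == i0 then w i0 else w i1.
  have Kq i : K (q i) by rewrite /q; case: ifP => // _; case: ifP.
  have := extremal_det ext Kq; rewrite det_I.
  have B i j : (\matrix_i bary v (q i)) i j = bary v (q i) 0 j by rewrite mxE.
  have q0 : q i0 = w i0 by rewrite /q (negbTE h01) eqxx.
  have q1 : q i1 = v i1 by rewrite /q eqxx.
  have q2 : q i2 = w i1 by rewrite /q (negbTE h21) (negbTE h20).
  rewrite !B q0 q1 q2 !vert eqxx (negbTE h10) (negbTE h12) -!/(t _ _) !wm => d.
  have {}d : m i0 * t i1 i2 + t i0 i2 * t i1 i0 <= 1.
    by move: d; rewrite ler_norml => /andP[+ _]; rewrite ?mulr1n ?mulr0n ?mul0r ?mul1r; lra.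
  have : m i0 * t i1 i0 <= t i0 i2 * t i1 i0.
    by apply: ler_wpM2r; [exact: le_trans (m0 i1) (andP b1).1|case/andP: a1].
  have -> : m i0 * (1 + m i1) = m i0 * t i1 i2 + m i0 * t i1 i0 by rewrite -s1; ring.
  by lra.
have := extremal_det ext Kw; rewrite det_I.
have B i j : (\matrix_i bary v (w i)) i j = t i j by rewrite mxE.
rewrite !B !wm => /ler_normlW.
have := corner_product_le (m0 i2) z12 z01 x1 a0 b1 c0.
have -> : t i0 i2 = 1 + m i0 - t i0 i1 by rewrite -s0; ring.
have -> : t i1 i2 = 1 + m i1 - t i1 i0 by rewrite -s1; ring.
have -> : t i2 i1 = 1 + m i2 - t i2 i0 by rewrite -s2; ring.
by move=> h1 h2; lra.
Qed.

(** At most one coordinate [g i] is negative.  In that case the point is a convex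
    combination of [w i] with weight [- g i / m i <= al i] and of the two other
    vertices; the conditions on the sums of two coordinates leave nonnegative weights
    for these, because the coordinates of [w i] are at most one. *)
Lemma extremal_fit (al D g : I -> R) : convex_set K -> (forall i, 0 <= al i) ->
  (forall i j k, uniq [:: i; j; k] -> al i + m k * al k <= D j) ->
  \sum_i g i = 1 -> (forall i, - (al i * m i) <= g i) ->
  (forall i j k, uniq [:: i; j; k] -> D j - al i * m i - al k * m k <= g i + g k) ->
  K (\sum_i g i *: v i).
Proof.
move=> cK al0 fitD g1 gz gD; have [vU Kv _ wP mP] := ext.
have [g0|] := pselect (forall i, 0 <= g i); first exact: convex_sum.
move=> /existsNP[i /negP]; rewrite -ltNge => gi.
have [j [k u]] : exists j k, uniq [:: i; j; k].
  have [h01 h02 h12] := I_neq; clear gi; move: i.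
  elim/I_cases; [exists i1, i2|exists i0, i2|exists i0, i1];
    by rewrite /= !inE ?negb_or ?[i1 == i0]eq_sym ?[i2 == i0]eq_sym ?[i2 == i1]eq_sym
       ?h01 ?h02 ?h12.
have [[ij ik] jk] : [/\ i != j & i != k] /\ j != k.
  by move: u; rewrite /= !inE negb_or => /andP[/andP[-> ->] /andP[-> _]].
have u' : uniq [:: i; k; j] by rewrite /= !inE negb_or ij ik eq_sym jk.
have S f : \sum_l f l = f i + f j + f k :> R by exact: sum_distinct.
have mi : 0 < m i.
  rewrite lt_neqAle m0 andbT eq_sym; apply/eqP => mi0.
  by have := gz i; rewrite mi0 mulr0 oppr0 leNgt gi.
have mi1 : m i <= 1 by have /andP[h /(le_trans h)] := low_point_coord ij.
pose s := - g i / m i.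
have s0 : 0 <= s by rewrite divr_ge0 // oppr_ge0 ltW.
have sm : s * m i = - g i by rewrite divfK // gt_eqF.
have sal : s <= al i by rewrite ler_pdivrMr // lerNl.
have room l l' : uniq [:: i; l'; l] -> i != l -> 0 <= g l - s * t i l.
  move=> ul il; have := gD _ _ _ ul; have := fitD _ _ _ ul.
  have : (al i - s) * m i <= al i - s by rewrite ler_piMr // subr_ge0.
  have : s * t i l <= s by rewrite ler_piMr.
  by move: sm; clear; lra.
have tsum := low_point_sum u.
pose W l := if l == i then s else g l - s * t i l.
pose q l := if l == i then w i else v l.
have W1 : \sum_l W l = 1.
  rewrite S /W eqxx ![_ == i]eq_sym (negbTE ij) (negbTE ik) -g1 S.
  have -> : s + (g j - s * t i j) + (g k - s * t i k) = s + g j + g k - s * (t i j + t i k).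
    by ring.
  by rewrite tsum mulrDr sm; ring.
have -> : \sum_l g l *: v l = \sum_l W l *: q l.
  rewrite (sum_distinct _ u) [RHS](sum_distinct _ u) /W /q eqxx.
  rewrite ![_ == i]eq_sym (negbTE ij) (negbTE ik) -[in RHS](bary_point vU (w i)).
  rewrite (sum_distinct _ u) (wP i).2 -/(t i j) -/(t i k) !scalerDr !scalerA mulrN sm opprK.
  move: (t i j) (t i k) => a b.
  by apply/matrixP => x y; rewrite !mxE; ring.
apply: convex_sum => // l; last by rewrite /q; case: ifP => // _; have [] := wP i.
rewrite /W; case: eqVneq => // li.
have [->|lj] := eqVneq l j; first exact: room u' ij.
have [->|lk] := eqVneq l k; first exact: room u ik.
have := distinct_cover u l.
by rewrite !inE (negbTE li) (negbTE lj) (negbTE lk).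
Qed.

End Extremal.

Section PlanarBound.
Variable R : realType.
Local Notation E := 'cV[R]_2.
Local Notation I := 'I_(2 + 1).
Implicit Types (K L : set E) (v w : I -> E) (m : I -> R).

Definition of_triple T (x : T * T * T) (i : I) : T :=
  if i == i0 then x.1.1 else if i == i1 then x.1.2 else x.2.

Definition to_triple T (f : I -> T) : T * T * T := (f i0, f i1, f i2).

Lemma of_tripleE T (x : T * T * T) : [/\ of_triple x i0 = x.1.1, of_triple x i1 = x.1.2 & of_triple x i2 = x.2].
Proof.
have [h01 h02 h12] := I_neq.
rewrite eq_sym in h01; rewrite eq_sym in h02; rewrite eq_sym in h12.
by rewrite /of_triple !eqxx (negbTE h01) (negbTE h02) (negbTE h12).
Qed.

Lemma fits_distinct m (a d : R * R * R) : fits (to_triple m) a d ->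
  (forall i, 0 <= of_triple a i) /\
  forall i j k, uniq [:: i; j; k] -> of_triple a i + m k * of_triple a k <= of_triple d j.
Proof.
have [a0 a1 a2] := of_tripleE a; have [d0 d1 d2] := of_tripleE d.
case: a a0 a1 a2 => [[x y] z] /= a0 a1 a2; case: d d0 d1 d2 => [[d e] f] /= d0 d1 d2.
case=> -[x0 y0 z0] [h1 h2] [h3 h4] [h5 h6]; split.
  by elim/I_cases; rewrite ?a0 ?a1 ?a2.
elim/I_cases; elim/I_cases; elim/I_cases;
  rewrite /= ?inE ?eqxx ?orbT ?andbF //= => _; by rewrite ?a0 ?a1 ?a2 ?d0 ?d1 ?d2.
Qed.

Lemma perm_to (j0 j1 j2 : I) : uniq [:: j0; j1; j2] ->
  exists s : {perm I}, [/\ s i0 = j0, s i1 = j1 & s i2 = j2].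
Proof.
move=> u; have [t0 t1 t2] := of_tripleE (j0, j1, j2).
have inj : injective (of_triple (j0, j1, j2)).
  have [[/eqP n1 /eqP n2] /eqP n3] : [/\ j0 != j1 & j0 != j2] /\ j1 != j2.
    by move: u; rewrite /= !inE negb_or => /andP[/andP[-> ->] /andP[-> _]].
  elim/I_cases; elim/I_cases; rewrite ?t0 ?t1 ?t2 //= => h;
    by [case: n1|case: n2|case: n3].
by exists (perm inj); rewrite !permE.
Qed.

Lemma perm3_perm k m : exists s : {perm I}, perm3 k (to_triple m) = to_triple (m \o s).
Proof.
have [h01 h02 h12] := I_neq.
have P j0 j1 j2 : uniq [:: j0; j1; j2] ->
    exists s : {perm I}, (m j0, m j1, m j2) = to_triple (m \o s).
  by case/perm_to=> s [s0 s1 s2]; exists s; rewrite /to_triple /= s0 s1 s2.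
by case: k => [|[|[|[|[|k]]]]]; apply: P; rewrite /= !inE !negb_or
   ?[i1 == i0]eq_sym ?[i2 == i0]eq_sym ?[i2 == i1]eq_sym ?h01 ?h02 ?h12.
Qed.

Lemma sort_perm m : exists s : {perm I}, m (s i2) <= m (s i1) <= m (s i0).
Proof.
have [h01 h02 h12] := I_neq.
have P j0 j1 j2 : uniq [:: j0; j1; j2] -> m j2 <= m j1 -> m j1 <= m j0 ->
    exists s : {perm I}, m (s i2) <= m (s i1) <= m (s i0).
  by case/perm_to=> s [s0 s1 s2] a b; exists s; rewrite s0 s1 s2 a b.
have u (j0 j1 j2 : I) : j0 != j1 -> j0 != j2 -> j1 != j2 -> uniq [:: j0; j1; j2].
  by move=> a b c; rewrite /= !inE negb_or a b c.
have h10 : i1 != i0 by rewrite eq_sym.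
have h20 : i2 != i0 by rewrite eq_sym.
have h21 : i2 != i1 by rewrite eq_sym.
have [a|/ltW a] := leP (m i0) (m i1); have [b|/ltW b] := leP (m i1) (m i2);
  have [c|/ltW c] := leP (m i0) (m i2).
- exact: (P i2 i1 i0 (u _ _ _ h21 h20 h10) a b).
- exact: (P i2 i1 i0 (u _ _ _ h21 h20 h10) a b).
- exact: (P i1 i2 i0 (u _ _ _ h12 h10 h20) c b).
- exact: (P i1 i0 i2 (u _ _ _ h10 h12 h02) c a).
- exact: (P i2 i0 i1 (u _ _ _ h20 h21 h01) a c).
- exact: (P i0 i2 i1 (u _ _ _ h02 h01 h21) b c).
- exact: (P i0 i1 i2 (u _ _ _ h01 h02 h12) b a).
- exact: (P i0 i1 i2 (u _ _ _ h01 h02 h12) b a).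
Qed.

Definition turn (o : bool) : R := if o then -1 else 1.

(** The coordinates [g_j + m'_j] or [1 - g_j] of [L] are nonnegative, have a fixed
    total and satisfy the lower bounds [room] on sums of two; scaled by [r] and shifted
    by the parameters they fulfil [extremal_fit]. *)
Lemma inscribe K L v w m v' w' m' o a : convex_set K ->
  extremal_simplex K v w m -> extremal_simplex L v' w' m' ->
  fits (to_triple m) a (room o (to_triple m')) ->
  let r := (extent o (to_triple m') - dot3 (to_triple m) a)^-1 in
  let c j := r * ((if o then 1 else m' j) - of_triple a j * m j) in
  0 < r ->
  \sum_j c j = 1 - turn o * r /\
  forall y, L y -> K (\sum_j (turn o * r * bary v' y 0 j + c j) *: v j).
Proof.
move=> cK ext ext' ft r c r0; have [al0 al] := fits_distinct ft.
have [v'U _ _ _ mP] := ext'.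
have rF : r * (extent o (to_triple m') - dot3 (to_triple m) a) = 1.
  by rewrite mulVf //; move: r0; rewrite invr_gt0 => /gt_eqF->.
have c1 : \sum_j c j = 1 - turn o * r.
  have [a0 a1 a2] := of_tripleE a; rewrite sum_I /c a0 a1 a2 -[X in _ = X - _]rF.
  by case: (a) => [[x y] z]; rewrite /extent /dot3 /to_triple /turn; case: (o) => /=; ring.
split=> // y Ly; pose g j := turn o * r * bary v' y 0 j + c j.
have b1 := bary_sum v'U y.
have lo j := mP j y Ly; have hi j := extremal_le1 j ext' Ly.
apply: (@extremal_fit R K v w m ext (fun j => r * of_triple a j)
   (fun j => r * of_triple (room o (to_triple m')) j) g) => //.
- by move=> i; rewrite mulr_ge0 // ltW.
- by move=> i j k u; rewrite mulrCA -mulrDr ler_pM2l // al.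
- by rewrite big_split /= -mulr_sumr b1 c1 mulr1 addrC subrK.
- move=> i; rewrite /g /c.
  have -> : turn o * r * bary v' y 0 i + r * ((if o then 1 else m' i) - of_triple a i * m i) =
    r * (turn o * bary v' y 0 i + (if o then 1 else m' i)) - r * of_triple a i * m i by ring.
  rewrite lerDr mulr_ge0 ?(ltW r0) // /turn; case: (o).
    by have := hi i; lra.
  by have := lo i; lra.
move=> i j k u; rewrite /g /c.
have -> : turn o * r * bary v' y 0 i + r * ((if o then 1 else m' i) - of_triple a i * m i) +
   (turn o * r * bary v' y 0 k + r * ((if o then 1 else m' k) - of_triple a k * m k)) =
   r * (turn o * (bary v' y 0 i + bary v' y 0 k) + (if o then 2 else m' i + m' k))
     - r * of_triple a i * m i - r * of_triple a k * m k by case: (o) => /=; ring.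
rewrite !lerD2r ler_pM2l //.
have sk : bary v' y 0 i + bary v' y 0 k = 1 - bary v' y 0 j.
  by rewrite -b1 (sum_distinct _ u); ring.
have -> : of_triple (room o (to_triple m')) j = if o then 1 - m' j else m' i + m' k.
  have [d0 d1 d2] := of_tripleE (room o (to_triple m')).
  move: d0 d1 d2 u; clear; case: o => /= d0 d1 d2; move: i j k;
  elim/I_cases; elim/I_cases; elim/I_cases;
    rewrite /= ?inE ?eqxx ?orbT ?andbF //= => _; by rewrite ?d0 ?d1 ?d2 //= addrC.
rewrite sk /turn; case: (o); first by have := lo j; lra.
by have := hi j; lra.
Qed.

Lemma planar_pair K L v w m v' w' m' o a b : convex_set K -> convex_set L ->
  extremal_simplex K v w m -> extremal_simplex L v' w' m' ->
  let F := extent o (to_triple m') - dot3 (to_triple m) a in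
  let G := extent o (to_triple m) - dot3 (to_triple m') b in
  fits (to_triple m) a (room o (to_triple m')) -> fits (to_triple m') b (room o (to_triple m)) ->
  0 < F -> 0 < G -> F * G <= 262 / 100 ->
  (BM_distance K L <= (262 / 100)%:E)%E.
Proof.
move=> cK cL ext ext' F G fa fb F0 G0 FG.
have [vU _ _ _ _] := ext; have [v'U _ _ _ _] := ext'.
have [F1 G1] : 0 < F^-1 /\ 0 < G^-1 by rewrite !invr_gt0.
have [_ HL] := inscribe cK ext ext' fa F1.
have [cs HK] := inscribe cL ext' ext fb G1.
have ss : turn o * F^-1 * (turn o * G^-1) = (F * G)^-1.
  by rewrite invfM /turn; case: (o); ring.
have ss0 : 0 < turn o * F^-1 * (turn o * G^-1) by rewrite ss invr_gt0 mulr_gt0.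
have := frames_admissible vU v'U ss0 HL HK cs.
by move/BM_distance_le; apply; rewrite ss invrK.
Qed.

Lemma planar_bound K L : convex_body K -> convex_body L ->
  (BM_distance K L <= (262 / 100)%:E)%E.
Proof.
move=> [Kc cK Ki] [Lc cL Li].
have sorted_ext (M : set E) : compact M -> M° !=set0 -> exists v w m,
    extremal_simplex M v w m /\ sorted_region (to_triple m).
  move=> Mc Mi; have [v [w [m ext]]] := extremal_exists Mc Mi.
  have [s /andP[h1 h2]] := sort_perm m.
  have ext' := extremal_perm s ext.
  by exists (v \o s), (w \o s), (m \o s); split; last exact: extremal_region ext' _ _.
have [v [w [m [ext reg]]]] := sorted_ext _ Kc Ki.
have [v' [w' [m' [ext' reg']]]] := sorted_ext _ Lc Li.
have [[z [k [a [b]]]]|[z [k [a [b]]]]] := sorted_close reg reg'.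
  have [s ->] := perm3_perm k m'; case=> fa fb F0 G0 FG.
  exact: planar_pair cK cL ext (extremal_perm s ext') fa fb F0 G0 FG.
have [s ->] := perm3_perm k m; case=> fa fb F0 G0 FG; rewrite mulrC in FG.
exact: planar_pair cK cL (extremal_perm s ext) ext' fb fa G0 F0 FG.
Qed.

End PlanarBound.

(** * The bound in every dimension *)

Section Bound.
Variable R : realType.

(** For [3 <= n <= 8] these are values with two decimals enlarged by [1 / 200], the
    most that the claimed precision allows. *)
Definition BM_bound (n : nat) : R :=
  match n with
  | 1%N => 1
  | 2%N => 262 / 100
  | 3%N => 6 + 173 / 200
  | 4%N => 12 + 153 / 200
  | 5%N => 20 + 141 / 200
  | 6%N => 30 + 133 / 200
  | 7%N => 42 + 127 / 200
  | 8%N => 56 + 123 / 200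
  | _ => n%:R ^+ 2 - n%:R + 1 / 2 + n%:R^-1
  end.

Lemma distance_le_bound n (K L : set 'cV[R]_n) (b e g : R) : (0 < n)%N ->
  convex_body K -> convex_body L -> n%:R * (n%:R - e) = b -> 0 <= e < 1 ->
  1 - e ^+ 2 / 2 <= g * (1 - e) -> g ^+ 2 <= b -> (BM_distance K L <= b%:E)%E.
Proof.
move=> n0 Kb Lb bE /andP[e0 e1] gP gb.
have n1 : 1 <= n%:R :> R by rewrite ler1n.
have [||d|d] := @distance_dichotomy R n K L (n%:R - e) n0 _ _ Kb Lb.
- by lra.
- by lra.
- by rewrite -bE.
apply: (le_trans d); rewrite lee_fin subKr; apply: le_trans gb.
have E1 : 0 < 1 - e by rewrite subr_gt0.
have e2 : e ^+ 2 <= 1 by rewrite expr_le1 // ltW.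
have G0 : 0 <= 1 - e ^+ 2 / 2 by lra.
have Gg : (1 - e ^+ 2 / 2) / (1 - e) <= g by rewrite ler_pdivrMr.
by rewrite ler_sqr ?nnegrE // ?divr_ge0 // ?(ltW E1) // (le_trans _ Gg) // divr_ge0 // ltW.
Qed.

Lemma BM_bound_range n : (0 < n)%N ->
  n%:R ^+ 2 - n%:R + 1 / 2 < BM_bound n < n%:R ^+ 2 - n%:R + 1 / 2 + 11 / (10 * n%:R).
Proof.
case: n => [//|[|[|[|[|[|[|[|[|n]]]]]]]]] _; rewrite /BM_bound; try lra.
set m := n.+4.+4.+1; have m0 : 0 < m%:R :> R by rewrite ltr0n.
have -> : 11 / (10 * m%:R) = m%:R^-1 + m%:R^-1 / 10 :> R.
  by field; rewrite gt_eqF.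
have : 0 < m%:R^-1 :> R by rewrite invr_gt0.
by lra.
Qed.

Lemma BM_bound_distance n (K L : set 'cV[R]_n) : (0 < n)%N ->
  convex_body K -> convex_body L -> (BM_distance K L <= (BM_bound n)%:E)%E.
Proof.
case: n K L => [//|[|[|[|[|[|[|[|[|n]]]]]]]]] K L _ Kb Lb.
- by apply: (@distance_le_bound 1 K L _ 0 1) => //; rewrite /BM_bound; lra.
- exact: planar_bound.
- by apply: (@distance_le_bound 3 K L _ (427 / 600) (26 / 10)) => //; rewrite /BM_bound; lra.
- by apply: (@distance_le_bound 4 K L _ (647 / 800) (71 / 20)) => //; rewrite /BM_bound; lra.
- by apply: (@distance_le_bound 5 K L _ (859 / 1000) (9 / 2)) => //; rewrite /BM_bound; lra.
- by apply: (@distance_le_bound 6 K L _ (1067 / 1200) (11 / 2)) => //; rewrite /BM_bound; lra.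
- by apply: (@distance_le_bound 7 K L _ (1273 / 1400) (13 / 2)) => //; rewrite /BM_bound; lra.
- by apply: (@distance_le_bound 8 K L _ (1477 / 1600) (15 / 2)) => //; rewrite /BM_bound; lra.
set m := n.+4.+4.+1 in K L Kb Lb *.
have m9 : 9 <= m%:R :> R by rewrite ler_nat.
pose h : R := m%:R^-1.
have mh : m%:R * h = 1 by rewrite mulfV // gt_eqF //; lra.
have h0 : 0 < h by rewrite invr_gt0; lra.
have h9 : h <= 1 / 9 by rewrite -(ler_pM2l (_ : 0 < m%:R)) ?mh; lra.
have h2 : 0 <= h ^+ 2 by exact: sqr_ge0.
have hh : h ^+ 2 <= h / 9 by rewrite expr2 ler_pM2l //; lra.
apply: (@distance_le_bound m K L _ (1 - h / 2 - h ^+ 2) (m%:R - 1 / 2)) => //.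
- rewrite -[BM_bound m]/(m%:R ^+ 2 - m%:R + 1 / 2 + h).
  have -> : m%:R * (m%:R - (1 - h / 2 - h ^+ 2)) =
     m%:R ^+ 2 - m%:R + (m%:R * h) / 2 + (m%:R * h) * h by ring.
  by rewrite mh [1 * h]mul1r.
- by apply/andP; split; lra.
- have -> : (m%:R - 1 / 2) * (1 - (1 - h / 2 - h ^+ 2)) =
     (m%:R * h) / 2 + (m%:R * h) * h - h / 4 - h ^+ 2 / 2 by field.
  have := sqr_ge0 (h / 2 + h ^+ 2); rewrite mh; lra.
rewrite -[BM_bound m]/(m%:R ^+ 2 - m%:R + 1 / 2 + h); lra.
Qed.

Lemma BM_diameter_le n : (0 < n)%N -> (BM_diameter R n <= (BM_bound n)%:E)%E.
Proof.
move=> n0; apply: ge_ereal_sup => _ [K [L [Kb Lb ->]]].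
exact: BM_bound_distance.
Qed.

End Bound.

Theorem theorem1p6 (R : realType) :
  exists b : nat -> R,
    [/\ (forall n : nat, (0 < n)%N ->
          n%:R ^+ 2 - n%:R + 1 / 2 < b n
            < n%:R ^+ 2 - n%:R + 1 / 2 + 11 / (10 * n%:R)),
        (forall n : nat, (0 < n)%N ->
          forall K L : set 'cV[R]_n, convex_body K -> convex_body L ->
            (BM_distance K L <= (b n)%:E)%E),
        (BM_diameter R 2 <= (262 / 100)%:E)%E,
        (forall n : nat, (3 <= n <= 8)%N -> (BM_diameter R n <= (b n)%:E)%E) &
        [/\ `|b 3%N - 686 / 100| <= 1 / 200,
            `|b 4%N - 1276 / 100| <= 1 / 200,
            `|b 5%N - 2070 / 100| <= 1 / 200 &
            [/\ `|b 6%N - 3066 / 100| <= 1 / 200,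
                `|b 7%N - 4263 / 100| <= 1 / 200 &
                `|b 8%N - 5661 / 100| <= 1 / 200]]].
Proof.
exists (@BM_bound R); split.
- exact: BM_bound_range.
- by move=> n n0 K L; exact: BM_bound_distance.
- exact: (@BM_diameter_le R 2).
- by move=> n /andP[n3 _]; apply: BM_diameter_le; exact: leq_trans n3.
have near (x y : R) : x - y <= 1 / 200 -> y - x <= 1 / 200 -> `|x - y| <= 1 / 200.
  by move=> h1 h2; rewrite ler_norml; lra.
split; last split; apply: near; rewrite /BM_bound; lra.
Qed.
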